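(* Let $V$ be a finite-dimensional vector space over an algebraically closed field of characteristic $0$, and let $k$ be an integer with $3\le k\le \frac{\dim V}{2}$ and $\dim V\ge 7$. Then the singular locus of the secant variety of lines $\sigma_2(\mathrm{Gr}(k,V))\subset\mathbb P(\bigwedge^k V)$ is the Zariski closure of the distance-$2$ orbit: $$\mathrm{Sing}\big(\sigma_2(\mathrm{Gr}(k,V))\big)=\overline{\Sigma_{2,\mathrm{Gr}(k,V)}}.$$
   Context: $\mathrm{Gr}(k,V)\subset\mathbb P(\bigwedge^kV)$ is the Grassmannian of $k$-dimensional linear subspaces of $V$ in its Plücker embedding; a point $p=[v_1\wedge\dots\wedge v_k]$ corresponds to the subspace $H_p=\langle v_1,\dots,v_k\rangle$. The secant variety $\sigma_2(X)$ of $X\subset\mathbb P^M$ is the Zariski closure of the set of points lying in the span of at most two points of $X$ (with its reduced structure). The Hamming distance $d(p,q)$ of $p\neq q$ in $\mathrm{Gr}(k,V)$ is the minimum $r$ for which there exist $p=p_0,p_1,\dots,p_r=q$ in $\mathrm{Gr}(k,V)$ such that each line $\langle p_i,p_{i+1}\rangle$, $0\le i\le r-1$, is contained in $\mathrm{Gr}(k,V)$; $d(p,p)=0$. $\Sigma_{2,\mathrm{Gr}(k,V)}$ is the set of points $[u+v]\in\mathbb P(\bigwedge^kV)$ where $u,v\in\bigwedge^kV$ are nonzero decomposable vectors with $d([u],[v])=2$. *)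

(* Defs.v *)
From HB Require Import structures.
From mathcomp Require Import all_boot all_order all_algebra all_field.
From mathcomp Require Import all_fingroup boolp classical_sets.
From mathcomp Require Import mpoly.

Set Implicit Arguments.
Unset Strict Implicit.
Unset Printing Implicit Defensive.

Import GRing.Theory.
Local Open Scope ring_scope.
Local Open Scope classical_set_scope.

Section ProjectiveGeometry.
Variables (F : fieldType) (W : vectType F).

Definition proj : Type := {L : {vspace W} | \dim L == 1%N}.

(* Homogeneous coordinates of p, i.e. the coordinates of a nonzero vector
   on the line p.  The choice made by vpick is immaterial below, where only
   homogeneous polynomials are evaluated. *)
Definition hcoord (p : proj) : 'I_(\dim {:W}) -> F :=
  fun i => coord (vbasis {:W}) i (vpick (val p)).

Definition vanishes_at (f : {mpoly F[\dim {:W}]}) (p : proj) : Prop :=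
  f.@[hcoord p] = 0.

Definition homogeneous (f : {mpoly F[\dim {:W}]}) : Prop :=
  exists d : nat, f \is d.-homog.

Definition zclosed (Z : set proj) : Prop :=
  exists I : set {mpoly F[\dim {:W}]}, I `<=` homogeneous /\
    Z = [set p | forall f, I f -> vanishes_at f p].

Definition zclosure (A : set proj) : set proj :=
  \bigcap_(Z in [set Z | zclosed Z /\ A `<=` Z]) Z.

Definition zirreducible (Z : set proj) : Prop :=
  Z !=set0 /\
  forall Z1 Z2, zclosed Z1 -> zclosed Z2 ->
    Z `<=` Z1 `|` Z2 -> Z `<=` Z1 \/ Z `<=` Z2.

Definition span2 (p q : proj) : set proj :=
  [set x | (val x <= val p + val q)%VS].

Definition secant_variety (X : set proj) : set proj :=
  zclosure [set x | exists p q, [/\ X p, X q & span2 p q x]].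

(* The homogeneous elements of the ideal of X; as X is a bare set of points,
   this is the ideal of the reduced structure. *)
Definition vanishing_ideal (X : set proj) : set {mpoly F[\dim {:W}]} :=
  [set f | homogeneous f /\ forall p, X p -> vanishes_at f p].

(* U is the affine cone over the embedded projective tangent space to X at p:
   the common kernel of the differentials at (a representative of) p of the
   polynomials vanishing on X.  Hence dim T_p X = \dim U - 1. *)
Definition is_affine_tangent_space (X : set proj) (p : proj)
    (U : {vspace W}) : Prop :=
  forall v, v \in U <->
    forall f, vanishing_ideal X f ->
      \sum_(i < \dim {:W}) (f^`M(i)).@[hcoord p] * coord (vbasis {:W}) i v = 0.

Definition closed_chain (X : set proj) (p : proj) (d : nat) : Prop :=
  exists Z : nat -> set proj,
    [/\ Z 0%N p,
        forall i, (i <= d)%N ->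
          [/\ zclosed (Z i), zirreducible (Z i) & Z i `<=` X]
      & forall i, (i < d)%N -> Z i `<` Z i.+1].

(* The Krull dimension of the local ring of X at p is d: the primes of that
   ring correspond to the irreducible closed subsets of X through p. *)
Definition is_local_dim (X : set proj) (p : proj) (d : nat) : Prop :=
  closed_chain X p d /\ forall e, closed_chain X p e -> (e <= d)%N.

Definition regular_at (X : set proj) (p : proj) : Prop :=
  exists U d, [/\ is_affine_tangent_space X p U, is_local_dim X p d
                & \dim U = d.+1].

Definition Sing (X : set proj) : set proj :=
  [set p | X p /\ ~ regular_at X p].

End ProjectiveGeometry.

Section ExteriorPower.
Variables (F : fieldType) (V : vectType F) (k : nat).

Definition incr_index : finType :=
  {s : {ffun 'I_k -> 'I_(\dim {:V})} |
     [forall i : 'I_k, forall j : 'I_k, (i < j)%N ==> (s i < s j)%N]}.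

(* The k-th exterior power of V, in the coordinates given by the basis
   e_(s 0) /\ ... /\ e_(s (k-1)), for s strictly increasing and e the basis
   vbasis {:V} of V.  See extpow_universal. *)
Definition extpow : vectType F := {ffun incr_index -> F^o}.

Definition wedge (v : 'I_k -> V) : extpow :=
  [ffun s : incr_index =>
     \det (\matrix_(i < k, j < k) coord (vbasis {:V}) (val s j) (v i))].

Definition update (v : 'I_k -> V) (i : 'I_k) (x : V) : 'I_k -> V :=
  fun j => if j == i then x else v j.

Definition multilinear_alternating (U : vectType F) (f : ('I_k -> V) -> U) :
    Prop :=
  (forall v i, linear (fun x => f (update v i x))) /\
  (forall v i j, i != j -> v i = v j -> f v = 0).

Lemma wedge_multilinear_alternating : multilinear_alternating wedge.
Proof.
split=> [v i a x y|v i j ij vij]; apply/ffunP=> s; rewrite !ffunE; last first.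
  by apply: (determinant_alternate ij) => l; rewrite !mxE vij.
rewrite /GRing.scale /= -[X in _ = _ + X]mul1r.
apply: (@determinant_multilinear _ _ _ _ _ i).
- by apply/rowP=> j; rewrite !mxE /update eqxx linearP mul1r.
- by apply/matrixP=> l j; rewrite !mxE /update eq_sym (negPf (neq_lift _ _)).
- by apply/matrixP=> l j; rewrite !mxE /update eq_sym (negPf (neq_lift _ _)).
Qed.

Definition basis_vector (j : 'I_(\dim {:V})) : V := (vbasis {:V})`_j.
Local Notation e := basis_vector.

Lemma multilinear_alternating_tperm (U : vectType F) (f : ('I_k -> V) -> U) :
  multilinear_alternating f ->
  forall v i j, i != j -> f (v \o tperm i j) = - f v.
Proof.
move=> [fL fA] v i j ij; have ji : j != i by rewrite eq_sym.
pose g x y := f (update (update v i x) j y).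
have gE x y : g x y = f (update (update v j y) i x).
  congr f; apply/funext=> l; rewrite /update.
  by case: (eqVneq l j) => [->|//]; rewrite (negPf ji).
have gDr x y z : g x (y + z) = g x y + g x z.
  by have := fL (update v i x) j 1 y z; rewrite !scale1r.
have gDl x y z : g (x + y) z = g x z + g y z.
  by rewrite !gE; have := fL (update v j z) i 1 x y; rewrite !scale1r.
have g0 x : g x x = 0.
  by apply: (fA _ i j ij); rewrite /update eqxx (negPf ij) eqxx.
have -> : f v = g (v i) (v j).
  congr f; apply/funext=> l; rewrite /update.
  by case: eqP => [->//|_]; case: eqP => [->|].
have -> : f (v \o tperm i j) = g (v j) (v i).
  congr f; apply/funext=> l; rewrite /update /=.
  by case: tpermP => [->|->|/eqP/negPf-> /eqP/negPf->//];
    rewrite ?eqxx ?(negPf ij).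
by apply/eqP; rewrite -addr_eq0; have := g0 (v j + v i);
  rewrite gDr !gDl !g0 add0r addr0 addrC => ->.
Qed.

Lemma multilinear_alternating_eq0 (U : vectType F) (f : ('I_k -> V) -> U) :
  multilinear_alternating f ->
  (forall s : incr_index, f (e \o val s) = 0) -> forall v, f v = 0.
Proof.
move=> fP fs0; have [fL fA] := fP.
have f_perm (t : 'S_k) v : f v = 0 -> f (v \o t) = 0.
  have [ts -> /allP tsP] := prod_tpermP t.
  elim: ts tsP v => [|[a b] ts IH] tsP v fv0.
    rewrite big_nil (_ : v \o _ = v) //.
    by apply/funext=> i /=; rewrite perm1.
  rewrite big_cons (_ : v \o _ =
      (v \o (\prod_(t <- ts) tperm t.1 t.2)%g) \o tperm a b); last first.
    by apply/funext=> i /=; rewrite permM.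
  rewrite multilinear_alternating_tperm //; last first.
    by apply: (tsP (a, b)); rewrite mem_head.
  by rewrite IH ?oppr0 // => x xts; apply: tsP; rewrite inE xts orbT.
have fe (phi : 'I_k -> 'I_(\dim {:V})) : f (e \o phi) = 0.
  have [/injectiveP phi_inj|] := boolP (injectiveb phi); last first.
    by move=> /injectivePn[i [j ij pij]]; apply: (fA _ i j ij); rewrite /= pij.
  pose s := [tuple val (phi i) | i < k].
  have /tuple_permP[t st] : perm_eq (sort leq s) s.
    by rewrite perm_sort.
  have us : uniq s by rewrite map_inj_uniq ?enum_uniq // => i j /val_inj/phi_inj.
  have lts : sorted ltn (sort leq s).
    by rewrite ltn_sorted_uniq_leq sort_uniq us sort_sorted //; apply: leq_total.
  have nthE (i : 'I_k) : nth 0%N (sort leq s) i = phi (t i).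
    by rewrite st -tnth_nth !tnth_mktuple.
  have incr : [forall i : 'I_k, forall j : 'I_k, (i < j)%N ==>
      ([ffun i => phi (t i)] i < [ffun i => phi (t i)] j)%N].
    apply/forallP=> i; apply/forallP=> j; apply/implyP=> ij.
    rewrite !ffunE -!nthE; apply: (sorted_ltn_nth ltn_trans) => //;
    by rewrite inE size_sort size_tuple.
  pose s' : incr_index := Sub [ffun i => phi (t i)] incr.
  have := f_perm t^-1%g _ (fs0 s').
  congr (f _ = 0); apply/funext=> i /=.
  by rewrite ffunE permKV.
suff H m v : (m <= k)%N ->
    (forall i : 'I_k, (m <= i)%N -> exists j, v i = e j) -> f v = 0.
  by move=> v; apply: (H k) => // i; rewrite leqNgt ltn_ord.
elim: m v => [|m IH] v mk vP.
  have /choice[phi phiP] : forall i, exists j, v i = e j by move=> i; apply: vP.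
  by rewrite (_ : v = e \o phi) //; apply/funext=> i /=.
pose im := Ordinal mk; pose g x := f (update v im x).
have -> : f v = g (v im).
  by congr f; apply/funext=> l; rewrite /update; case: eqP => [->|].
have gD x y : g (x + y) = g x + g y.
  by have := fL v im 1 x y; rewrite !scale1r.
have g0 : g 0 = 0 by apply: (addIr (g 0)); rewrite -gD !add0r.
have gZ a x : g (a *: x) = a *: g x.
  by have := fL v im a x 0; rewrite -!/(g _) g0 !addr0.
rewrite (coord_vbasis (memvf (v im))) (big_morph g gD g0) big1 // => j _.
rewrite gZ [g _](IH _ (ltnW mk)) ?scaler0 // => i mi.
rewrite /update; case: (eqVneq i im) => [_|im_i]; first by exists j.
by apply: vP; rewrite ltn_neqAle mi andbT eq_sym.
Qed.

Lemma incr_index_inj (s : incr_index) : injective (val s).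
Proof.
have lt_s (i j : 'I_k) : (i < j)%N -> (val s i < val s j)%N.
  by have /forallP/(_ i)/forallP/(_ j)/implyP := valP s.
move=> i j sij; apply/ord_inj; have [ij|ji|//] := ltngtP i j.
  by have := lt_s _ _ ij; rewrite sij ltnn.
by have := lt_s _ _ ji; rewrite sij ltnn.
Qed.

Lemma incr_index_eq (s t : incr_index) :
  (forall i, exists j, val s i = val t j) -> s = t.
Proof.
move=> st; pose v (s : incr_index) := [tuple nat_of_ord (val s i) | i < k].
have v_sorted s' : sorted ltn (v s').
  apply/(sortedP 0%N) => i; rewrite size_tuple => ik.
  have vE (l : 'I_k) : nth 0%N (v s') l = val s' l.
    by rewrite -tnth_nth tnth_mktuple.
  have /forallP/(_ (Ordinal (ltnW ik)))/forallP/(_ (Ordinal ik))/implyP :=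
    valP s'.
  by rewrite -!vE; apply.
have v_uniq s' : uniq (v s') by apply: (sorted_uniq ltn_trans ltnn).
have sub : {subset v s <= v t}.
  move=> x /mapP[i _ ->]; have [j ->] := st i.
  by apply/mapP; exists j; rewrite ?mem_enum.
have [|_ eq_st] := uniq_min_size (v_uniq s) sub; first by rewrite !size_tuple.
have vst : v s = v t.
  by apply/val_inj; exact: (irr_sorted_eq ltn_trans ltnn (v_sorted s) (v_sorted t) eq_st).
apply/val_inj/ffunP=> i; apply/ord_inj.
by have := congr1 (fun u => tnth u i) vst; rewrite !tnth_mktuple.
Qed.

Lemma wedge_basis (s : incr_index) :
  wedge (e \o val s) = [ffun t => (s == t)%:R].
Proof.
apply/ffunP=> t; rewrite !ffunE.
have eE i j : coord (vbasis {:V}) i (e j) = (i == j)%:R.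
  by rewrite /basis_vector coord_free ?(basis_free (vbasisP _)) // eq_sym.
have [<-|st] := eqVneq s t.
  rewrite -[RHS](det1 _ k); congr (\det _); apply/matrixP=> i j.
  by rewrite !mxE eE (inj_eq (@incr_index_inj s)) eq_sym.
have [i sti] : exists i, forall j, val s i != val t j.
  apply: contrapT => /forallNP nst; case/eqP: st; apply: incr_index_eq => i.
  have /existsNP[j /negP] := nst i; rewrite negbK => /eqP.
  by exists j.
rewrite (expand_det_row _ i) big1 // => j _.
by rewrite !mxE eE eq_sym (negPf (sti j)) mul0r.
Qed.

Lemma extpow_universal :
  multilinear_alternating wedge /\
  forall (U : vectType F) (f : ('I_k -> V) -> U), multilinear_alternating f ->
    exists! g : 'Hom(extpow, U), forall v, g (wedge v) = f v.
Proof.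
split=> [|U f fP]; first exact: wedge_multilinear_alternating.
have wE (w : extpow) : w = \sum_s (w s : F) *: wedge (e \o val s).
  apply/ffunP=> t; rewrite sum_ffunE (bigD1 t) //= big1 => [|s st].
    by rewrite wedge_basis !ffunE eqxx addr0 /GRing.scale /= mulr1.
  by rewrite wedge_basis !ffunE (negPf st) /GRing.scale /= mulr0.
pose g0 (w : extpow) := \sum_s (w s : F) *: f (e \o val s).
have g0L : linear g0.
  move=> a x y; rewrite /g0 scaler_sumr -big_split /=; apply: eq_bigr => s _.
  by rewrite !ffunE scalerDl scalerA.
pose g0M := GRing.isLinear.Build F extpow U *:%R g0 g0L.
pose g0l : {linear extpow -> U} := HB.pack g0 g0M.
exists (linfun g0l); split=> [v|g gf].
  rewrite lfunE /=; apply/eqP; rewrite -subr_eq0; apply/eqP.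
  apply: (@multilinear_alternating_eq0 U (fun v => g0 (wedge v) - f v)).
    have [[wL wA] [fL fA]] := (wedge_multilinear_alternating, fP).
    split=> [u i a x y|u i j ij uij].
      by rewrite wL fL g0L scalerBr opprD addrACA.
    rewrite (wA _ i j) // (fA _ i j) // subr0 /g0 big1 // => s _.
    by rewrite ffunE scale0r.
  move=> s; apply/eqP; rewrite subr_eq0 /g0 (bigD1 s) //= big1 => [|t ts].
    by rewrite wedge_basis ffunE eqxx scale1r addr0.
  by rewrite wedge_basis ffunE eq_sym (negPf ts) scale0r.
apply/lfunP=> w; rewrite lfunE /= /g0 {2}[w]wE linear_sum.
by apply: eq_bigr => s _; rewrite linearZ /= gf.
Qed.

Definition decomposable (w : extpow) : Prop := exists v, w = wedge v.

Definition Gr : set (proj extpow) :=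
  [set p | exists (H : {vspace V}) (v : k.-tuple V),
     [/\ \dim H = k, basis_of H v & val p = <[wedge (tnth v)]>%VS]].

Definition line_path (r : nat) (p q : proj extpow) : Prop :=
  exists c : nat -> proj extpow,
    [/\ c 0%N = p, c r = q, forall i, (i <= r)%N -> Gr (c i)
      & forall i, (i < r)%N -> span2 (c i) (c i.+1) `<=` Gr].

Definition is_hamming_dist (p q : proj extpow) (r : nat) : Prop :=
  line_path r p q /\ forall s, line_path s p q -> (r <= s)%N.

Definition Sigma2 : set (proj extpow) :=
  [set x | exists (u v : extpow) (p q : proj extpow),
     [/\ u != 0 /\ v != 0, decomposable u /\ decomposable v,
         val p = <[u]>%VS /\ val q = <[v]>%VS,
         is_hamming_dist p q 2 & val x = <[u + v]>%VS]].

End ExteriorPower.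

Arguments Gr [F] V k _.
Arguments Sigma2 [F] V k _.

(* Main.v *)
(* A point x of the secant variety is a limit of sums wdg A + wdg B, where wdg A
   is the wedge of the rows of A.  Evaluating x on k-tuples of covectors (frames)
   gives quadratic and cubic forms c2, c3 in x which, on wdg A + wdg B and a frame
   dual to A and B, are multiples of the 2- and 3-minors of A - B.

   If some c3 does not vanish at x, a parametrization of the secant variety by an
   affine space of dimension 2k(n-k)+1 has a polynomial inverse, up to a denominator
   which can be made nonzero at x by moving the frame, so x is a regular point.  If
   all the c3 vanish at x, the quadratic relations between the c2 force
   x = wdg A + wdg B with A and B differing in two rows only, which is a limit of
   points of Sigma2.

   Conversely, a point of Sigma2 is (a1 ^ a2 + b1 ^ b2) ^ l with independent vectors,
   and the different ways of writing a1 ^ a2 + b1 ^ b2 as a sum of two bivectors give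
   6 + 4a + 4b + 6ab independent tangent vectors, a = k-2, b = n-k-2.  This is larger
   than 2k(n-k)+2 as ab >= 2, and the tangent dimension is upper semicontinuous
   whereas the local dimension is at most 2k(n-k)+1. *)

(* The forms [c2] and [c3] are homogenized cumulants. On a frame, wdg A + wdg B acts as a
   distribution with two atoms, whose masses are the values of the two summands; [x1], [x2], [x3]
   are its moments, with exterior in place of symmetric products. Second and third cumulants see the
   atoms through A - B only, the third one with a factor be - al besides al * be. This is why frames
   have to be moved: the masses depend on the frame and may happen to be equal. In the same way the
   chart coordinates are the mean M, a direction D scaled so that the second and third central
   moments agree in units of D, and their common value d. A point of the closure is not known to be
   a sum of two decomposable vectors, so properties of such sums enter as polynomial identities
   carried over by Zariski density. With k = a+2 and n = a+b+4 the tangent count exceeds 2k(n-k)+2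
   by 4(ab-1). This is zero for a = b = 1, that is for Gr(3,6), whose secant variety is the whole
   projective space; hence the bound dim V >= 7. *)
From HB Require Import structures.
Require Import Defs.
From mathcomp Require Import all_boot all_order all_algebra all_field.
From mathcomp Require Import all_fingroup boolp classical_sets.
From mathcomp Require Import mpoly ring zify.

Set Implicit Arguments.
Unset Strict Implicit.
Unset Printing Implicit Defensive.

Import GRing.Theory.
Local Open Scope ring_scope.

(** * Polynomial functions *)

Section PolynomialFunctions.
Variable F : fieldType.

Lemma mpoly_ring_ind n (P : {mpoly F[n]} -> Prop) :
  (forall c, P c%:MP) -> (forall i, P 'X_i) ->
  (forall p q, P p -> P q -> P (p + q)) ->
  (forall p q, P p -> P q -> P (p * q)) -> forall p, P p.
Proof.
move=> PC PX PD PM; elim/mpolyind=> [|c m p _ _ IH]; first by rewrite -mpolyC0.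
apply: (PD) IH; rewrite -mul_mpolyC; apply: (PM) => //.
rewrite mpolyXE_id; elim/big_ind: _ => [||i _]; [exact: (PC 1)|by move=> *; apply: (PM)|].
by elim: (m i) => [|j IHj]; rewrite ?expr0 ?exprS; [exact: (PC 1)|apply: (PM)].
Qed.

Definition mev (U : vectType F) (p : {mpoly F[\dim {:U}]}) (v : U) : F :=
  p.@[fun i => coord (vbasis {:U}) i v].

(** Polynomiality is attached to functions on a vector space, so that pairs of matrices and frames
    can serve as parameter spaces without coordinates being chosen on them. *)
Definition pfun (U : vectType F) (f : U -> F) : Prop :=
  exists p, forall v, f v = mev p v.

Definition pmap (U W : vectType F) (f : U -> W) : Prop :=
  forall i, pfun (fun u => coord (vbasis {:W}) i (f u)).

Lemma coord_sum (U : vectType F) (v : U) :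
  v = \sum_(i < \dim {:U}) coord (vbasis {:U}) i v *: (vbasis {:U})`_i.
Proof. exact: coord_vbasis (memvf v). Qed.

Lemma coord_inj (U : vectType F) (v w : U) :
  (forall i, coord (vbasis {:U}) i v = coord (vbasis {:U}) i w) -> v = w.
Proof. by move=> vw; rewrite (coord_sum v) (coord_sum w); under eq_bigr do rewrite vw. Qed.

Lemma eq_pfun (U : vectType F) (f g : U -> F) : f =1 g -> pfun f -> pfun g.
Proof. by move=> fg [p fp]; exists p => v; rewrite -fg. Qed.

Lemma pfun_mev (U : vectType F) (p : {mpoly F[\dim {:U}]}) : pfun (mev p).
Proof. by exists p. Qed.

Lemma pfunC (U : vectType F) (c : F) : pfun (fun _ : U => c).
Proof. by exists c%:MP => v; rewrite /mev mevalC. Qed.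

Lemma pfunD (U : vectType F) (f g : U -> F) :
  pfun f -> pfun g -> pfun (fun v => f v + g v).
Proof. by move=> [p fp] [q gq]; exists (p + q) => v; rewrite /mev mevalD fp gq. Qed.

Lemma pfunM (U : vectType F) (f g : U -> F) :
  pfun f -> pfun g -> pfun (fun v => f v * g v).
Proof. by move=> [p fp] [q gq]; exists (p * q) => v; rewrite /mev mevalM fp gq. Qed.

Lemma pfunN (U : vectType F) (f : U -> F) : pfun f -> pfun (fun v => - f v).
Proof. by move=> [p fp]; exists (- p) => v; rewrite /mev mevalN fp. Qed.

Lemma pfunB (U : vectType F) (f g : U -> F) :
  pfun f -> pfun g -> pfun (fun v => f v - g v).
Proof. by move=> pf pg; apply: pfunD => //; apply: pfunN. Qed.

Lemma pfunX (U : vectType F) (f : U -> F) n : pfun f -> pfun (fun v => f v ^+ n).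
Proof. by move=> [p fp]; exists (p ^+ n) => v; rewrite /mev rmorphXn /= fp. Qed.

Lemma pfun_sum (U : vectType F) (I : Type) (r : seq I) (P : pred I)
    (f : I -> U -> F) :
  (forall i, P i -> pfun (f i)) -> pfun (fun v => \sum_(i <- r | P i) f i v).
Proof.
move=> pf; elim: r => [|i r IH].
  by apply: eq_pfun (pfunC U 0) => v; rewrite big_nil.
case Pi: (P i).
  by apply: eq_pfun (pfunD (pf i Pi) IH) => v; rewrite big_cons Pi.
by apply: eq_pfun IH => v; rewrite big_cons Pi.
Qed.

Lemma pfun_prod (U : vectType F) (I : Type) (r : seq I) (P : pred I)
    (f : I -> U -> F) :
  (forall i, P i -> pfun (f i)) -> pfun (fun v => \prod_(i <- r | P i) f i v).
Proof.
move=> pf; elim: r => [|i r IH].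
  by apply: eq_pfun (pfunC U 1) => v; rewrite big_nil.
case Pi: (P i).
  by apply: eq_pfun (pfunM (pf i Pi) IH) => v; rewrite big_cons Pi.
by apply: eq_pfun IH => v; rewrite big_cons Pi.
Qed.

Lemma pfun_det (U : vectType F) n (A : U -> 'M[F]_n) :
  (forall i j, pfun (fun v => A v i j)) -> pfun (fun v => \det (A v)).
Proof.
move=> pA; apply: pfun_sum => s _; apply: pfunM; first exact: pfunC.
by apply: pfun_prod => i _; apply: pA.
Qed.

Lemma pfun_linear (U : vectType F) (f : U -> F) :
  (forall a u v, f (a *: u + v) = a * f u + f v) -> pfun f.
Proof.
move=> fL; exists (\sum_(i < \dim {:U}) f (vbasis {:U})`_i *: 'X_i) => v.
have fD u w : f (u + w) = f u + f w by have := fL 1 u w; rewrite scale1r mul1r.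
have f0 : f 0 = 0 by apply: (addIr (f 0)); rewrite -fD !add0r.
have fZ a u : f (a *: u) = a * f u by have := fL a u 0; rewrite f0 !addr0.
rewrite /mev raddf_sum /= {1}(coord_sum v) (big_morph f fD f0).
by apply: eq_bigr => i _; rewrite fZ mevalZ mevalXU mulrC.
Qed.

Lemma pfun_comp (U W : vectType F) (f : W -> F) (g : U -> W) :
  pmap g -> pfun f -> pfun (fun u => f (g u)).
Proof.
move=> /choice[q gq] [p fp]; exists (p \mPo [tuple q i | i < \dim {:W}]) => u.
rewrite fp /mev comp_mpoly_meval; apply: meval_eq => i.
by rewrite tnth_mktuple gq.
Qed.

Lemma pmap_comp (U W Z : vectType F) (f : W -> Z) (g : U -> W) :
  pmap g -> pmap f -> pmap (fun u => f (g u)).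
Proof. by move=> pg pf i; have := pfun_comp pg (pf i). Qed.

Lemma pfun_pmap (U W : vectType F) (f : U -> W) (l : W -> F) :
  (forall a u v, l (a *: u + v) = a * l u + l v) -> pmap f ->
  pfun (fun u => l (f u)).
Proof. by move=> lL pf; apply: (pfun_comp pf); apply: pfun_linear. Qed.

Lemma pmap_linear (U W : vectType F) (f : U -> W) : linear f -> pmap f.
Proof. by move=> fL i; apply: pfun_linear => a u v; rewrite fL linearP. Qed.

Lemma pmapD (U W : vectType F) (f g : U -> W) :
  pmap f -> pmap g -> pmap (fun u => f u + g u).
Proof.
move=> pf pg i; have := pfunD (pf i) (pg i); apply: eq_pfun => v.
by rewrite linearD.
Qed.

Lemma pmapZ (U W : vectType F) (c : U -> F) (g : U -> W) :
  pfun c -> pmap g -> pmap (fun u => c u *: g u).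
Proof.
move=> pc pg i; have := pfunM pc (pg i); apply: eq_pfun => v.
by rewrite linearZ.
Qed.

Lemma pmapC (U W : vectType F) (w : W) : pmap (fun _ : U => w).
Proof. by move=> i; apply: pfunC. Qed.

Lemma pmap_sum (U W : vectType F) (I : Type) (r : seq I) (P : pred I)
    (f : I -> U -> W) :
  (forall i, P i -> pmap (f i)) -> pmap (fun v => \sum_(i <- r | P i) f i v).
Proof.
move=> pf j; have := pfun_sum r (fun i Pi => pf i Pi j); apply: eq_pfun => v.
by rewrite linear_sum.
Qed.

Lemma pmap_basis (U W : vectType F) (I : finType) (f : U -> W) (b : I -> W)
    (c : I -> U -> F) :
  (forall u, f u = \sum_i c i u *: b i) -> (forall i, pfun (c i)) -> pmap f.
Proof.
move=> fE pc j; rewrite (funext fE); apply: pmap_sum => i _.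
by apply: pmapZ (pmapC _ _).
Qed.

Lemma pmap_id (U : vectType F) : pmap (@id U).
Proof. by apply: pmap_linear. Qed.

Lemma pmap_mx (U : vectType F) m n (A : U -> 'M[F]_(m, n)) :
  (forall i j, pfun (fun u => A u i j)) -> pmap A.
Proof.
move=> pA; apply: (@pmap_basis _ _ ('I_m * 'I_n)%type _
  (fun ij => delta_mx ij.1 ij.2) (fun ij u => A u ij.1 ij.2)) => [u|ij]; last exact: pA.
by rewrite [LHS]matrix_sum_delta pair_bigA.
Qed.

Lemma pmap_ffun (U : vectType F) (I : finType) (f : U -> {ffun I -> F^o}) :
  (forall i, pfun (fun u => f u i)) -> pmap f.
Proof.
move=> pf; apply: (@pmap_basis _ _ I _ (fun i => [ffun j => (i == j)%:R])
  (fun i u => f u i)) => // u; apply/ffunP=> j.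
rewrite sum_ffunE (bigD1 j) //= big1 => [|i ij].
  by rewrite !ffunE eqxx addr0 /GRing.scale /= mulr1.
by rewrite !ffunE (negPf ij) /GRing.scale /= mulr0.
Qed.

Lemma pmap_pair (U W Z : vectType F) (f : U -> W) (g : U -> Z) :
  pmap f -> pmap g -> pmap (fun u => (f u, g u)).
Proof.
move=> pf pg; rewrite (_ : (fun u => _) = fun u => (f u, 0) + (0, g u)); last first.
  by apply/funext=> u; congr (_, _); rewrite /= ?addr0 ?add0r.
apply: pmapD.
  apply: (@pmap_comp _ _ _ (fun w => (w, 0 : Z)) f pf).
  by apply: pmap_linear => a u v; congr (_, _); rewrite /= ?scaler0 ?addr0.
apply: (@pmap_comp _ _ _ (fun w => (0 : W, w)) g pg).
by apply: pmap_linear => a u v; congr (_, _); rewrite /= ?scaler0 ?addr0.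
Qed.

Lemma pmap_scalar (U : vectType F) (f : U -> F) : pfun f -> pmap (f : U -> F^o).
Proof.
move=> pf i; have := pfunM pf (pfunC U (coord (vbasis {:F^o}) i 1)).
by apply: eq_pfun => u; rewrite -[in RHS](mulr1 (f u)) -[f u * 1]/(f u *: (1 : F^o)) linearZ.
Qed.

(** The restriction of p to the line x + s *: v, as a polynomial in s. Its values serve the
    genericity arguments, its derivative at 0 is the differential of p. *)
Definition pline (U : vectType F) (p : {mpoly F[\dim {:U}]}) (x v : U) : {poly F} :=
  mmap polyC (fun i => (coord (vbasis {:U}) i x)%:P + coord (vbasis {:U}) i v *: 'X) p.

Lemma horner_pline (U : vectType F) (p : {mpoly F[\dim {:U}]}) (x v : U) s :
  (pline p x v).[s] = mev p (x + s *: v).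
Proof.
rewrite /pline /mev; elim/mpoly_ring_ind: p => [c|i|p q IHp IHq|p q IHp IHq].
- by rewrite mmapC mevalC hornerC.
- rewrite mmapX mmap1U mevalXU !hornerE linearD linearZ /=.
  by rewrite /GRing.scale /= mulrC.
- by rewrite raddfD /= hornerD IHp IHq mevalD.
- by rewrite rmorphM /= hornerM IHp IHq mevalM.
Qed.

Definition dmev (U : vectType F) (p : {mpoly F[\dim {:U}]}) (x v : U) : F :=
  \sum_(i < \dim {:U}) (p^`M(i)).@[fun j => coord (vbasis {:U}) j x] *
    coord (vbasis {:U}) i v.

Lemma deriv_pline (U : vectType F) (p : {mpoly F[\dim {:U}]}) (x v : U) :
  (pline p x v)^`().[0] = dmev p x v.
Proof.
have h0 q : (pline q x v).[0] = q.@[fun j => coord (vbasis {:U}) j x].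
  by rewrite horner_pline scale0r addr0.
rewrite /dmev; elim/mpoly_ring_ind: p => [c|i|p q IHp IHq|p q IHp IHq].
- rewrite /pline mmapC derivC horner0 big1 // => i _.
  by rewrite mderivC meval0 mul0r.
- rewrite /pline mmapX mmap1U derivD derivC derivZ derivX !hornerE.
  rewrite (bigD1 i) //= big1 => [|j ji]; rewrite mderivX mnm1E.
    by rewrite eqxx scale1r (_ : (U_(i) - U_(i))%MM = 0%MM) ?mpolyX0 ?meval1 ?mul1r ?addr0 //; apply/mnmP=> j; rewrite mnmBE subnn mnm0E.
  by rewrite eq_sym (negPf ji) scale0r meval0 mul0r.
- rewrite [pline _ _ _]raddfD /= derivD hornerD IHp IHq -big_split /=.
  by apply: eq_bigr => i _; rewrite mderivD mevalD mulrDl.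
- rewrite [pline _ _ _]rmorphM /= derivM hornerD !hornerM IHp IHq !h0.
  rewrite big_distrl big_distrr -big_split /=.
  apply: eq_bigr => i _; rewrite mderivM mevalD !mevalM mulrDl.
  by rewrite mulrAC mulrA.
Qed.

Hypothesis F0 : [pchar F] =i pred0.

Lemma natr_char0_inj : injective (fun i : nat => i%:R : F).
Proof.
move=> i j; wlog ij : i j / (i <= j)%N.
  by move=> H ij; have [/H->//|/ltnW/H/(_ (esym ij))] := leqP i j.
move=> /eqP; rewrite eq_sym -subr_eq0 -natrB //; move/pcharf0P: F0 => ->.
by rewrite subn_eq0 => ji; apply/eqP; rewrite eqn_leq ij ji.
Qed.

Lemma natr_char0_neq0 i : (i != 0)%N -> (i%:R : F) != 0.
Proof. by move=> i0; apply: contra_neq i0 => /(@natr_char0_inj i 0). Qed.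

(** Characteristic 0 supplies as many distinct integers as needed, more than a nonzero polynomial of
    this size has roots. *)
Lemma poly_eq0 (r : {poly F}) : (forall s, r.[s] = 0) -> r = 0.
Proof.
move=> r0; apply/eqP/negPn/negP => rN0.
have := @max_poly_roots _ r [seq i%:R | i <- iota 0 (size r)] rN0.
rewrite size_map size_iota ltnn.
have -> // : all (root r) [seq i%:R | i <- iota 0 (size r)].
  by apply/allP=> x /mapP[i _ ->]; apply/rootP.
suff -> : uniq [seq (i%:R : F) | i <- iota 0 (size r)] by move=> /(_ isT isT).
by rewrite map_inj_uniq ?iota_uniq //; apply: natr_char0_inj.
Qed.

Lemma poly_neq0 (r : {poly F}) : r != 0 -> exists s, r.[s] != 0.
Proof.
move=> rN0; apply: contrapT => /forallNP r0; case/eqP: rN0; apply: poly_eq0 => s.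
by apply/eqP/negPn/negP; apply: r0.
Qed.

Lemma pfun_line (U : vectType F) (f : U -> F) (x v : U) :
  pfun f -> exists r : {poly F}, forall s, f (x + s *: v) = r.[s].
Proof. by move=> [p fp]; exists (pline p x v) => s; rewrite fp horner_pline. Qed.

(** Irreducibility of affine space, seen on a line: the restrictions to the line through x and y are
    nonzero polynomials in one variable, hence so is their product, which has a non-root. *)
Lemma pfun_generic (U : vectType F) (f g : U -> F) (x y : U) :
  pfun f -> pfun g -> f x != 0 -> g y != 0 ->
  exists s, f (x + s *: (y - x)) != 0 /\ g (x + s *: (y - x)) != 0.
Proof.
move=> pf pg fx gy; have [r fr] := pfun_line x (y - x) pf.
have [q gq] := pfun_line x (y - x) pg.
have rN0 : r != 0.
  by apply: contra_neq fx => r0; have := fr 0; rewrite scale0r addr0 r0 horner0.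
have qN0 : q != 0.
  apply: contra_neq gy => q0; have := gq 1.
  by rewrite scale1r [x + _]addrC subrK q0 horner0.
have [s] := poly_neq0 (mulf_neq0 rN0 qN0); rewrite hornerM mulf_eq0 negb_or.
by case/andP=> rs qs; exists s; rewrite fr gq.
Qed.

(** The density argument used throughout: a polynomial identity is checked on an open set only, and
    y shows that this set is not empty. *)
Lemma pfun_eq0_generic (U : vectType F) (f g : U -> F) (y : U) :
  pfun f -> pfun g -> g y != 0 -> (forall u, g u != 0 -> f u = 0) ->
  forall u, f u = 0.
Proof.
move=> pf pg gy fg u; apply/eqP/negPn/negP => fu.
have [s [fs gs]] := pfun_generic pf pg fu gy.
by rewrite fg // eqxx in fs.
Qed.

End PolynomialFunctions.

(** * Cones and Zariski closure *)

Section Cones.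
Variables (F : fieldType) (W : vectType F).
Local Open Scope classical_set_scope.
Implicit Types (f g : {mpoly F[\dim {:W}]}) (p q : proj W) (A X Z : set (proj W)).

Definition rep p : W := vpick (val p).

Lemma rep_neq0 p : rep p != 0.
Proof.
rewrite /rep vpick0; apply: contraTneq (valP p) => p0.
by rewrite p0 dimv0.
Qed.

Lemma val_rep p : val p = <[rep p]>%VS.
Proof.
apply/esym/eqP; rewrite eqEdim; apply/andP; split.
  by apply: memv_pick.
by rewrite (eqP (valP p)) dim_vline rep_neq0.
Qed.

Lemma mem_rep p : rep p \in val p.
Proof. exact: memv_pick. Qed.

Definition point (v : W) (v0 : v != 0) : proj W.
Proof. by exists <[v]>%VS; rewrite dim_vline v0. Defined.

Lemma val_point p (v : W) : v != 0 -> v \in val p -> val p = <[v]>%VS.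
Proof.
move=> v0; rewrite val_rep => /vlineP[s vE]; apply/eqP; rewrite eqEdim.
rewrite !dim_vline v0 rep_neq0 leqnn andbT -memvE.
have s0 : s != 0 by apply: contraNneq v0 => s0; rewrite vE s0 scale0r.
by apply/vlineP; exists s^-1; rewrite vE scalerA mulVf ?scale1r.
Qed.

Lemma mev_homog d f s (v : W) : f \is d.-homog ->
  mev f (s *: v) = s ^+ d * mev f v.
Proof.
move=> /dhomogP fd; rewrite /mev !mevalE big_distrr /= !big_seq.
apply: eq_bigr => m mf; rewrite mulrCA; congr (_ * _).
have <- : mdeg m = d by apply: fd.
rewrite mdegE expr_sum -big_split /=.
by apply: eq_bigr => i _; rewrite linearZ /= exprMn.
Qed.

Lemma vanishes_at_line f p (v : W) : homogeneous f -> vanishes_at f p ->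
  v \in val p -> mev f v = 0.
Proof.
move=> [d fd] fp; rewrite val_rep => /vlineP[s ->].
by rewrite (mev_homog _ _ fd) [mev f _]fp mulr0.
Qed.

Lemma vanishes_at_rep f p (v : W) : homogeneous f -> v != 0 -> v \in val p ->
  mev f v = 0 -> vanishes_at f p.
Proof.
move=> [d fd] v0 vp fv0; have := mem_rep p.
by rewrite (val_point v0 vp) => /vlineP[s E]; rewrite /vanishes_at -/(mev f _) [vpick _]E (mev_homog _ _ fd) fv0 mulr0.
Qed.

(** Vanishing on the affine cone over X, for functions that need not be homogeneous. The zero vector
    of each line is included. *)
Definition cvanish X (G : W -> F) : Prop :=
  forall p v, X p -> v \in val p -> G v = 0.

Lemma vanishing_cvanish X f : vanishing_ideal X f -> cvanish X (mev f).
Proof. by move=> [hf f0] p v Xp; apply: vanishes_at_line => //; apply: f0. Qed.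

Lemma cvanish_vanishing X f : homogeneous f -> cvanish X (mev f) ->
  vanishing_ideal X f.
Proof. by move=> hf f0; split=> // p Xp; apply: (f0 p) => //; apply: mem_rep. Qed.

Local Notation comp d f := (pihomog mdeg d f).

Lemma homog_comp d f : homogeneous (comp d f).
Proof. by exists d; apply: pihomogP. Qed.

Lemma mev_comp f s (v : W) :
  mev f (s *: v) = \sum_(d < msize f) s ^+ d * mev (comp d f) v.
Proof.
rewrite [in LHS](pihomog_partitionE (leqnn (msize f))).
rewrite /mev raddf_sum /=; apply: eq_bigr => d _.
by have := mev_homog s v (pihomogP mdeg d f).
Qed.

Hypothesis F0 : [pchar F] =i pred0.

(** Along the line through v the value of f is a polynomial in s, whose coefficients are the values
    at v of the homogeneous components. *)
Lemma comp_cone f (v : W) : (forall s, s != 0 -> mev f (s *: v) = 0) ->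
  forall d, mev (comp d f) v = 0.
Proof.
move=> f0 d; have [dk|kd] := ltnP d (msize f); last first.
  by rewrite pihomogE /mev big_seq_cond big1 ?meval0 // => m /andP[/msize_mdeg_lt];
    rewrite ltnNge => /negP H /eqP E; case: H; rewrite E.
pose r := \poly_(i < msize f) mev (comp i f) v.
have r0 : r = 0.
  (* The factor 'X takes care of s = 0, where nothing is assumed on f. *)
  suff : 'X * r = 0 by move/eqP; rewrite mulf_eq0 polyX_eq0 => /eqP.
  apply: (poly_eq0 F0) => s; rewrite hornerM hornerX.
  have [->|s0] := eqVneq s 0; rewrite ?mul0r // -[RHS](mulr0 s); congr (_ * _).
  rewrite horner_poly -[RHS](f0 s s0) mev_comp.
  by apply: eq_bigr => i _; rewrite mulrC.
by have := congr1 (fun q : {poly F} => q`_d) r0; rewrite coef_poly dk coef0.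
Qed.

Lemma cvanish_comp X f d : cvanish X (mev f) -> vanishing_ideal X (comp d f).
Proof.
move=> f0; apply: cvanish_vanishing; first exact: homog_comp.
move=> p v Xp vp; apply: comp_cone => s _; apply: (f0 p) => //.
exact: memvZ.
Qed.

Lemma zclosureP A p : zclosure A p <->
  forall f, homogeneous f -> (forall q, A q -> vanishes_at f q) -> vanishes_at f p.
Proof.
split=> [Ap f hf fA|H Z [[I [hI ->]] AZ] f If]; last first.
  by apply: H => [|q /AZ]; [exact: hI|apply].
have := Ap [set q | vanishes_at f q]; apply; split=> [|q /fA//].
exists [set f]; split=> [g ->//|]; apply/seteqP; split=> q /=.
  by move=> fq g ->.
by apply.
Qed.

Lemma subset_zclosure A : A `<=` zclosure A.
Proof. by move=> p Ap; apply/zclosureP => f _; apply. Qed.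

Lemma zclosed_zclosure A : zclosed (zclosure A).
Proof.
exists [set f | homogeneous f /\ forall q, A q -> vanishes_at f q].
split=> [f []//|]; apply/seteqP; split=> p.
  by move=> /zclosureP H f [? ?]; apply: H.
by move=> H; apply/zclosureP => f hf fA; apply: H.
Qed.

Lemma zclosure_sub A Z : zclosed Z -> A `<=` Z -> zclosure A `<=` Z.
Proof. by move=> cZ AZ p; apply. Qed.

(** The homogeneous components of G vanish on A separately, so they belong to the equations of the
    closure. *)
Lemma cvanish_closure A (G : W -> F) : pfun G -> cvanish A G ->
  cvanish (zclosure A) G.
Proof.
move=> [f Gf] GA p v /zclosureP Ap vp.
have fA : cvanish A (mev f) by move=> q w Aq wq; rewrite -Gf; apply: GA wq.
rewrite Gf -[v]scale1r mev_comp big1 // => d _.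
have [hf f0] := cvanish_comp d fA.
by rewrite (vanishes_at_line hf _ vp) ?mulr0 //; apply: Ap.
Qed.

Lemma zclosure_pfun A p (v : W) : v != 0 -> v \in val p ->
  (forall G : W -> F, pfun G -> cvanish A G -> G v = 0) -> zclosure A p.
Proof.
move=> v0 vp H; apply/zclosureP => f hf fA.
apply: (vanishes_at_rep hf v0 vp); apply: H; first by exists f.
exact: (vanishing_cvanish (conj hf fA)).
Qed.

Lemma zclosed_pfun Z p : zclosed Z -> ~ Z p ->
  exists f, [/\ homogeneous f, forall q, Z q -> vanishes_at f q & ~ vanishes_at f p].
Proof.
move=> [I [hI ->]] /= /existsNP[f /not_implyP[If fp]]; exists f; split=> //.
  exact: hI.
by move=> q; apply.
Qed.

(** Primality of the ideal of an irreducible set. At a point where f is nonzero, G vanishes on the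
    whole punctured line, hence so do its homogeneous components, and irreducibility applies to f
    and each component. *)
Lemma zirreducible_cvanish Z f (G : W -> F) : zirreducible Z -> homogeneous f ->
  pfun G -> ~ (forall p, Z p -> vanishes_at f p) ->
  cvanish Z (fun v => mev f v * G v) -> cvanish Z G.
Proof.
move=> [Z0 Zirr] hf [h Gh] fZ fG p v Zp vp; rewrite Gh -[v]scale1r mev_comp big1 // => d _.
suff H : forall q, Z q -> vanishes_at (comp d h) q.
  by rewrite (vanishes_at_line (homog_comp d h) (H p Zp) vp) mulr0.
pose V g := [set q | vanishes_at g q].
have cV g : homogeneous g -> zclosed (V g).
  move=> hg; exists [set g]; split=> [_ ->//|]; apply/seteqP; split=> q /=.
    by move=> gq _ ->.
  by apply.
suff ZV : Z `<=` V f `|` V (comp d h).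
  by have [//|] := Zirr (V f) (V (comp d h)) (cV _ hf) (cV _ (homog_comp d h)) ZV.
move=> q Zq.
have [f0|/eqP f0] := pselect (mev f (rep q) = 0); [by left|right].
apply: comp_cone => s s0; have [e fe] := hf.
have /eqP := fG q _ Zq (memvZ s (mem_rep q)).
by rewrite (mev_homog _ _ fe) !mulf_eq0 expf_eq0 (negPf s0) andbF (negPf f0) /= -Gh => /eqP.
Qed.

End Cones.

(** * Upper bound for the length of chains *)

Section ChainBound.
Variables (F : fieldType) (F0 : [pchar F] =i pred0).
Local Open Scope classical_set_scope.

Fixpoint exponents (d e : nat) : seq (seq nat) :=
  if e is e'.+1 then [seq a :: s | a <- iota 0 d, s <- exponents d e'] else [:: [::]].

Lemma size_exponents d e : size (exponents d e) = (d ^ e)%N.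
Proof. by elim: e => //= e IH; rewrite size_allpairs IH size_iota expnS. Qed.

Lemma uniq_exponents d e : uniq (exponents d e).
Proof.
elim: e => //= e IH; apply: allpairs_uniq; rewrite ?iota_uniq //.
by move=> [a s] [b t] _ _ /= [-> ->].
Qed.

Lemma big_exponents (V : nmodType) d e (f : seq nat -> V) :
  \sum_(s <- exponents d e.+1) f s =
  \sum_(0 <= a < d) \sum_(s <- exponents d e) f (a :: s).
Proof. by rewrite [exponents d e.+1]lock -lock big_allpairs_dep /index_iota subn0. Qed.

Lemma exponentsP d e s : s \in exponents d e.+1 ->
  exists a t, [/\ (a < d)%N, t \in exponents d e & s = a :: t].
Proof.
rewrite [exponents d e.+1]lock -lock => /allpairsPdep[a [t [ad te ->]]].
by exists a, t; split=> //; move: ad; rewrite mem_iota add0n.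
Qed.

(** The head of the list is the exponent of the generator of highest index, so that induction on the
    list peels off the top of a chain. *)
Fixpoint monomial n (g : nat -> {mpoly F[n]}) (s : seq nat) : {mpoly F[n]} :=
  if s is a :: s' then g (size s') ^+ a * monomial g s' else 1.

Lemma mem_exponents d e s : s \in exponents d e -> size s = e /\ all (gtn d) s.
Proof.
elim: e s => [|e IH] s /=; first by rewrite inE => /eqP->.
move=> /allpairsPdep[a [t [ad /IH[te td] ->]]] /=; rewrite te td andbT.
by move: ad; rewrite mem_iota add0n => /andP[_ ->].
Qed.

Arguments exponents : simpl never.

Lemma msizeM_deg n (p q : {mpoly F[n]}) a b :
  (msize p <= a.+1)%N -> (msize q <= b.+1)%N -> (msize (p * q) <= (a + b).+1)%N.
Proof.
move=> pa qb; have [->|p0] := eqVneq p 0; first by rewrite mul0r msize0.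
have [->|q0] := eqVneq q 0; first by rewrite mulr0 msize0.
rewrite msizeM // -ltnS.
have : (msize p + msize q <= a.+1 + b.+1)%N by apply: leq_add.
rewrite addnS addSn; case: (msize p + msize q)%N => //=.
Qed.

Lemma msizeX_deg n (p : {mpoly F[n]}) a j :
  (msize p <= a.+1)%N -> (msize (p ^+ j) <= (a * j).+1)%N.
Proof.
move=> pa; elim: j => [|j IH]; first by rewrite expr0 msize1.
by rewrite exprS mulnS; apply: msizeM_deg.
Qed.

Lemma msize_monomial n (g : nat -> {mpoly F[n]}) d e D s :
  (forall i, (i < e)%N -> (msize (g i) <= D.+1)%N) -> s \in exponents d e ->
  (msize (monomial g s) <= (e * (d * D)).+1)%N.
Proof.
elim: e s => [|e IH] s gD; first by rewrite inE => /eqP->; rewrite msize1.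
move=> /exponentsP[a [t [ad te ->]]] /=; have [st _] := mem_exponents te.
rewrite st mulSn; apply: msizeM_deg; last by apply: IH => // i ie; apply/gD/ltnW.
apply: leq_trans (msizeX_deg _ (gD e (leqnn _))) _.
by rewrite ltnS mulnC leq_mul2r (ltnW ad) orbT.
Qed.

Lemma card_bmultinom n N : (#|{: 'X_{1..n < N}}| <= N ^ n)%N.
Proof.
have lt_mN (m : 'X_{1..n < N}) i : (m i < N)%N.
  apply: leq_ltn_trans (bmdeg m); rewrite mdegE (bigD1 i) //=; exact: leq_addr.
pose h (m : 'X_{1..n < N}) := [ffun i => Ordinal (lt_mN m i)].
have -> : (N ^ n)%N = #|{ffun 'I_n -> 'I_N}| by rewrite card_ffun !card_ord.
apply: (@leq_card _ _ h) => m1 m2 /ffunP hm; apply/val_inj/mnmP => i.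
by have := congr1 val (hm i); rewrite !ffunE.
Qed.

(* The monomials of bounded degree in m+1 polynomials outnumber, for large
   degree, the available monomials in m variables. *)
Lemma monomial_dependence m (p : nat -> {mpoly F[m]}) :
  exists d (c : seq nat -> F), (exists2 s, s \in exponents d m.+1 & c s != 0) /\
    \sum_(s <- exponents d m.+1) c s *: monomial p s = 0.
Proof.
pose D := \max_(i < m.+1) msize (p i); pose C := (m.+1 * D)%N.
(* The monomials have degree at most C * d, and d exceeds (C + 1)^m, so that (C * d + 1)^m <= ((C +
   1) * d)^m < d^(m + 1). *)
pose d := ((C.+1) ^ m).+1; pose N := (m.+1 * (d * D)).+1.
have NE : N = (C * d).+1 by rewrite /N /C mulnAC mulnA.
have Nlt : (N ^ m < d ^ m.+1)%N.
  apply: (@leq_ltn_trans ((C.+1 * d) ^ m)%N).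
    rewrite NE mulSn addnC -addn1; case: (m) => // m'; rewrite leq_exp2r //.
    by rewrite leq_add2l.
  by rewrite expnMn expnS ltn_pmul2r ?expn_gt0.
pose S := exponents d m.+1.
pose K := \matrix_(i < size S, j < #|{: 'X_{1..m < N}}|)
  (monomial p (nth [::] S i))@_(enum_val j).
have : (\rank K < size S)%N.
  apply: leq_ltn_trans (rank_leq_col _) _; rewrite size_exponents.
  exact: leq_ltn_trans (card_bmultinom _ _) Nlt.
move=> rK; have kN0 : kermx K != 0 by rewrite -mxrank_eq0 mxrank_ker subn_eq0 -ltnNge.
have /rowV0Pn[c cK c0] := kN0; have {}cK : c *m K = 0 by apply/sub_kermxP.
exists d, (fun s => if insub (index s S) is Some i then c 0 i else 0).
have cE (i : 'I_(size S)) : insub (index (nth [::] S i) S) = Some i.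
  by rewrite index_uniq ?uniq_exponents // valK.
split.
  have /rV0Pn[i ci] := c0; exists (nth [::] S i); first exact: mem_nth.
  by rewrite cE.
rewrite -/S (big_nth [::]) big_mkord; apply/mpolyP => mm.
rewrite mcoeff0 raddf_sum /=.
have [mN|Nm] := ltnP (mdeg mm) N; last first.
  apply: big1 => i _; rewrite mcoeffZ (memN_msupp_eq0 (m := mm)) ?mulr0 //.
  apply: msize_mdeg_ge; apply: leq_trans Nm; apply: (msize_monomial (d := d)).
    by move=> j jm; apply: leqW; apply: (leq_bigmax (Ordinal jm)).
  exact: mem_nth.
have := congr1 (fun M : 'rV__ => M 0 (enum_rank (BMultinom mN))) cK.
rewrite !mxE => E; rewrite -[RHS]E; apply: eq_bigr => i _.
by rewrite mcoeffZ !mxE enum_rankK cE.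
Qed.

Variable W : vectType F.
Implicit Types (X : set (proj W)).

(** Since [g i.+1] vanishes on [Z i] but not on [Z i.+1], the [g i] behave like algebraically
    independent functions on the cone over [Z e]. In a relation ordered by powers of the last
    function, the lowest power is divided out by irreducibility of the last set; restriction to the
    preceding set then leaves only its coefficient, a relation for the shorter chain. *)
Lemma monomial_free (Z : nat -> set (proj W)) (g : nat -> {mpoly F[\dim {:W}]}) e d
    (c : seq nat -> F) :
  (forall i, (i <= e)%N -> zirreducible (Z i)) ->
  (exists k, (0 < k)%N /\ g 0%N \is k.-homog) ->
  (forall i, (i <= e)%N -> homogeneous (g i)) ->
  (forall i, (i <= e)%N -> ~ (forall q, Z i q -> vanishes_at (g i) q)) ->
  (forall i, (i < e)%N -> Z i `<=` Z i.+1) ->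
  (forall i, (i < e)%N -> forall q, Z i q -> vanishes_at (g i.+1) q) ->
  cvanish (Z e) (mev (\sum_(s <- exponents d e.+1) c s *: monomial g s)) ->
  forall s, s \in exponents d e.+1 -> c s = 0.
Proof.
move=> Zirr [k [k0 gk]]; elim: e c Zirr => [|e IH] c Zirr gh gN ZZ gZ.
  move=> cZ; have /existsNP[q /not_implyP[Zq gq]] := gN 0%N isT.
  have {gq}/eqP gq : mev (g 0%N) (rep q) <> 0 by [].
  have cE a : (a < d)%N -> c [:: a] = 0.
    (* On the line through q the powers of [g 0] become multiples of the powers s^(k * a), which are
       distinct because k > 0. *)
    move=> ad; pose r := \sum_(a < d) (c [:: (a : nat)] * mev (g 0%N) (rep q) ^+ a) *: 'X^(k * a).
    have r0 : r = 0.
      apply: (poly_eq0 F0) => s; rewrite horner_sum.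
      rewrite -[RHS](cZ q (s *: rep q) Zq (memvZ s (mem_rep q))).
      rewrite big_exponents big_mkord /mev raddf_sum.
      apply: eq_bigr => b _; rewrite [exponents d 0]/exponents big_seq1 /= hornerZ hornerXn mevalZ /= mulr1.
      rewrite rmorphXn /= -/(mev (g 0%N) (s *: rep q)) (mev_homog _ _ gk) exprMn -exprM -mulrA.
      by rewrite [X in _ * X]mulrC.
    have := congr1 (fun r : {poly F} => r`_(k * a)) r0.
    rewrite coef0 coef_sum (bigD1 (Ordinal ad)) //= coefZ coefXn eqxx mulr1.
    rewrite big1 ?addr0 => [/eqP|b ba].
      by rewrite mulf_eq0 expf_eq0 (negPf gq) andbF orbF => /eqP.
    rewrite coefZ coefXn eqn_mul2l eqn0Ngt k0 /= eq_sym.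
    by rewrite (negPf (_ : (b : nat) != a)) ?mulr0.
  by move=> s /exponentsP[a [t [ad]]]; rewrite inE => /eqP-> ->; apply: cE.
have {}IH c' : cvanish (Z e) (mev (\sum_(s <- exponents d e.+1) c' s *: monomial g s)) ->
    forall s, s \in exponents d e.+1 -> c' s = 0.
  by apply: IH => i ie; [apply: Zirr|apply: gh|apply: gN|apply: ZZ|apply: gZ]; rewrite ltnW.
pose h a := \sum_(s <- exponents d e.+1) c (a :: s) *: monomial g s.
have sumE : \sum_(s <- exponents d e.+2) c s *: monomial g s =
    \sum_(0 <= a < d) g e.+1 ^+ a * h a.
  rewrite big_exponents; apply: eq_bigr => a _.
  rewrite /h big_distrr /= !big_seq; apply: eq_bigr => s /mem_exponents[se _].
  by rewrite se scalerAr.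
rewrite sumE => cZ.
suff H j : (j <= d)%N -> forall a, (a < j)%N -> forall s, s \in exponents d e.+1 -> c (a :: s) = 0.
  by move=> s /exponentsP[a [t [ad te ->]]]; apply: (H d).
elim: j => // j IHj jd; have {}IHj := IHj (ltnW jd).
have h0 a : (a < j)%N -> h a = 0.
  by move=> aj; rewrite /h big_seq big1 // => s se; rewrite IHj // scale0r.
pose G := \sum_(j <= a < d) g e.+1 ^+ (a - j) * h a.
have {}cZ : cvanish (Z e.+1) (mev G).
  have : cvanish (Z e.+1) (mev (g e.+1 ^+ j * G)).
    rewrite (_ : _ * G = \sum_(0 <= a < d) g e.+1 ^+ a * h a) //.
    rewrite (big_cat_nat (leq0n j) (ltnW jd)) /= big_nat big1 ?add0r => [|a /andP[_ aj]]; last first.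
      by rewrite h0 ?mulr0.
    rewrite /G big_distrr /=; apply: eq_big_nat => a /andP[ja _].
    by rewrite mulrA -exprD subnKC.
  elim: (j) => [|i IHi]; first by rewrite expr0 mul1r.
  move=> giG; apply: IHi.
  apply: (zirreducible_cvanish F0 (Zirr _ (leqnn _)) (gh _ (leqnn _)) (pfun_mev _)).
    exact: gN.
  by move=> q v Zq vq; have := giG q v Zq vq; rewrite exprS -mulrA /mev mevalM.
have hj : cvanish (Z e) (mev (h j)).
  move=> q v Zq vq; rewrite -[RHS](cZ q v (ZZ e (leqnn _) q Zq) vq).
  have -> : G = h j + g e.+1 * \sum_(j.+1 <= a < d) g e.+1 ^+ (a - j.+1) * h a.
    rewrite /G big_ltn // subnn expr0 mul1r big_distrr /=; congr (_ + _).
    by apply: eq_big_nat => a /andP[ja _]; rewrite mulrA -exprS subnSK.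
  rewrite {2}/mev mevalD mevalM -!/(mev _ v).
  by rewrite (vanishes_at_line (gh _ _) (gZ e (leqnn _) q Zq) vq) // mul0r addr0.
move=> a; rewrite ltnS leq_eqVlt => /predU1P[->|/IHj//].
exact: IH.
Qed.

(** A chain of length m = dim A would provide m + 1 polynomials whose monomials are independent on
    the cone over X. Composed with [Phi] they are polynomials in m variables, where a dependence
    exists. *)
Lemma chain_bound (A : vectType F) (Phi : A -> W) X p e : pmap Phi ->
  (forall G, pfun G -> (forall a, G (Phi a) = 0) -> cvanish X G) ->
  closed_chain X p e -> (e < \dim {:A})%N.
Proof.
move=> pPhi PhiX [Z [Z0p ZP Zlt]]; rewrite ltnNge; apply/negP => le_me.
set m := \dim {:A} in le_me.
have ZZ i : (i < m)%N -> Z i `<` Z i.+1 by move=> im; apply/Zlt/(leq_trans im).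
have cl i : (i <= m)%N -> zclosed (Z i) /\ zirreducible (Z i).
  by move=> im; have [] := ZP i (leq_trans im le_me).
(* The family starts with a linear coordinate that is nonzero at p, so that [g 0] has positive
   degree; indices beyond m get the dummy value 0. *)
have /choice[g gP] : forall i, exists f, (i <= m)%N ->
    [/\ homogeneous f, ~ (forall q, Z i q -> vanishes_at f q),
       (i = 0)%N -> (f \is 1.-homog) &
       forall j, i = j.+1 -> forall q, Z j q -> vanishes_at f q].
  case=> [|i]; last first.
    have [im|mi] := ltnP i m; last by exists 0.
    have [_ /existsNP[q /not_implyP[Zq Zq']]] := ZZ i im.
    have [f [hf fZ fq]] := zclosed_pfun (proj1 (cl i (ltnW im))) Zq'.
    by exists f; split=> // [fZ'|j [<-]//]; apply/fq/fZ'.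
  have [i ri] : exists i, coord (vbasis {:W}) i (rep p) != 0.
    apply: contrapT => /forallNP H; have /eqP := rep_neq0 p; apply.
    by apply: coord_inj => i; rewrite linear0; apply/eqP/negPn/negP.
  exists 'X_i => _; have hX : ('X_i : {mpoly F[\dim {:W}]}) \is 1.-homog.
    by rewrite dhomogX /= mdeg1.
  split=> // [|H]; first by exists 1%N.
  by have := H _ Z0p; rewrite /vanishes_at mevalXU; apply/eqP.
have /choice[q qP] : forall i, exists q : {mpoly F[m]},
    forall a, mev (g i) (Phi a) = mev q a.
  by move=> i; have [q qE] := pfun_comp pPhi (pfun_mev (g i)); exists q.
have [d [c [[s sd cs] c0]]] := monomial_dependence q.
case/eqP: cs; apply: (@monomial_free Z g m d c) sd.
- by move=> i /cl[].
- by exists 1%N; split=> //; have [_ _ /(_ erefl)] := gP 0%N (leq0n _).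
- by move=> i /gP[].
- by move=> i /gP[].
- by move=> i /ZZ[].
- by move=> i im; have [_ _ _] := gP i.+1 im; apply.
have H : forall t a, mev (monomial g t) (Phi a) = mev (monomial q t) a.
  elim=> [|b t IH] a /=; first by rewrite /mev !meval1.
  by rewrite /mev !mevalM !rmorphXn /= -!/(mev _ _) qP IH.
move=> x v Zx vx; apply: (PhiX _ (pfun_mev _)) vx; last first.
  by have [_ _] := ZP m le_me; apply.
move=> a; rewrite /mev raddf_sum /= -[RHS](meval0 (fun i => coord (vbasis {:A}) i a)).
rewrite -c0 raddf_sum /=; apply: eq_bigr => t _; rewrite !mevalZ; congr (_ * _).
exact: H.
Qed.

End ChainBound.

(** * Tangent spaces and charts *)

Section Jets.
Variable F : fieldType.

(** Congruence modulo 'X^2, so that first order computations take place among polynomials instead of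
    dual numbers. *)
Definition eq_jet (r q : {poly F}) : Prop := r`_0 = q`_0 /\ r`_1 = q`_1.

Lemma eq_jet_refl r : eq_jet r r. Proof. by []. Qed.

Lemma eq_jetD r r' q q' : eq_jet r r' -> eq_jet q q' -> eq_jet (r + q) (r' + q').
Proof. by move=> [r0 r1] [q0 q1]; split; rewrite !coefD ?r0 ?r1 ?q0 ?q1. Qed.

Lemma eq_jetB r r' q q' : eq_jet r r' -> eq_jet q q' -> eq_jet (r - q) (r' - q').
Proof. by move=> [r0 r1] [q0 q1]; split; rewrite !coefB ?r0 ?r1 ?q0 ?q1. Qed.

Lemma eq_jetM r r' q q' : eq_jet r r' -> eq_jet q q' -> eq_jet (r * q) (r' * q').
Proof.
move=> [r0 r1] [q0 q1]; split; rewrite !coefM !big_ord_recl !big_ord0 /=;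
  by rewrite /bump /= ?subn0 ?subnn r0 q0 // r1 q1.
Qed.

Lemma eq_jetX r r' j : eq_jet r r' -> eq_jet (r ^+ j) (r' ^+ j).
Proof. by move=> rr; elim: j => [|j IH]; rewrite ?expr0 // !exprS; apply: eq_jetM. Qed.

Lemma eq_jet_sum (I : Type) (s : seq I) (f g : I -> {poly F}) :
  (forall i, eq_jet (f i) (g i)) -> eq_jet (\sum_(i <- s) f i) (\sum_(i <- s) g i).
Proof. by move=> fg; elim/big_rec2: _ => // i y1 y2 _; apply: eq_jetD. Qed.

Lemma eq_jet_prod (I : Type) (s : seq I) (f g : I -> {poly F}) :
  (forall i, eq_jet (f i) (g i)) -> eq_jet (\prod_(i <- s) f i) (\prod_(i <- s) g i).
Proof. by move=> fg; elim/big_rec2: _ => // i y1 y2 _; apply: eq_jetM. Qed.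

Lemma eq_jet_mmap n (y z : 'I_n -> {poly F}) (p : {mpoly F[n]}) :
  (forall i, eq_jet (y i) (z i)) -> eq_jet (mmap polyC y p) (mmap polyC z p).
Proof.
move=> yz; apply: eq_jet_sum => m; apply: eq_jetM => //.
by apply: eq_jet_prod => i; apply: eq_jetX.
Qed.

Lemma coef1M (r q : {poly F}) : (r * q)`_1 = r`_0 * q`_1 + r`_1 * q`_0.
Proof. by rewrite coefM !big_ord_recl big_ord0 addr0 /= subn0 subnn. Qed.

Lemma coef1_deriv (r : {poly F}) : r`_1 = r^`().[0].
Proof. by rewrite horner_coef0 coef_deriv. Qed.

Lemma jet_pline (U : vectType F) (p : {mpoly F[\dim {:U}]}) (x v : U) :
  (pline p x v)`_0 = mev p x /\ (pline p x v)`_1 = dmev p x v.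
Proof.
by rewrite coef1_deriv deriv_pline -horner_coef0 horner_pline scale0r addr0.
Qed.

Lemma horner_mmap n (y : 'I_n -> {poly F}) (p : {mpoly F[n]}) s :
  (mmap polyC y p).[s] = p.@[fun i => (y i).[s]].
Proof.
elim/mpoly_ring_ind: p => [c|i|p q IHp IHq|p q IHp IHq].
- by rewrite mmapC mevalC hornerC.
- by rewrite mmapX mmap1U mevalXU.
- by rewrite raddfD /= hornerD IHp IHq mevalD.
- by rewrite rmorphM /= hornerM IHp IHq mevalM.
Qed.

(** The degree used, [msize p], is one more than that of a nonzero p, which only adds a factor s.
    The ring is arbitrary because the same expression is needed over multivariate polynomials, over
    F and over {poly F}. *)
Definition homogenized (R : comNzRingType) (c : F -> R) n (p : {mpoly F[n]})
    (y : 'I_n -> R) (s : R) : R :=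
  \sum_(m <- msupp p) c p@_m * (\prod_i y i ^+ m i) * s ^+ (msize p - mdeg m).

Lemma homogenized_scale (R : comNzRingType) (c : {rmorphism F -> R}) n
    (p : {mpoly F[n]}) (y : 'I_n -> R) (s : R) :
  homogenized c p (fun i => s * y i) s = s ^+ msize p * mmap c y p.
Proof.
rewrite /homogenized /mmap big_distrr /= !big_seq; apply: eq_bigr => m mp.
have -> : \prod_i (s * y i) ^+ m i = s ^+ mdeg m * \prod_i y i ^+ m i.
  by rewrite mdegE expr_sum -big_split /=; apply: eq_bigr => i _; rewrite exprMn.
have le_m : (mdeg m <= msize p)%N by apply/ltnW/msize_mdeg_lt.
rewrite -[in RHS](subnKC le_m) exprD /mmap1.
move: (s ^+ mdeg m) (s ^+ (msize p - mdeg m)) (c p@_m) (\prod_(i < n) _) => u v a b.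
by rewrite mulrA -[a * u]mulrC -!mulrA [b * v]mulrC [v * (a * b)]mulrCA.
Qed.

Lemma homogenized_morph (R S : comNzRingType) (c : F -> R) (phi : {rmorphism R -> S})
    n (p : {mpoly F[n]}) (y : 'I_n -> R) (s : R) :
  phi (homogenized c p y s) =
  homogenized (phi \o c) p (fun i => phi (y i)) (phi s).
Proof.
rewrite rmorph_sum; apply: eq_bigr => m _; rewrite !rmorphM rmorphXn rmorph_prod /=.
by congr (_ * _ * _); apply: eq_bigr => i _; rewrite rmorphXn.
Qed.

Lemma eq_jet_homogenized n (p : {mpoly F[n]}) (y z : 'I_n -> {poly F}) s :
  (forall i, eq_jet (y i) (z i)) ->
  eq_jet (homogenized polyC p y s) (homogenized polyC p z s).
Proof.
move=> yz; apply: eq_jet_sum => m; apply: eq_jetM => //; apply: eq_jetM => //.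
by apply: eq_jet_prod => i; apply: eq_jetX.
Qed.

Lemma dmevP (U : vectType F) (p : {mpoly F[\dim {:U}]}) (x : U) a u v :
  dmev p x (a *: u + v) = a * dmev p x u + dmev p x v.
Proof.
rewrite /dmev big_distrr -big_split /=; apply: eq_bigr => i _.
by rewrite linearP /= mulrDr mulrCA.
Qed.

Lemma dmev_sum (U : vectType F) (I : Type) (s : seq I)
    (p : I -> {mpoly F[\dim {:U}]}) (x v : U) :
  dmev (\sum_(i <- s) p i) x v = \sum_(i <- s) dmev (p i) x v.
Proof.
elim: s => [|i s IH]; rewrite ?big_nil ?big_cons.
  by rewrite /dmev big1 // => j _; rewrite mderiv0 meval0 mul0r.
rewrite -IH /dmev -big_split /=; apply: eq_bigr => j _.
by rewrite mderivD mevalD mulrDl.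
Qed.

End Jets.

Section TangentSpace.
Variables (F : fieldType) (F0 : [pchar F] =i pred0) (W : vectType F).
Local Open Scope classical_set_scope.
Implicit Types (X : set (proj W)).

Lemma exists_hom (U Z : vectType F) (f : U -> Z) : linear f ->
  exists g : 'Hom(U, Z), forall u, g u = f u.
Proof.
move=> fL; pose fM := GRing.isLinear.Build F U Z *:%R f fL.
pose fl : {linear U -> Z} := HB.pack f fM.
by exists (linfun fl) => u; rewrite lfunE.
Qed.

(** A subspace of maximal dimension inside S is all of S, since any further vector of S would
    enlarge it. *)
Lemma exists_vspace (S : W -> Prop) : S 0 ->
  (forall a u v, S u -> S v -> S (a *: u + v)) ->
  exists U : {vspace W}, forall v, v \in U <-> S v.
Proof.
move=> S0 SL; pose P n := `[< exists U : {vspace W}, \dim U = n /\ forall v, v \in U -> S v >].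
have P0 : exists n, P n.
  by exists 0%N; apply/asboolP; exists 0%VS; rewrite dimv0; split=> // v; rewrite memv0 => /eqP->.
have Pub n : P n -> (n <= \dim {:W})%N.
  by move=> /asboolP[U [<- _]]; apply/dimvS/subvf.
case: (ex_maxnP P0 Pub) => n /asboolP[U [Un US]] nmax; exists U => v; split=> [/US//|Sv].
apply/negPn/negP => vU.
have : P (\dim (<[v]> + U)%VS).
  apply/asboolP; exists (<[v]> + U)%VS; split=> // w /memv_addP[_ /vlineP[a ->] [u uU ->]].
  by apply: SL => //; apply: US.
move/nmax; rewrite -Un leqNgt; case/negP.
rewrite ltn_neqAle dimvS ?addvSr // andbT; apply/negP => /eqP E.
have : (U == <[v]> + U)%VS by rewrite eqEdim addvSr -E leqnn.
by move/eqP => UE; move: vU; rewrite UE memvE addvSl.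
Qed.

Lemma exists_tangent_space X p : exists U, is_affine_tangent_space X p U.
Proof.
apply: exists_vspace => [f _|a u v Su Sv f If].
  by rewrite big1 // => i _; rewrite linear0 mulr0.
by have := dmevP f (rep p) a u v; rewrite /dmev => ->; rewrite Su // Sv // mulr0 addr0.
Qed.

Lemma tangent_cvanish X p U v f : is_affine_tangent_space X p U -> v \in U ->
  cvanish X (mev f) -> dmev f (rep p) v = 0.
Proof.
move=> XU /XU vU f0; rewrite (pihomog_partitionE (leqnn (msize f))).
rewrite dmev_sum big1 // => d _; apply: vU.
exact: (cvanish_comp F0 d f0).
Qed.

(** A polynomial curve in the cone has its velocity in the tangent space. Only the 1-jet of y is
    prescribed, which admits curves other than lines. *)
Lemma tangent_curve X p U v (y : 'I_(\dim {:W}) -> {poly F}) :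
  is_affine_tangent_space X p U ->
  (forall i, eq_jet (y i) ((coord (vbasis {:W}) i (rep p))%:P + coord (vbasis {:W}) i v *: 'X)) ->
  (forall f, vanishing_ideal X f -> forall s, f.@[fun i => (y i).[s]] = 0) ->
  v \in U.
Proof.
move=> XU yv yX; apply/XU => f If; rewrite -/(dmev f (rep p) v).
have [_ <-] := jet_pline f (rep p) v; rewrite /pline.
have [_ <-] := eq_jet_mmap f yv; rewrite (_ : mmap _ _ _ = 0) ?coef0 //.
by apply: (poly_eq0 F0) => s; rewrite horner_mmap yX.
Qed.

Lemma tangent_line X p U v :
  is_affine_tangent_space X p U ->
  (forall f, vanishing_ideal X f -> forall s, mev f (rep p + s *: v) = 0) ->
  v \in U.
Proof.
move=> XU vX; apply: (tangent_curve XU (fun i => eq_jet_refl _)) => f If s.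
rewrite -[RHS](vX f If s) /mev; apply: meval_eq => i.
by rewrite !hornerE linearD linearZ /= mulrC.
Qed.

End TangentSpace.

(** * Regularity along a polynomial parametrization with polynomial inverse *)

Section Chart.
Variables (F : fieldType) (F0 : [pchar F] =i pred0) (A W : vectType F).
Local Open Scope classical_set_scope.
Variables (Phi : A -> W) (psi : W -> A) (x0 h : W -> F) (X : set (proj W)).
Hypotheses (pPhi : pmap Phi) (ppsi : pmap psi) (ph : pfun h).
Hypothesis x0L : forall a u v, x0 (a *: u + v) = a * x0 u + x0 v.
Hypothesis x0Phi : forall a, x0 (Phi a) = 1.
Hypothesis psiPhi : forall t a, psi (t *: Phi a) = h (t *: Phi a) *: a.
Hypothesis clX : zclosed X.
Hypothesis XPhi : forall p a, val p = <[Phi a]>%VS -> X p.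
Hypothesis PhiX : forall G, pfun G -> (forall t a, G (t *: Phi a) = 0) -> cvanish X G.

Let x00 : x0 0 = 0.
Proof.
by have := x0L 1 0 0; rewrite scale1r mul1r addr0 => /eqP; rewrite -subr_eq0 opprD addNKr oppr_eq0 => /eqP.
Qed.

Let x0Z t v : x0 (t *: v) = t * x0 v.
Proof. by have := x0L t v 0; rewrite x00 !addr0. Qed.

Local Notation B := (F^o * A)%type.

Let cone_map (b : B) : W := (b.1 : F) *: Phi b.2.

Let pcone : pmap cone_map.
Proof.
apply: pmapZ; first by apply: (@pfun_linear _ B (fun b => b.1 : F)).
by apply: (@pmap_comp _ B _ _ Phi snd) => //; apply: pmap_linear.
Qed.

Lemma dim_cone_chart : \dim {: B} = (\dim {:A}).+1.
Proof. by rewrite !dimvf. Qed.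

Variable p : proj W.
Hypotheses (Xp : X p) (hp : h (rep p) != 0).
Let x := rep p.
Let a0 := (h x)^-1 *: psi x.
Local Notation cA := (coord (vbasis {:A})).
Local Notation cW := (coord (vbasis {:W})).

Let psi_x : psi x = h x *: a0.
Proof. by rewrite /a0 scalerA divff ?scale1r. Qed.

Lemma x_neq0 : x != 0. Proof. exact: rep_neq0. Qed.

Lemma Phi_neq0 a : Phi a != 0.
Proof. by apply: contra_eq_neq (x0Phi a) => ->; rewrite x00 eq_sym oner_eq0. Qed.

Lemma chart_cone f t a : vanishing_ideal X f -> mev f (t *: Phi a) = 0.
Proof.
move=> If; apply: (vanishing_cvanish If (p := point (Phi_neq0 a))); last first.
  by apply/vlineP; exists t.
exact: (XPhi (a := a)).
Qed.

Section Coordinates.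
Variables (q0 qh : {mpoly F[\dim {:W}]}) (qpsi : 'I_(\dim {:A}) -> {mpoly F[\dim {:W}]}).
Hypothesis q0E : forall w, x0 w = mev q0 w.
Hypothesis qhE : forall w, h w = mev qh w.
Hypothesis qpsiE : forall i w, cA i (psi w) = mev (qpsi i) w.

Lemma dmev_linear v : dmev q0 x v = x0 v.
Proof.
have [_ <-] := jet_pline q0 x v.
have -> : pline q0 x v = (x0 x)%:P + x0 v *: 'X.
  apply/eqP; rewrite -subr_eq0; apply/eqP; apply: (poly_eq0 F0) => s.
  rewrite hornerD hornerN horner_pline -q0E [x + _]addrC x0L !hornerE.
  by rewrite [s * _]mulrC addrC [x0 v * s + _]addrC addNr.
by rewrite coefD coefC coefZ coefX add0r mulr1.
Qed.

(* On the cone of X the coordinates satisfy h^c x_I = x0 * P^h(psi, h), where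
   P^h is the homogenization of degree c of the I-th coordinate P of Phi. *)
Section Relation.
Variables (I : 'I_(\dim {:W})) (P : {mpoly F[\dim {:A}]}).
Hypothesis PE : forall a, cW I (Phi a) = mev P a.
Let c := msize P.
Let g := qh ^+ c * 'X_I - q0 * homogenized (@mpolyC _ _) P qpsi qh.

Lemma chart_relation : cvanish X (mev g).
Proof.
apply: PhiX => [|t a]; first exact: pfun_mev.
set w := t *: Phi a.
rewrite /g /mev mevalB !mevalM rmorphXn /= mevalXU -!/(mev _ w) -q0E -qhE.
have -> : mev (homogenized (@mpolyC _ _) P qpsi qh) w =
    homogenized idfun P (fun i => h w * cA i a) (h w).
  rewrite /mev; have := homogenized_morph (@mpolyC _ _) (meval (fun i => cW i w)) P qpsi qh.
  move=> /= ->; rewrite -/(mev qh w) -qhE.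
  apply: eq_bigr => m _; rewrite /= mevalC; congr (_ * _ * _).
  by apply: eq_bigr => i _; rewrite -/(mev _ w) -qpsiE psiPhi linearZ.
rewrite homogenized_scale -/(meval _ _) -/(mev _ a) -PE x0Z x0Phi mulr1.
by rewrite /w linearZ /= mulrCA subrr.
Qed.

(** The hypothesis on v says that psi / h has derivative 0 along v. Hence P^h(psi, h) is h^c * P(a0)
    modulo 'X^2, and the relation becomes h^c times the deviation of x_I from a constant. *)
Lemma chart_jet v : x0 v = 0 ->
  (forall i, dmev (qpsi i) x v = cA i a0 * dmev qh x v) ->
  eq_jet (pline g x v)
    (pline qh x v ^+ c * (pline 'X_I x v - (x0 x * mev P a0)%:P)).
Proof.
move=> v0 dpsi; rewrite {1}/pline /g rmorphB !rmorphM rmorphXn /= -!/(pline _ x v).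
rewrite mulrBr; apply: eq_jetB => //.
rewrite mulrCA; apply: eq_jetM.
  have [e0 e1] := jet_pline q0 x v.
  by split; rewrite ?e0 ?e1 coefC /= ?dmev_linear // q0E.
have -> : pline (homogenized (@mpolyC _ _) P qpsi qh) x v =
    homogenized polyC P (fun i => pline (qpsi i) x v) (pline qh x v).
  rewrite {1}/pline; have := homogenized_morph (@mpolyC _ _)
    (mmap polyC (fun i => (cW i x)%:P + cW i v *: 'X)) P qpsi qh.
  by move=> /= ->; apply: eq_bigr => m _ /=; rewrite mmapC.
have -> : pline qh x v ^+ c * (mev P a0)%:P =
    homogenized polyC P (fun i => pline qh x v * (cA i a0)%:P) (pline qh x v).
  rewrite homogenized_scale; congr (_ * _).
  apply/eqP; rewrite -subr_eq0; apply/eqP; apply: (poly_eq0 F0) => s.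
  rewrite hornerD hornerN horner_mmap hornerC /mev; apply/eqP; rewrite subr_eq0; apply/eqP.
  by apply: meval_eq => i; rewrite hornerC.
apply: eq_jet_homogenized => i; have [j0 j1] := jet_pline (qpsi i) x v.
have [h0 h1] := jet_pline qh x v.
split; first by rewrite j0 coefMC h0 -qpsiE psi_x linearZ /= -qhE.
by rewrite j1 coefMC h1 dpsi mulrC.
Qed.

End Relation.

(** The constant terms of the relations, taken with v = 0, determine every coordinate of x, because
    h is nonzero there. *)
Lemma chart_point : x = x0 x *: Phi a0.
Proof.
have d0 (q : {mpoly F[\dim {:W}]}) : dmev q x 0 = 0.
  by rewrite /dmev big1 // => i _; rewrite linear0 mulr0.
apply: coord_inj => I; have [P PE] := pPhi I.
have [|j0 _] := chart_jet I P (v := 0) x00; first by move=> i; rewrite !d0 mulr0.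
move: j0; set g := (qh ^+ _ * _ - _); have [-> _] := jet_pline g x 0.
rewrite (chart_relation PE (p := p)) ?mem_rep // -horner_coef0 hornerM horner_exp.
rewrite hornerD hornerN hornerC !horner_coef0 -!/(pline _ _ _).
have [-> _] := jet_pline qh x 0; have [-> _] := jet_pline 'X_I x 0.
move=> /esym/eqP; rewrite mulf_eq0 expf_eq0 -qhE (negPf hp) andbF /=.
by rewrite {1}/mev mevalXU subr_eq0 -PE linearZ => /eqP.
Qed.

Lemma chart_tangent_inj U v : is_affine_tangent_space X p U -> v \in U ->
  x0 v = 0 -> (forall i, dmev (qpsi i) x v = cA i a0 * dmev qh x v) -> v = 0.
Proof.
move=> XU vU v0 dv; apply: coord_inj => I; have [P PE] := pPhi I.
have [_] := chart_jet I P v0 dv.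
set g := (qh ^+ _ * _ - _); have [_ ->] := jet_pline g x v.
rewrite (tangent_cvanish F0 XU vU (chart_relation PE)).
rewrite coef1M !coefB !coefC /= subr0.
have [-> ->] := jet_pline 'X_I x v; rewrite {1}/mev mevalXU -PE.
have -> : coord (vbasis {:W}) I x = x0 x * cW I (Phi a0).
  by rewrite {1}chart_point linearZ.
rewrite subrr mulr0 addr0 -horner_coef0 horner_exp horner_coef0.
have [-> _] := jet_pline qh x v.
move=> /esym/eqP; rewrite mulf_eq0 expf_eq0 -qhE (negPf hp) andbF /=.
rewrite linear0 => /eqP <-; have [_ <-] := jet_pline 'X_I x v.
by rewrite /pline mmapX mmap1U coefD coefC coefZ coefX add0r mulr1.
Qed.

(** The differential of (x0, psi / h), with denominators cleared, embeds the tangent space into the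
    source of the cone map. *)
Lemma chart_tangent_dim_le U : is_affine_tangent_space X p U ->
  (\dim U <= (\dim {:A}).+1)%N.
Proof.
move=> XU; pose L0 v : B := (x0 v, \sum_i (dmev (qpsi i) x v - cA i a0 * dmev qh x v) *: (vbasis {:A})`_i).
have L0L : linear L0.
  move=> a u v; congr (_, _) => /=; first by rewrite x0L.
  rewrite scaler_sumr -big_split /=; apply: eq_bigr => i _.
  rewrite !dmevP scalerA -scalerDl; congr (_ *: _).
  by rewrite mulrDr opprD addrACA mulrBr [cA i a0 * (a * _)]mulrCA.
have [L LE] := exists_hom L0L.
have <- : \dim (L @: U) = \dim U.
  apply/limg_dim_eq/eqP; rewrite -subv0; apply/subvP => v /memv_capP[vU].
  rewrite memv_ker LE => /eqP[v0 vL]; rewrite memv0; apply/eqP.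
  apply: (chart_tangent_inj XU) => // i; apply/eqP; rewrite -subr_eq0; apply/eqP.
  have /(congr1 (cA i)) := vL; rewrite linear0 linear_sum (bigD1 i) //= big1 => [|j ji].
    by rewrite linearZ /= coord_free ?(basis_free (vbasisP _)) // eqxx addr0 /GRing.scale /= mulr1.
  by rewrite linearZ /= coord_free ?(basis_free (vbasisP _)) // (negPf ji) /GRing.scale /= mulr0.
by rewrite -dim_cone_chart; apply/dimvS/subvf.
Qed.

(** The cone map (t, a) |-> t *: Phi a is inverted by x0 and psi / h, so its differential at the
    preimage of x is injective; the image consists of velocities of curves in the cone. *)
Lemma chart_tangent_dim_ge U : is_affine_tangent_space X p U ->
  ((\dim {:A}).+1 <= \dim U)%N.
Proof.
move=> XU; have /choice[q qE] := pcone; pose y0 : B := (x0 x, a0).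
have cone_y0 : cone_map y0 = x by rewrite /cone_map /= -chart_point.
pose D0 (b : B) : W := \sum_I dmev (q I) y0 b *: (vbasis {:W})`_I.
have D0E b I : cW I (D0 b) = dmev (q I) y0 b.
  rewrite linear_sum (bigD1 I) //= big1 => [|j ji].
    by rewrite linearZ /= coord_free ?(basis_free (vbasisP _)) // eqxx addr0 /GRing.scale /= mulr1.
  by rewrite linearZ /= coord_free ?(basis_free (vbasisP _)) // (negPf ji) /GRing.scale /= mulr0.
have D0L : linear D0.
  by move=> a u v; apply: coord_inj => I; rewrite linearP /= !D0E dmevP.
have [D DE] := exists_hom D0L.
have hy (b : B) I s : (pline (q I) y0 b).[s] = cW I (cone_map (y0 + s *: b)).
  by rewrite horner_pline qE.
have jy b I : eq_jet (pline (q I) y0 b) ((cW I x)%:P + cW I (D0 b) *: 'X).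
  have [j0 j1] := jet_pline (q I) y0 b.
  by split; rewrite coefD coefC coefZ coefX /= ?mulr0 ?mulr1 ?addr0 ?add0r ?j0 ?j1 ?D0E // -qE cone_y0.
have mf (f : {mpoly F[\dim {:W}]}) b s :
    (mmap polyC (fun I => pline (q I) y0 b) f).[s] = mev f (cone_map (y0 + s *: b)).
  by rewrite horner_mmap /mev; apply: meval_eq => I; rewrite hy.
have jf (f : {mpoly F[\dim {:W}]}) b : eq_jet (mmap polyC (fun I => pline (q I) y0 b) f) (pline f x (D0 b)).
  exact: eq_jet_mmap.
have D_inj b : D0 b = 0 -> b = 0.
  move=> Db0; have {}jf f : (mmap polyC (fun I => pline (q I) y0 b) f)`_1 = 0.
    have [_ ->] := jf f b; have [_ ->] := jet_pline f x (D0 b).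
    by rewrite Db0 /dmev big1 // => i _; rewrite linear0 mulr0.
  have b1 : b.1 = 0.
    rewrite -(jf q0) (_ : mmap _ _ _ = (x0 x)%:P + (b.1 : F) *: 'X).
      by rewrite coefD coefC coefZ coefX add0r mulr1.
    apply/eqP; rewrite -subr_eq0; apply/eqP; apply: (poly_eq0 F0) => s.
    rewrite hornerD hornerN mf -q0E x0Z x0Phi mulr1 !hornerE /= [_ * s]mulrC.
    by rewrite subrr.
  have b2 : b.2 = 0.
    apply: coord_inj => i; rewrite linear0.
    have E : mmap polyC (fun I => pline (q I) y0 b) (qpsi i) =
        mmap polyC (fun I => pline (q I) y0 b) qh * ((cA i a0)%:P + cA i b.2 *: 'X).
      apply/eqP; rewrite -subr_eq0; apply/eqP; apply: (poly_eq0 F0) => s.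
      have psiC y : cA i (psi (cone_map y)) = h (cone_map y) * cA i y.2.
        by rewrite psiPhi linearZ.
      have bE : cA i (y0 + s *: b).2 = cA i a0 + cA i b.2 * s.
        rewrite -[(y0 + s *: b).2]/(a0 + s *: b.2) linearD; congr (_ + _).
        by rewrite linearZ /= mulrC.
      rewrite hornerD hornerN hornerM !mf -qpsiE -qhE psiC bE.
      by rewrite hornerD hornerC hornerZ hornerX subrr.
    have := jf (qpsi i); rewrite E coef1M jf mul0r addr0.
    have [-> _] := eq_jet_mmap qh (jy b); have [-> _] := jet_pline qh x (D0 b).
    rewrite coefD coefC coefZ coefX /= add0r mulr1 -qhE => /eqP.
    by rewrite mulf_eq0 (negPf hp) /= => /eqP.
  by rewrite [b]surjective_pairing b1 b2.
rewrite -dim_cone_chart -(limg_dim_eq (f := D)); last first.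
  apply/eqP; rewrite -subv0; apply/subvP => b /memv_capP[_].
  by rewrite memv_ker DE memv0 => /eqP/D_inj->.
apply/dimvS/subvP => _ /memv_imgP[b _ ->]; rewrite DE.
apply: (tangent_curve F0 XU (jy b)) => f If s.
rewrite -horner_mmap mf; exact: chart_cone.
Qed.

End Coordinates.

Lemma chart_tangent_dim U : is_affine_tangent_space X p U -> \dim U = (\dim {:A}).+1.
Proof.
move=> XU; have /choice[qpsi qpsiE] := ppsi; have [qh qhE] := ph.
have [q0 q0E] := pfun_linear x0L; apply/eqP; rewrite eqn_leq.
by rewrite (chart_tangent_dim_le q0E qhE qpsiE XU) (chart_tangent_dim_ge q0E qhE qpsiE XU).
Qed.

Lemma chart_x0 : x0 x != 0.
Proof.
have /choice[qpsi qpsiE] := ppsi; have [qh qhE] := ph.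
have [q0 q0E] := pfun_linear x0L; have E := chart_point q0E qhE qpsiE.
by apply: contra_neq x_neq0 => x0x; rewrite E x0x scale0r.
Qed.

Lemma chart_rep : x = x0 x *: Phi a0.
Proof.
have /choice[qpsi qpsiE] := ppsi; have [qh qhE] := ph.
by have [q0 q0E] := pfun_linear x0L; apply: (chart_point q0E qhE qpsiE).
Qed.

(** The parameter agrees with a0 from the coordinate i on. The closures form a flag through p with
    one step for each coordinate of A. *)
Let slice i : set (proj W) := [set q | exists a,
  (forall j : 'I_(\dim {:A}), (i <= j)%N -> cA j a = cA j a0) /\ val q = <[Phi a]>%VS].

(** Two forms that are nonzero at two parameters of the slice are both nonzero at some parameter on
    the line joining them, which still belongs to the slice. *)
Lemma slice_irreducible i : zirreducible (zclosure (slice i)).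
Proof.
split.
  exists (point (Phi_neq0 a0)); apply: subset_zclosure; exists a0; split=> //.
move=> Z1 Z2 cZ1 cZ2 Z12; apply: contrapT => /not_orP[N1 N2].
have sl Z : zclosed Z -> ~ (zclosure (slice i) `<=` Z) -> exists f a,
    [/\ forall q, Z q -> vanishes_at f q, homogeneous f, mev f (Phi a) != 0 &
     forall j : 'I_(\dim {:A}), (i <= j)%N -> cA j a = cA j a0].
  move=> cZ NZ; have : ~ (slice i `<=` Z) by move=> /(zclosure_sub cZ).
  move=> /existsNP[q /not_implyP[[a [ai qa]] Zq]].
  have [f [hf fZ fq]] := zclosed_pfun cZ Zq; exists f, a; split=> //.
  apply/eqP => fa; case: fq; apply: (vanishes_at_rep hf (Phi_neq0 a)) => //.
  by rewrite qa memv_line.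
have [f1 [a1 [fZ1 hf1 fa1 ai1]]] := sl _ cZ1 N1.
have [f2 [a2 [fZ2 hf2 fa2 ai2]]] := sl _ cZ2 N2.
have pf f : pfun (fun a => mev f (Phi a)) by apply: pfun_comp pPhi (pfun_mev f).
have [s []] := pfun_generic F0 (pf f1) (pf f2) fa1 fa2.
set a := a1 + _ => fa1' fa2'.
have : zclosure (slice i) (point (Phi_neq0 a)).
  apply: subset_zclosure; exists a; split=> // j ij.
  by rewrite linearD linearZ linearB /= ai1 // ai2 // subrr mulr0 addr0.
move/Z12 => [/fZ1 f0|/fZ2 f0].
  by case/eqP: fa1'; apply: (vanishes_at_line hf1 f0); apply: memv_line.
by case/eqP: fa2'; apply: (vanishes_at_line hf2 f0); apply: memv_line.
Qed.

Lemma chart_regular : regular_at X p.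
Proof.
have [U XU] := exists_tangent_space X p; exists U, (\dim {:A}).
split=> //; last exact: chart_tangent_dim.
split; last first.
  move=> e ch; rewrite -ltnS -dim_cone_chart; apply: (chain_bound F0 pcone _ ch).
  by move=> G pG G0; apply: PhiX => // t a; apply: (G0 (t, a)).
exists (fun i => zclosure (slice i)); split=> [|i _|i iN].
- apply: subset_zclosure; exists a0; split=> //; apply: val_point (Phi_neq0 _) _.
  rewrite (_ : Phi a0 = (x0 x)^-1 *: x); first exact/memvZ/mem_rep.
  by rewrite [in RHS]chart_rep scalerA x0Z x0Phi mulr1 mulVf ?scale1r ?chart_x0.
- split; [exact: zclosed_zclosure|exact: slice_irreducible|].
  by apply: zclosure_sub => // q [a [_ /XPhi]].
split.
  apply: zclosure_sub; first exact: zclosed_zclosure.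
  move=> q [a [ai qa]]; apply: subset_zclosure; exists a; split=> // j ij.
  by apply: ai; apply: ltnW.
move=> sub; pose i' := Ordinal iN.
(* [G] compares the coordinate i' of psi / h with that of a0. It vanishes on the smaller slice; on
   the larger one it is nonzero where the increment s and h are nonzero. *)
pose G w := cA i' (psi w) - h w * cA i' a0.
have pG : pfun G.
  by apply: pfunB; [apply: ppsi|apply: pfunM => //; apply: pfunC].
have G0 : cvanish (zclosure (slice i.+1)) G.
  suff H : cvanish (zclosure (slice i)) G by move=> q v /sub; apply: H.
  apply: (cvanish_closure F0 pG) => q v [a [ai qa]]; rewrite qa => /vlineP[t ->].
  by rewrite /G psiPhi linearZ /= ai ?subrr // leqnn.
pose a s := a0 + s *: (vbasis {:A})`_i'.
have aE s j : cA j (a s) = cA j a0 + s * (j == i')%:R.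
  rewrite /a linearD; congr (_ + _).
  rewrite linearZ -[LHS]/(s * cA j (vbasis {:A})`_i').
  by rewrite coord_free ?(basis_free (vbasisP _)) // eq_sym.
have ph' : pfun (fun a => h (x0 x *: Phi a)).
  by apply: (pfun_comp _ ph); apply: pmapZ => //; apply: pfunC.
have [r rE] := pfun_line a0 (vbasis {:A})`_i' ph'.
have r0 : r != 0.
  apply: contra_neq hp => r0; have := rE 0.
  by rewrite scale0r addr0 -chart_rep r0 horner0.
have X0 : ('X : {poly F}) != 0 by rewrite polyX_eq0.
have [s] := poly_neq0 F0 (mulf_neq0 X0 r0).
rewrite hornerM hornerX mulf_eq0 negb_or -rE => /andP[s0 hs].
have : G (x0 x *: Phi (a s)) = 0.
  apply: (G0 (point (Phi_neq0 (a s)))); last by apply/vlineP; exists (x0 x).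
  apply: subset_zclosure; exists (a s); split=> // j ij.
  by rewrite aE (_ : (j == i') = false) ?mulr0 ?addr0 //; apply/eqP => ji; rewrite ji ltnn in ij.
move/eqP; rewrite /G psiPhi linearZ /= aE eqxx mulr1 mulrDr addrAC subrr add0r.
by rewrite mulf_eq0 (negPf hs) (negPf s0).
Qed.

End Chart.

(** * Alternating forms and evaluation of exterior vectors *)

Section AlternatingForms.
Variables (F : fieldType) (C : vectType F) (k : nat) (X : ('I_k -> C) -> F).
Hypothesis XP : @multilinear_alternating F C k F^o X.
Implicit Types (Y : 'I_k -> C) (i j l m : 'I_k) (u v w : C).

Lemma alt_linear Y i a u v :
  X (update Y i (a *: u + v)) = a * X (update Y i u) + X (update Y i v).
Proof. by have [XL _] := XP; have := XL Y i a u v. Qed.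

Lemma alt_add Y i u v : X (update Y i (u + v)) = X (update Y i u) + X (update Y i v).
Proof. by rewrite -[u]scale1r alt_linear mul1r scale1r. Qed.

Lemma alt_zero Y i : X (update Y i 0) = 0.
Proof. by apply: (addIr (X (update Y i 0))); rewrite -alt_add !add0r. Qed.

Lemma alt_scale Y i a u : X (update Y i (a *: u)) = a * X (update Y i u).
Proof. by rewrite -[a *: u]addr0 alt_linear alt_zero addr0. Qed.

Lemma alt_eq Y i j : i != j -> Y i = Y j -> X Y = 0.
Proof. by have [_ XA] := XP; move=> ij /(XA _ _ _ ij). Qed.

Lemma update_id Y i : update Y i (Y i) = Y.
Proof. by apply/funext=> j; rewrite /update; case: eqP => [->|]. Qed.

Lemma updateC Y i j u v : i != j ->
  update (update Y i u) j v = update (update Y j v) i u.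
Proof.
move=> ij; apply/funext=> l; rewrite /update.
by case: (eqVneq l j) => [->|//]; rewrite eq_sym (negPf ij).
Qed.

Lemma updateK Y i u v : update (update Y i u) i v = update Y i v.
Proof. by apply/funext=> l; rewrite /update; case: eqP. Qed.

Lemma update_eq Y i u : update Y i u i = u.
Proof. by rewrite /update eqxx. Qed.

Lemma update_neq Y i j u : j != i -> update Y i u j = Y j.
Proof. by rewrite /update => /negPf->. Qed.

Lemma alt_swap Y i j u v : i != j ->
  X (update (update Y i u) j v) = - X (update (update Y i v) j u).
Proof.
move=> ij; have := multilinear_alternating_tperm XP (update (update Y i v) j u) ij.
move=> <-; congr X; apply/funext=> l /=.
case: tpermP => [->|->|/eqP li /eqP lj]; rewrite /update ?eqxx ?(negPf ij) //.
by rewrite (negPf li) (negPf lj).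
Qed.

Definition x1 Y i u := X (update Y i u).
Definition x2 Y i j u v := X (update (update Y i u) j v).
Definition x3 Y i j l u v w := X (update (update (update Y i u) j v) l w).

Lemma x1_frame Y i m : x1 Y i (Y m) = (m == i)%:R * X Y.
Proof.
rewrite /x1; case: (eqVneq m i) => [->|mi]; first by rewrite update_id mul1r.
by rewrite mul0r (@alt_eq _ m i) // update_eq update_neq.
Qed.

Lemma x2_sym Y i j u v : i != j -> x2 Y i j u v = x2 Y j i v u.
Proof. by move=> ij; rewrite /x2 updateC. Qed.

Lemma x2_anti Y i j u v : i != j -> x2 Y i j u v = - x2 Y i j v u.
Proof. exact: alt_swap. Qed.

Lemma x2_frame Y i j m v : i != j ->
  x2 Y i j (Y m) v = (m == i)%:R * x1 Y j v - (m == j)%:R * x1 Y i v.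
Proof.
move=> ij; have ji : j != i by rewrite eq_sym.
have [->|mi] := eqVneq m i; first by rewrite (negPf ij) mul0r subr0 mul1r /x2 update_id.
have [->|mj] := eqVneq m j; first by rewrite mul0r mul1r sub0r x2_anti // x2_sym // /x2 update_id.
by rewrite !mul0r subr0 /x2 (@alt_eq _ m i) // update_neq // update_neq // update_neq ?update_eq // eq_sym.
Qed.

Lemma x3_anti12 Y i j l u v w : i != j -> i != l -> j != l ->
  x3 Y i j l u v w = - x3 Y i j l v u w.
Proof.
move=> ij il jl; have U a b : update (update (update Y i a) j b) l w = update (update (update Y l w) i a) j b.
  by rewrite updateC // [update (update Y i a) l w]updateC // eq_sym.
by rewrite /x3 !U alt_swap.
Qed.

Lemma x3_anti23 Y i j l u v w : j != l -> x3 Y i j l u v w = - x3 Y i j l u w v.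
Proof. by move=> jl; rewrite /x3 alt_swap. Qed.

Lemma x3_sym12 Y i j l u v w : i != j -> x3 Y i j l u v w = x3 Y j i l v u w.
Proof. by move=> ij; rewrite /x3 [update (update Y i u) j v]updateC. Qed.

Lemma x3_sym23 Y i j l u v w : j != l -> x3 Y i j l u v w = x3 Y i l j u w v.
Proof. by move=> jl; rewrite /x3 updateC. Qed.

Lemma x3_frame Y i j l m v w : i != j -> i != l -> j != l ->
  x3 Y i j l (Y m) v w = (m == i)%:R * x2 Y j l v w -
     (m == j)%:R * x2 Y i l v w + (m == l)%:R * x2 Y i j v w.
Proof.
move=> ij il jl; have [ji li lj] : [/\ j != i, l != i & l != j] by rewrite ![_ == i]eq_sym [l == j]eq_sym.
have [->|mi] := eqVneq m i.
  by rewrite (negPf ij) (negPf il) !mul0r mul1r subr0 addr0 /x3 update_id.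
have [->|mj] := eqVneq m j.
  rewrite (negPf jl) !mul0r mul1r sub0r addr0 x3_anti12 // x3_sym12 // /x3 update_id.
  by rewrite -/(x2 Y i l v w).
have [->|ml] := eqVneq m l; last first.
  rewrite !mul0r subr0 addr0 /x3 (@alt_eq _ m i) //.
  by rewrite /update (negPf ml) (negPf mj) (negPf mi) (negPf il) (negPf ij) eqxx.
rewrite mul0r mul0r mul1r subr0 add0r x3_anti12 // x3_anti23 // opprK.
rewrite /x3 -[Y l](_ : update (update Y i v) j w l = Y l) ?update_id //.
by rewrite !update_neq.
Qed.

(* [c2] and [c3] are invariant under adding elements of the frame to u, v, w; on
   [al *: wdg A + be *: wdg B], for a frame dual to A and B, [c2] is al * be times
   a 2-minor of A - B, and [c3] a multiple of a 3-minor. *)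
Definition c2 Y i j u v :=
  X Y * x2 Y i j u v - (x1 Y i u * x1 Y j v - x1 Y i v * x1 Y j u).

Definition c3 Y i j l u v w :=
  X Y ^+ 2 * x3 Y i j l u v w
  - X Y * (x1 Y i u * x2 Y j l v w - x1 Y i v * x2 Y j l u w + x1 Y i w * x2 Y j l u v
         - x1 Y j u * x2 Y i l v w + x1 Y j v * x2 Y i l u w - x1 Y j w * x2 Y i l u v
         + x1 Y l u * x2 Y i j v w - x1 Y l v * x2 Y i j u w + x1 Y l w * x2 Y i j u v)
  + 2 * (x1 Y i u * (x1 Y j v * x1 Y l w - x1 Y j w * x1 Y l v)
       - x1 Y i v * (x1 Y j u * x1 Y l w - x1 Y j w * x1 Y l u)
       + x1 Y i w * (x1 Y j u * x1 Y l v - x1 Y j v * x1 Y l u)).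

Lemma c2_anti Y i j u v : i != j -> c2 Y i j u v = - c2 Y i j v u.
Proof. by move=> ij; rewrite /c2 x2_anti //; ring. Qed.

Lemma c2_frame Y i j m v : i != j -> c2 Y i j (Y m) v = 0.
Proof.
move=> ij; rewrite /c2 x2_frame // !x1_frame.
by case: (eqVneq m i) => [mi|_]; case: (eqVneq m j) => [mj|_] //=; ring.
Qed.

Lemma c3_frame Y i j l m v w : i != j -> i != l -> j != l -> c3 Y i j l (Y m) v w = 0.
Proof.
move=> ij il jl; rewrite /c3 x3_frame // !x2_frame // !x1_frame.
case: (eqVneq m i) => [mi|_]; case: (eqVneq m j) => [mj|_]; case: (eqVneq m l) => [ml|_] //=; try ring.
all: by move: ij il jl; rewrite -?mi -?mj -?ml ?eqxx.
Qed.

Lemma x1_linear Y i a u v : x1 Y i (a *: u + v) = a * x1 Y i u + x1 Y i v.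
Proof. exact: alt_linear. Qed.

Lemma x2_linear Y i j a u v w : i != j ->
  x2 Y i j (a *: u + v) w = a * x2 Y i j u w + x2 Y i j v w.
Proof. by move=> ij; rewrite /x2 !(updateC _ _ _ ij) alt_linear. Qed.

Lemma x3_linear Y i j l a u v w z : i != j -> i != l ->
  x3 Y i j l (a *: u + v) w z = a * x3 Y i j l u w z + x3 Y i j l v w z.
Proof.
move=> ij il; have U y : update (update (update Y i y) j w) l z = update (update (update Y j w) l z) i y.
  by rewrite (updateC Y _ _ ij) updateC.
by rewrite /x3 !U alt_linear.
Qed.

Lemma c2_linear Y i j a u v w : i != j ->
  c2 Y i j (a *: u + v) w = a * c2 Y i j u w + c2 Y i j v w.
Proof. by move=> ij; rewrite /c2 x2_linear // !x1_linear; ring. Qed.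

Lemma c3_linear Y i j l a u v w z : i != j -> i != l -> j != l ->
  c3 Y i j l (a *: u + v) w z = a * c3 Y i j l u w z + c3 Y i j l v w z.
Proof. by move=> ij il jl; rewrite /c3 x3_linear // !x2_linear // !x1_linear; ring. Qed.

Lemma c3_anti12 Y i j l u v w : i != j -> i != l -> j != l ->
  c3 Y i j l u v w = - c3 Y i j l v u w.
Proof.
move=> ij il jl; rewrite /c3 x3_anti12 // (x2_anti _ u v ij) (x2_anti _ u v il) (x2_anti _ u v jl).
ring.
Qed.

Lemma c3_anti23 Y i j l u v w : i != j -> i != l -> j != l ->
  c3 Y i j l u v w = - c3 Y i j l u w v.
Proof.
move=> ij il jl; rewrite /c3 x3_anti23 // (x2_anti _ v w ij) (x2_anti _ v w il) (x2_anti _ v w jl).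
ring.
Qed.

Section LinearForms.
Variable f : C -> F.
Hypothesis fL : forall a u v, f (a *: u + v) = a * f u + f v.

Lemma lin0 : f 0 = 0.
Proof.
have := fL 1 0 0; rewrite scale1r mul1r addr0 => E.
by apply: (addIr (f 0)); rewrite add0r -E.
Qed.

Lemma linZ a u : f (a *: u) = a * f u.
Proof. by rewrite -[a *: u]addr0 fL lin0 addr0. Qed.

Lemma linD u v : f (u + v) = f u + f v.
Proof. by rewrite -[u]scale1r fL mul1r scale1r. Qed.

Lemma lin_sum (I : finType) (g : I -> C) : f (\sum_i g i) = \sum_i f (g i).
Proof. exact: (big_morph f linD lin0). Qed.
End LinearForms.

(* [X Y] times the projection onto the common kernel of the forms [x1 Y i],
   parallel to the span of the frame [Y]. *)
Definition center Y u := X Y *: u - \sum_m x1 Y m u *: Y m.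

Lemma x1_center Y i u : x1 Y i (center Y u) = 0.
Proof.
have fL a v w := x1_linear Y i a v w.
rewrite /center (linD fL) -scaleN1r !(linZ fL) (lin_sum fL).
rewrite (bigD1 i) //= big1 => [|m mi].
  by rewrite addr0 (linZ fL) x1_frame eqxx mul1r; ring.
by rewrite (linZ fL) x1_frame (negPf mi) mul0r mulr0.
Qed.

Lemma centerE (f : C -> F) Y u : (forall a v w, f (a *: v + w) = a * f v + f w) ->
  (forall m, f (Y m) = 0) -> f (center Y u) = X Y * f u.
Proof.
move=> fL fY; rewrite /center (linD fL) -scaleN1r !(linZ fL) (lin_sum fL) big1 ?mulr0 ?addr0 //.
by move=> m _; rewrite (linZ fL) fY mulr0.
Qed.

Lemma c2_center Y i j u v : i != j ->
  c2 Y i j (center Y u) (center Y v) = X Y ^+ 2 * c2 Y i j u v.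
Proof.
move=> ij; rewrite (@centerE (fun z => c2 Y i j z _)); last 2 first.
- by move=> *; apply: c2_linear.
- by move=> *; apply: c2_frame.
rewrite c2_anti // (@centerE (fun z => c2 Y i j z _)); last 2 first.
- by move=> *; apply: c2_linear.
- by move=> *; apply: c2_frame.
by rewrite (c2_anti _ u v) //; ring.
Qed.

Lemma c3_center Y i j l u v w : i != j -> i != l -> j != l ->
  c3 Y i j l (center Y u) (center Y v) (center Y w) = X Y ^+ 3 * c3 Y i j l u v w.
Proof.
move=> ij il jl.
have E z a b : c3 Y i j l (center Y z) a b = X Y * c3 Y i j l z a b.
  rewrite (@centerE (fun z => c3 Y i j l z a b)) // => *; first exact: c3_linear.
  exact: c3_frame.
have E2 z a b : c3 Y i j l a (center Y z) b = X Y * c3 Y i j l a z b.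
  by rewrite c3_anti12 // E (c3_anti12 _ a z) //; ring.
have E3 z a b : c3 Y i j l a b (center Y z) = X Y * c3 Y i j l a b z.
  by rewrite c3_anti23 // E2 (c3_anti23 _ a b) //; ring.
by rewrite E E2 E3; ring.
Qed.

End AlternatingForms.

Section Evaluation.
Variables (F : fieldType) (V : vectType F) (k : nat).
Local Notation n := (\dim {:V}).
Local Notation C := 'cV[F]_n.
Local Notation W := (extpow V k).

Definition wdg (A : 'M[F]_(k, n)) : W :=
  wedge (fun i => \sum_j A i j *: (vbasis {:V})`_j).

Definition coords_mx (v : 'I_k -> V) : 'M[F]_(k, n) :=
  \matrix_(i, j) coord (vbasis {:V}) j (v i).

Lemma coord_basis_sum (c : 'I_n -> F) j :
  coord (vbasis {:V}) j (\sum_j c j *: (vbasis {:V})`_j) = c j.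
Proof. by rewrite coord_sum_free // (basis_free (vbasisP _)). Qed.

Lemma wedge_wdg v : wedge v = wdg (coords_mx v).
Proof.
congr wedge; apply/funext=> i; rewrite {1}(coord_sum (v i)).
by apply: eq_bigr => j _; rewrite mxE.
Qed.

Lemma wdgE A s : (wdg A : {ffun _ -> F^o}) s = \det (\matrix_(i, j) A i (val s j)).
Proof.
rewrite ffunE; congr (\det _); apply/matrixP=> i j.
by rewrite !mxE coord_basis_sum.
Qed.

(** The columns are covectors in coordinates, and the value is the pairing of x with their wedge
    product, written with maximal minors. *)
Definition ev (x : W) (Y : 'I_k -> C) : F :=
  \sum_(s : incr_index V k) (x s : F) * \det (\matrix_(i < k, j < k) Y j (val s i) 0).

Lemma ev_linear a x y Y : ev (a *: x + y) Y = a * ev x Y + ev y Y.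
Proof.
rewrite /ev big_distrr -big_split /=; apply: eq_bigr => s _.
by rewrite !ffunE mulrDl mulrA.
Qed.

(** The Cauchy-Binet formula. The determinant is alternating in the rows of A, so it factors through
    a linear form on the exterior power, which is computed on basis vectors. *)
Lemma ev_wdg A Y : ev (wdg A) Y = \det (\matrix_(i < k, j < k) (A *m Y j) i 0).
Proof.
pose f (v : 'I_k -> V) : F^o := \det (\matrix_(i, j) (coords_mx v *m Y j) i 0).
have fP : multilinear_alternating f.
  split=> [v i a u w|v i j ij vij]; last first.
    apply: (determinant_alternate ij) => l; rewrite !mxE.
    by apply: eq_bigr => m _; rewrite !mxE vij.
  rewrite /GRing.scale /= -[X in _ = _ + X]mul1r.
  apply: (@determinant_multilinear _ _ _ _ _ i).
  - apply/rowP=> j; rewrite !mxE mul1r big_distrr -big_split /=.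
    apply: eq_bigr => m _; rewrite !mxE /update eqxx linearP mulrDl mulrA //.
  - by apply/matrixP=> l j; rewrite !mxE; apply: eq_bigr => m _;
      rewrite !mxE /update eq_sym (negPf (neq_lift _ _)).
  - by apply/matrixP=> l j; rewrite !mxE; apply: eq_bigr => m _;
      rewrite !mxE /update eq_sym (negPf (neq_lift _ _)).
have [_ /(_ _ _ fP)[g [gf _]]] := extpow_universal V k.
have fE (B : 'M[F]_(k, n)) : f (fun i => \sum_j B i j *: (vbasis {:V})`_j) = \det (\matrix_(i, j) (B *m Y j) i 0).
  congr (\det _); apply/matrixP=> i j; rewrite !mxE; apply: eq_bigr => m _.
  by rewrite mxE coord_basis_sum.
rewrite -fE -gf -/(wdg A).
have wE (w : W) : w = \sum_s (w s : F) *: wedge (basis_vector (V := V) \o val s).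
  apply/ffunP=> t; rewrite sum_ffunE (bigD1 t) //= big1 => [|s st].
    by rewrite wedge_basis !ffunE eqxx addr0 /GRing.scale /= mulr1.
  by rewrite wedge_basis !ffunE (negPf st) /GRing.scale /= mulr0.
rewrite [in RHS](wE (wdg A)) linear_sum; apply: eq_bigr => s _.
rewrite linearZ /= gf /GRing.scale /=; congr (_ * _).
congr (\det _); apply/matrixP=> i j; rewrite !mxE (bigD1 (val s i)) //= big1 => [|m mi].
  by rewrite mxE /basis_vector coord_free ?(basis_free (vbasisP _)) // eqxx mul1r addr0.
rewrite mxE /basis_vector coord_free ?(basis_free (vbasisP _)) // eq_sym.
by rewrite (negPf (mi : m != _ :> 'I__)) mul0r.
Qed.

Lemma ev_alternating x : @multilinear_alternating F C k F^o (ev x).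
Proof.
split=> [Y i a u v|Y i j ij Yij].
  rewrite /ev /GRing.scale /= big_distrr -big_split /=; apply: eq_bigr => s _.
  rewrite mulrCA -mulrDr; congr (_ * _).
  rewrite -!(det_tr (\matrix_(_, _) _)) -[X in _ = _ + X]mul1r.
  apply: (@determinant_multilinear _ _ _ _ _ i).
  - by apply/rowP=> j; rewrite !mxE /update eqxx !mxE mul1r.
  - by apply/matrixP=> l j; rewrite !mxE /update eq_sym (negPf (neq_lift _ _)).
  - by apply/matrixP=> l j; rewrite !mxE /update eq_sym (negPf (neq_lift _ _)).
rewrite /ev big1 // => s _; rewrite -det_tr (determinant_alternate ij) ?mulr0 // => l.
by rewrite !mxE Yij.
Qed.

Lemma ev_coord x (t : incr_index V k) :
  ev x (fun j => \col_i (i == val t j)%:R) = x t.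
Proof.
rewrite /ev (bigD1 t) //= big1 => [|s st]; last first.
  have E : wedge (basis_vector (V := V) \o val t) s = 0 :> F.
    by rewrite wedge_basis ffunE eq_sym (negPf st).
  rewrite -[RHS](mulr0 (x s : F)) -[in RHS]E ffunE; congr (_ * _).
  rewrite -[RHS]det_tr; congr (\det _); apply/matrixP=> i j; rewrite !mxE /=.
  by rewrite /basis_vector coord_free ?(basis_free (vbasisP _)) // eq_sym.
rewrite addr0 -[RHS]mulr1; congr (_ * _); rewrite -[RHS](det1 F k); congr (\det _).
by apply/matrixP=> i j; rewrite !mxE (inj_eq (@incr_index_inj _ _ _ t)).
Qed.

Lemma ev_inj x y : (forall Y, ev x Y = ev y Y) -> x = y.
Proof. by move=> xy; apply/ffunP=> t; rewrite -!ev_coord xy. Qed.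

Lemma ev0 Y : ev 0 Y = 0.
Proof. by rewrite /ev big1 // => s _; rewrite ffunE mul0r. Qed.

Lemma evD x y Y : ev (x + y) Y = ev x Y + ev y Y.
Proof. by rewrite -[x]scale1r ev_linear mul1r scale1r. Qed.

Lemma evZ a x Y : ev (a *: x) Y = a * ev x Y.
Proof. by rewrite -[a *: x]addr0 ev_linear ev0 addr0. Qed.

Lemma ev_sum (I : finType) (x : I -> W) Y : ev (\sum_i x i) Y = \sum_i ev (x i) Y.
Proof. by apply: (big_morph (fun x => ev x Y)) => [x' y'|]; rewrite ?evD ?ev0. Qed.

Lemma pfun_ev (P : vectType F) (x : P -> W) (Y : P -> 'I_k -> C) :
  pmap x -> (forall j r, pfun (fun p => Y p j r 0)) -> pfun (fun p => ev (x p) (Y p)).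
Proof.
move=> px pY; apply: pfun_sum => s _; apply: pfunM.
  by apply: (pfun_pmap (l := fun w : W => w s : F)) px => a u v; rewrite !ffunE.
by apply: pfun_det => i j; apply: eq_pfun (pY j (val s i)) => p; rewrite mxE.
Qed.

Lemma pfun_update (P : vectType F) (Y : P -> 'I_k -> C) i (u : P -> C) :
  (forall j r, pfun (fun p => Y p j r 0)) -> (forall r, pfun (fun p => u p r 0)) ->
  forall j r, pfun (fun p => update (Y p) i (u p) j r 0).
Proof.
move=> pY pu j r; rewrite /update; case: (eqVneq j i) => _; [exact: pu|exact: pY].
Qed.

Lemma pmap_wdg (P : vectType F) (A : P -> 'M[F]_(k, n)) :
  (forall i j, pfun (fun p => A p i j)) -> pmap (fun p => wdg (A p)).
Proof.
move=> pA; apply: pmap_ffun => s; apply: eq_pfun (fun p => esym (wdgE (A p) s)) _.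
apply: pfun_det => i j; apply: eq_pfun (pA i (val s j)) => p.
by rewrite mxE.
Qed.

Lemma wdg_mul (G : 'M[F]_k) A : wdg (G *m A) = \det G *: wdg A.
Proof.
apply: ev_inj => Y; rewrite evZ !ev_wdg -det_mulmx; congr (\det _).
apply/matrixP=> i j; rewrite [LHS]mxE -mulmxA !mxE; apply: eq_bigr => m _.
by rewrite !mxE.
Qed.

Lemma wdg_scale (k0 : (0 < k)%N) c (A : 'M[F]_(k, n)) : exists B, c *: wdg A = wdg B.
Proof.
pose j0 := Ordinal k0.
exists (diag_mx (\row_j (if j == j0 then c else 1)) *m A).
rewrite wdg_mul det_diag (bigD1 j0) //= big1 => [|j jj]; rewrite mxE ?eqxx ?mulr1 //.
by rewrite (negPf jj).
Qed.

End Evaluation.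

(** * A parametrization of the secant variety *)

Section Moments.
Variables (F : fieldType) (F0 : [pchar F] =i pred0) (k : nat).

Fixpoint tau2 (d : F) j : F * F :=
  if j is j'.+1 then let: (a, b) := tau2 d j' in (b, b + d * a) else (1, 0).

(* [tau d j] is the value at 'X^j of the linear form on F[X] which sends 1 to 1,
   'X to 0 and vanishes on the multiples of 'X^2 - 'X - d. *)
Definition tau d j := (tau2 d j).1.

Lemma tauSS d j : tau d j.+2 = tau d j.+1 + d * tau d j.
Proof. by rewrite /tau /=; case: (tau2 d j). Qed.

Lemma tau_pfun (P : vectType F) (d : P -> F) j : pfun d -> pfun (fun p => tau (d p) j).
Proof.
move=> pd; suff [] : pfun (fun p => tau (d p) j) /\ pfun (fun p => tau (d p) j.+1) by [].
elim: j => [|j [IH1 IH2]]; first by split; apply: pfunC.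
split=> //; apply: eq_pfun (pfunD IH2 (pfunM pd IH1)) => p.
by rewrite tauSS.
Qed.

(** The recurrence has characteristic polynomial 'X^2 - 'X - d with roots l1 and l2; the
    coefficients are fitted to the initial values 1 and 0. *)
Lemma tau_roots l1 l2 j : l1 + l2 = 1 -> l1 != l2 ->
  tau (- (l1 * l2)) j = - l2 / (l1 - l2) * l1 ^+ j + l1 / (l1 - l2) * l2 ^+ j.
Proof.
move=> l12 l1N2; have e0 : l1 - l2 != 0 by rewrite subr_eq0.
suff [] : tau (- (l1 * l2)) j = - l2 / (l1 - l2) * l1 ^+ j + l1 / (l1 - l2) * l2 ^+ j /\
  tau (- (l1 * l2)) j.+1 = - l2 / (l1 - l2) * l1 ^+ j.+1 + l1 / (l1 - l2) * l2 ^+ j.+1 by [].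
elim: j => [|j [IH1 IH2]].
  by split; rewrite /tau /= ?expr0 ?expr1; field.
split=> //; rewrite tauSS IH2 IH1 !exprS.
have l2E : l2 = 1 - l1 by rewrite -l12 addrC addKr.
move: (l1 ^+ j) (l2 ^+ j) => u v; move: e0; rewrite l2E => e0; field.
exact: e0.
Qed.

Definition node : 'rV[F]_k.+1 := \row_j j%:R.

Lemma node_unit : Vandermonde k.+1 node \in unitmx.
Proof.
rewrite unitmxE unitfE det_Vandermonde; apply/prodf_neq0 => i _.
apply/prodf_neq0 => j ij; rewrite !mxE subr_eq0; apply/eqP => /(natr_char0_inj F0) ji.
by rewrite ji ltnn in ij.
Qed.

(** Quadrature at the nodes 0, ..., k: the weights reproduce the moments [tau] up to degree k, which
    is the degree in s of the wedge of a graph, and unlike the roots l1, l2 they are polynomial in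
    d. *)
Definition weight d (r : 'I_k.+1) : F :=
  (invmx (Vandermonde k.+1 node) *m \col_i tau d i) r 0.

Lemma weight_pfun (P : vectType F) (d : P -> F) r :
  pfun d -> pfun (fun p => weight (d p) r).
Proof.
move=> pd; apply: eq_pfun (fun p => esym (mxE _ _ _ _)) _.
apply: pfun_sum => i _; apply: pfunM; first exact: pfunC.
by apply: eq_pfun (tau_pfun i pd) => p; rewrite mxE.
Qed.

Lemma weight_moment d (i : 'I_k.+1) : \sum_r weight d r * r%:R ^+ i = tau d i.
Proof.
have /(congr1 (fun v : 'cV_k.+1 => v i 0)) := mulKVmx node_unit (\col_i tau d i).
rewrite [X in _ = X]mxE => <-; rewrite mxE; apply: eq_bigr => r _.
by rewrite [Vandermonde _ _ _ _]mxE mxE mulrC.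
Qed.

Lemma weight_horner d (q : {poly F}) : (size q <= k.+1)%N ->
  \sum_r weight d r * q.[r%:R] = \sum_(i < k.+1) q`_i * tau d i.
Proof.
move=> sq; under eq_bigr => r _ do rewrite (horner_coef_wide _ sq) big_distrr.
rewrite exchange_big; apply: eq_bigr => i _; rewrite -weight_moment big_distrr /=.
by apply: eq_bigr => r _; rewrite mulrCA.
Qed.

Lemma weight_cubic d p0 p1 p2 p3 : (3 <= k)%N ->
  \sum_r weight d r * (p0 + p1 * r%:R + p2 * r%:R ^+ 2 + p3 * r%:R ^+ 3) =
  p0 + d * p2 + d * p3.
Proof.
move=> k3; have m i : (i <= k)%N -> \sum_r weight d r * r%:R ^+ i = tau d i.
  by rewrite -ltnS => ik; have := weight_moment d (Ordinal ik).
transitivity (p0 * tau d 0 + p1 * tau d 1 + p2 * tau d 2 + p3 * tau d 3); last first.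
  by rewrite !tauSS /tau /=; ring.
rewrite -!m ?(leq_trans _ k3) // !big_distrr -!big_split /=.
by apply: eq_bigr => r _; rewrite expr0 expr1; ring.
Qed.

Lemma size_det_linear (n : nat) (A : 'M[{poly F}]_n) :
  (forall i j, (size (A i j) <= 2)%N) -> (size (\det A) <= n.+1)%N.
Proof.
move=> sA; rewrite /determinant; apply: (leq_trans (size_sum _ _ _)).
apply/bigmax_leqP => s _; rewrite -signr_odd; case: (odd _); rewrite ?expr0 ?expr1 ?mulN1r ?size_polyN ?mul1r.
all: apply: leq_trans (size_prod_leq _ _) _; rewrite card_ord leq_subLR.
all: apply: (@leq_trans (\sum_(i < n) 2).+1); first by rewrite ltnS; apply: leq_sum => i _.
all: by rewrite sum_nat_const card_ord addnS ltnS mulnC mul2n -addnn.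
Qed.

End Moments.

Section SecantParametrization.
Variables (F : closedFieldType) (F0 : [pchar F] =i pred0) (V : vectType F) (k m : nat).
Local Notation n := (\dim {:V}).
Local Notation C := 'cV[F]_n.
Local Notation W := (extpow V k).
Hypothesis k3 : (3 <= k)%N.
Let k0 : (0 < k)%N := ltnW (ltnW k3).
Variables (E : 'M[F]_(n, k)) (Q : 'M[F]_(n, m)) (P : 'M[F]_(k, n)) (R : 'M[F]_(m, n)).
Hypotheses (PE : P *m E = 1%:M) (PQ : P *m Q = 0) (RE : R *m E = 0) (RQ : R *m Q = 1%:M).
Hypothesis EPQR : E *m P + Q *m R = 1%:M.

Local Notation par := ('M[F]_(k, m) * 'M[F]_(k, m) * F^o)%type.

(** The affine chart of matrices dual to the columns of E: if A *m E is invertible, row operations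
    turn A into the graph of exactly one N. *)
Definition graph (N : 'M[F]_(k, m)) : 'M[F]_(k, n) := P + N *m R.

(* The linear form of [tau], applied to the polynomial s |-> wdg (graph (M + s *: D)).
   When l1 != l2 are the roots of 'X^2 - 'X - d, this is the combination of the
   decomposable vectors at s = l1 and s = l2 in [secant_par_roots]; using d instead
   of the roots makes the parametrization generically injective. *)
Definition secant_par (a : par) : W :=
  \sum_(r < k.+1) weight (a.2 : F) r *: wdg (graph (a.1.1 + r%:R *: a.1.2)).

Lemma pmap_secant_par : pmap secant_par.
Proof.
apply: pmap_sum => r _; apply: pmapZ.
  by apply: weight_pfun; apply: (@pfun_linear _ par (fun a => a.2 : F)).
apply: pmap_wdg => i j.
apply: (@eq_pfun _ par (fun a => P i j + (a.1.1 *m R) i j + r%:R * (a.1.2 *m R) i j)).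
  by move=> a; rewrite /graph mulmxDl -scalemxAl !mxE addrA.
apply: pfunD; first apply: pfunD; first exact: pfunC.
  by apply: (@pfun_linear _ par) => a u v; rewrite mulmxDl -scalemxAl !mxE.
apply: pfunM; first exact: pfunC.
by apply: (@pfun_linear _ par) => a u v; rewrite mulmxDl -scalemxAl !mxE.
Qed.

Lemma graph_frame N j : graph N *m col j E = \col_i (i == j)%:R.
Proof.
rewrite colE mulmxA [graph N *m E]mulmxDl -mulmxA PE RE mulmx0 addr0 mul1mx.
by apply/colP=> i; rewrite !mxE eqxx andbT.
Qed.

Lemma graph_coframe N a : graph N *m col a Q = col a N.
Proof.
rewrite colE mulmxA [graph N *m Q]mulmxDl -mulmxA PQ RQ mulmx1 add0r.
by rewrite -colE.
Qed.

Lemma ev_secant_par a Y :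
  ev (secant_par a) Y =
  \sum_(r < k.+1) weight (a.2 : F) r * ev (wdg (graph (a.1.1 + r%:R *: a.1.2))) Y.
Proof. by rewrite ev_sum; apply: eq_bigr => r _; rewrite evZ. Qed.

Lemma ev_graph_poly (M D : 'M[F]_(k, m)) Y : exists q : {poly F}, (size q <= k.+1)%N /\
  forall s, ev (wdg (graph (M + s *: D))) Y = q.[s].
Proof.
exists (\det (\matrix_(i < k, j < k) ((((P + M *m R) *m Y j) i 0)%:P + ((D *m R *m Y j) i 0) *: 'X))).
split=> [|s].
  apply: size_det_linear => i j; rewrite mxE; apply: (leq_trans (size_polyD _ _)).
  rewrite geq_max (leq_trans (size_polyC_leq1 _)) //=.
  by apply: (leq_trans (size_scale_leq _ _)); rewrite size_polyX.
rewrite ev_wdg -(horner_evalE s) -det_map_mx; congr (\det _); apply/matrixP=> i j.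
rewrite [LHS]mxE [RHS]mxE /= horner_evalE [X in X.[s]]mxE !hornerE.
rewrite /graph [(M + _) *m R]mulmxDl addrA mulmxDl -!scalemxAl [LHS]mxE; congr (_ + _).
by rewrite mxE mulrC.
Qed.

Lemma secant_par_roots M D l1 l2 : l1 + l2 = 1 -> l1 != l2 ->
  secant_par (M, D, - (l1 * l2) : F^o) =
  (- l2 / (l1 - l2)) *: wdg (graph (M + l1 *: D)) + (l1 / (l1 - l2)) *: wdg (graph (M + l2 *: D)).
Proof.
move=> l12 lN; apply: ev_inj => Y; rewrite ev_secant_par evD !evZ /=.
have [q [sq qE]] := ev_graph_poly M D Y.
under eq_bigr => r _ do rewrite qE.
rewrite (weight_horner F0) // !qE !(horner_coef_wide _ sq) !big_distrr -big_split /=.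
apply: eq_bigr => i _; rewrite (tau_roots _ l12 lN); ring.
Qed.

(** In one direction, two generic matrices are brought to graphs N1, N2 with weights a, b; their
    weighted mean is M, and N1, N2 lie at l1 and l2 on the line through M with direction D. In the
    other direction, the roots exist over the closed field and are distinct for generic d. *)
Lemma secant_par_dense (G : W -> F) : pfun G ->
  (forall t a, G (t *: secant_par a) = 0) <-> (forall A B, G (wdg A + wdg B) = 0).
Proof.
move=> pG; split=> [G0 A B|G0 t [[M D] d]].
  pose mm := ('M[F]_(k, n) * 'M[F]_(k, n))%type.
  pose al (p : mm) := \det (p.1 *m E); pose be (p : mm) := \det (p.2 *m E).
  have pal : pfun al.
    by apply: pfun_det => i j; apply: (@pfun_linear _ mm) => a u v; rewrite mulmxDl -scalemxAl !mxE.
  have pbe : pfun be.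
    by apply: pfun_det => i j; apply: (@pfun_linear _ mm) => a u v; rewrite mulmxDl -scalemxAl !mxE.
  have pGw : pfun (fun p : mm => G (wdg p.1 + wdg p.2)).
    apply: (pfun_comp _ pG); apply: pmapD; apply: pmap_wdg => i j;
      by apply: (@pfun_linear _ mm) => a u v; rewrite !mxE.
  (* The factors exclude matrices that are not graphs, a missing mean when a + b = 0, and the case a
     = b, where centering forces l1 + l2 = 0 instead of 1. *)
  pose g p := al p * be p * (al p + be p) * (be p - al p).
  have pg : pfun g.
    by apply: pfunM; [apply: pfunM; [apply: pfunM|apply: pfunD]|apply: pfunB].
  (* [P] has weight 1, so a second matrix of weight 2 makes all factors of [g] nonzero: 1, 2, 3 and
     1. *)
  have [P2 P2E] : exists P2, \det (P2 *m E) = 2.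
    have [H HE] : exists H : 'M[F]_k, \det H = 2.
      case: (k) k3 => // k' _; exists (diag_mx (\row_j (if j == ord0 then 2 else 1))).
      rewrite det_diag (bigD1 ord0) //= big1 => [|j j0]; rewrite mxE ?eqxx ?mulr1 //.
      by rewrite (negPf j0).
    by exists (H *m P); rewrite -mulmxA PE mulmx1.
  have gN0 : g (P, P2) != 0.
    have -> : g (P, P2) = 6%:R by rewrite /g /al /be /= PE P2E det1; ring.
    exact: (natr_char0_neq0 F0 (isT : 6%N != 0%N)).
  apply: (pfun_eq0_generic F0 pGw pg gN0 _ (A, B)) => {A B} -[A B].
  rewrite /g /al /be /= !mulf_eq0 !negb_or => /andP[/andP[/andP[a0 b0] ab] ba].
  set a := \det (A *m E) in a0 ab ba *; set b := \det (B *m E) in b0 ab ba *.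
  have graphE (A' : 'M[F]_(k, n)) : \det (A' *m E) != 0 ->
      wdg A' = \det (A' *m E) *: wdg (graph (invmx (A' *m E) *m (A' *m Q))).
    move=> u; rewrite -wdg_mul /graph mulmxDr mulmxA mulKVmx ?unitmxE ?unitfE //.
    by rewrite -!mulmxA -mulmxDr EPQR mulmx1.
  rewrite (graphE A a0) (graphE B b0) -/a -/b.
  set N1 := invmx _ *m _; set N2 := invmx (B *m E) *m _.
  (* The solution of l1 + l2 = 1 and a * l1 + b * l2 = 0, the latter because M is the mean; c is the
     inverse of l1 - l2. *)
  pose c := (b - a) / (a + b); pose l1 := b / (b - a); pose l2 := - a / (b - a).
  have ab' : a + b != 0 by rewrite addrC in ab *.
  have l12 : l1 + l2 = 1 by rewrite /l1 /l2 -mulrDl divff.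
  have lN : l1 != l2.
    rewrite -subr_eq0 /l1 /l2 mulNr opprK -mulrDl mulf_neq0 ?invr_eq0 //.
    by rewrite addrC.
  pose M := (a / (a + b)) *: N1 + (b / (a + b)) *: N2.
  have := G0 (a + b) (M, c *: (N1 - N2), - (l1 * l2) : F^o).
  rewrite secant_par_roots // => <-; congr G; rewrite scalerDr !scalerA; congr (_ *: wdg (graph _) + _ *: wdg (graph _)).
  - rewrite /l1 /l2; field.
    by rewrite opprK [b + a]addrC ba ab'.
  - apply/matrixP=> i j; rewrite !mxE /c /l1; field.
    by rewrite ba ab'.
  - rewrite /l1 /l2; field.
    by rewrite opprK [b + a]addrC ba ab'.
  - apply/matrixP=> i j; rewrite !mxE /c /l2; field.
    by rewrite ba ab'.
have pf : pfun (fun e : F^o => G (t *: secant_par (M, D, e))).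
  apply: (pfun_comp _ pG); apply: pmapZ; first exact: pfunC.
  apply: (@pmap_comp _ _ par _ secant_par (fun e => (M, D, e))); last exact: pmap_secant_par.
  by apply: pmap_pair; [apply: pmapC|apply: pmap_id].
(* The discriminant of 'X^2 - 'X - e. *)
have pg : pfun (fun e : F^o => 1 + 4 * (e : F)).
  by apply: pfunD; [apply: pfunC|apply: pfunM; [apply: pfunC|apply: (@pfun_linear _ F^o)]].
have g0 : 1 + 4 * (0 : F) != 0 by rewrite mulr0 addr0 oner_eq0.
apply: (pfun_eq0_generic F0 pf pg (y := 0 : F^o) g0) => {}d dN.
have [l] : exists l, root ('X^2 - 'X - (d : F)%:P) l.
  have lt : (size ('X + (d : F)%:P : {poly F})%R < 3)%N.
    apply: (leq_ltn_trans (size_polyD _ _)); rewrite gtn_max size_polyX.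
    by rewrite (leq_ltn_trans (size_polyC_leq1 _)).
  by apply/closed_rootP; rewrite -addrA -opprD size_polyDl size_polyXn ?size_polyN.
rewrite /root !hornerE => /eqP lE.
have dE : d = - (l * (1 - l)) by move/eqP: lE; rewrite subr_eq0 => /eqP <-; ring.
have lN : l != 1 - l.
  rewrite -subr_eq0; apply: contra_neq dN => l0.
  rewrite dE (_ : _ + _ = (l - (1 - l)) ^+ 2); last by ring.
  by rewrite l0 expr0n.
have [B1 E1] := wdg_scale k0 (t * (- (1 - l) / (l - (1 - l)))) (graph (M + l *: D)).
have [B2 E2] := wdg_scale k0 (t * (l / (l - (1 - l)))) (graph (M + (1 - l) *: D)).
rewrite dE secant_par_roots //; last by rewrite addrC subrK.
by rewrite scalerDr !scalerA E1 E2 G0.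
Qed.

End SecantParametrization.

Section DualFrame.
Variables (F : fieldType) (V : vectType F) (k : nat).
Local Notation n := (\dim {:V}).
Local Notation C := 'cV[F]_n.
Variables (A : 'M[F]_(k, n)) (Y : 'I_k -> C).
Hypothesis AY : forall j, A *m Y j = \col_i (i == j)%:R.
Local Notation X := (ev (wdg A)).
Let XP := ev_alternating (wdg A).

Lemma ev_wdg_ker (B : 'M[F]_(k, n)) Z j : B *m Z j = 0 -> ev (wdg B) Z = 0.
Proof.
move=> BZ; rewrite ev_wdg (expand_det_col _ j) big1 // => i _.
by rewrite mxE BZ mxE mul0r.
Qed.

Lemma ev_frame : X Y = 1.
Proof.
rewrite ev_wdg -[RHS](det1 F k); congr (\det _); apply/matrixP=> i j.
by rewrite [LHS]mxE AY !mxE.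
Qed.

(** The frame spans a complement of the kernel of A, so a linear form that kills the kernel sees u
    only through A *m u. *)
Lemma frame_expand (f : C -> F) u :
  (forall a v w, f (a *: v + w) = a * f v + f w) ->
  (forall r, A *m r = 0 -> f r = 0) -> f u = \sum_m (A *m u) m 0 * f (Y m).
Proof.
move=> fL f0; under eq_bigr => m _ do rewrite -(linZ fL).
rewrite -(lin_sum fL); apply/eqP; rewrite -subr_eq0 -mulN1r -(linZ fL) -(linD fL).
apply/eqP/f0; rewrite mulmxDr -scalemxAr mulmx_sumr.
rewrite (_ : \sum_m _ = A *m u) ?scaleN1r ?subrr //.
apply/colP=> i; rewrite summxE (bigD1 i) //= big1 => [|j ji].
  by rewrite -scalemxAr AY addr0 [LHS]mxE [X in _ * X]mxE eqxx mulr1.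
by rewrite -scalemxAr AY [LHS]mxE [X in _ * X]mxE eq_sym (negPf ji) mulr0.
Qed.

Lemma sum_delta (c : 'I_k -> F) i : \sum_m c m * (m == i)%:R = c i.
Proof.
rewrite (bigD1 i) //= big1 ?eqxx ?mulr1 ?addr0 // => m mi.
by rewrite (negPf mi) mulr0.
Qed.

Lemma sum_delta2 (c : 'I_k -> F) i j a b :
  \sum_m c m * ((m == i)%:R * a - (m == j)%:R * b) = c i * a - c j * b.
Proof.
under eq_bigr => m _ do rewrite mulrBr !mulrA.
by rewrite sumrB -!big_distrl /= !sum_delta.
Qed.

Lemma x1_dual i u : x1 X Y i u = (A *m u) i 0.
Proof.
rewrite (@frame_expand (x1 X Y i)) => [|a v w|r Ar].
- by under eq_bigr => m _ do rewrite (x1_frame XP) ev_frame mulr1; rewrite sum_delta.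
- exact: (x1_linear XP).
- by apply: (@ev_wdg_ker _ _ i); rewrite update_eq.
Qed.

Lemma x2_dual i j u v : i != j ->
  x2 X Y i j u v = (A *m u) i 0 * (A *m v) j 0 - (A *m u) j 0 * (A *m v) i 0.
Proof.
move=> ij; rewrite (@frame_expand (fun u => x2 X Y i j u v)) => [|a w z|r Ar].
- under eq_bigr => m _ do rewrite (x2_frame XP) //.
  by rewrite sum_delta2 !x1_dual.
- exact: (x2_linear XP).
- by apply: (@ev_wdg_ker _ _ i); rewrite update_neq // update_eq.
Qed.

Lemma x3_dual i j l u v w : i != j -> i != l -> j != l ->
  x3 X Y i j l u v w = (A *m u) i 0 * ((A *m v) j 0 * (A *m w) l 0 - (A *m v) l 0 * (A *m w) j 0)
   - (A *m u) j 0 * ((A *m v) i 0 * (A *m w) l 0 - (A *m v) l 0 * (A *m w) i 0)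
   + (A *m u) l 0 * ((A *m v) i 0 * (A *m w) j 0 - (A *m v) j 0 * (A *m w) i 0).
Proof.
move=> ij il jl; rewrite (@frame_expand (fun u => x3 X Y i j l u v w)) => [|a y z|r Ar].
- under eq_bigr => m _ do rewrite (x3_frame XP) // mulrDr.
  rewrite big_split /= sum_delta2 !x2_dual //; congr (_ + _).
  by under eq_bigr => m _ do rewrite mulrA; rewrite -big_distrl /= sum_delta.
- exact: (x3_linear XP).
- by apply: (@ev_wdg_ker _ _ i); rewrite (update_neq _ _ il) (update_neq _ _ ij) update_eq.
Qed.

End DualFrame.

(** * The Grassmannian and its secant variety in terms of matrices *)

Section GrassmannianPoints.
Variables (F : fieldType) (F0 : [pchar F] =i pred0) (V : vectType F) (k : nat).
Local Open Scope classical_set_scope.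
Local Notation n := (\dim {:V}).
Local Notation W := (extpow V k).

(** A frame on which [wdg A] is nonzero gives an invertible k by k matrix, which forces the rows of
    A to be independent. *)
Lemma GrP (p : proj W) : Gr V k p <-> exists2 A : 'M[F]_(k, n), wdg A != 0 & val p = <[wdg A]>%VS.
Proof.
split=> [[H [v [_ _ pE]]]|[A A0 pE]].
  exists (coords_mx (tnth v)); rewrite -wedge_wdg //.
  apply: contraTneq (valP p) => w0; by rewrite pE w0 dim_vline eqxx.
pose v := [tuple \sum_j A i j *: (vbasis {:V})`_j | i < k].
have vE i : v`_(i : 'I_k) = \sum_j A i j *: (vbasis {:V})`_j.
  by rewrite -tnth_nth tnth_mktuple.
have fv : free v.
  apply/freeP => c c0.
  have cA : (\row_i c i) *m A = 0.
    apply/rowP=> j; rewrite !mxE.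
    have /(congr1 (coord (vbasis {:V}) j)) := c0; rewrite linear0 linear_sum => E.
    apply: etrans E; apply: eq_bigr => i _.
    by rewrite mxE vE linearZ /= coord_basis_sum.
  have [Y Y0] : exists Y, ev (wdg A) Y != 0.
    apply: contrapT => /forallNP H; case/eqP: A0; apply: ev_inj => Y.
    by rewrite ev0; apply/eqP/negPn/negP/H.
  move: Y0; rewrite ev_wdg; set M := \matrix_(_, _) _ => M0 i.
  have cM : (\row_i c i) *m M = 0.
    apply/rowP=> j; have E : ((\row_i c i) *m A *m Y j) 0 0 = 0.
      by rewrite cA mul0mx mxE.
    rewrite [RHS]mxE; apply: etrans E; rewrite -mulmxA [LHS]mxE [RHS]mxE.
    by apply: eq_bigr => l _; rewrite [M _ _]mxE.
  have Mu : M \in unitmx by rewrite unitmxE unitfE.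
  have /(congr1 (fun B : 'rV_k => B 0 i)) := congr1 (mulmx^~ (invmx M)) cM.
  by rewrite mulmxK // mul0mx !mxE.
exists <<v>>%VS, v; split; first by apply/eqP; move: fv; rewrite /free size_tuple.
  by rewrite /basis_of eqxx fv.
by rewrite pE; congr <[wedge _]>%VS; apply/funext=> i; rewrite tnth_mktuple.
Qed.

Lemma secant_point (p : proj W) (A B : 'M[F]_(k, n)) :
  val p = <[wdg A + wdg B]>%VS ->
  exists q r, [/\ Gr V k q, Gr V k r & span2 q r p].
Proof.
move=> pE; have [A0|A0] := eqVneq (wdg A) 0; have [B0|B0] := eqVneq (wdg B) 0.
- by have := valP p; rewrite pE A0 B0 addr0 dim_vline eqxx.
- exists p, p; split; try (by apply/GrP; exists B; rewrite // pE A0 add0r).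
  by rewrite /span2 /= addvv.
- exists p, p; split; try (by apply/GrP; exists A; rewrite // pE B0 addr0).
  by rewrite /span2 /= addvv.
- exists (point A0), (point B0); split; try by apply/GrP; eexists; last by [].
  rewrite /span2 /= pE; apply/subvP => _ /vlineP[c ->]; apply/memvZ.
  by apply: memv_add; apply: memv_line.
Qed.

Hypothesis k0 : (0 < k)%N.

Lemma secant_pointP (p : proj W) v :
  (exists q r, [/\ Gr V k q, Gr V k r & span2 q r p]) -> v \in val p ->
  exists A B : 'M[F]_(k, n), v = wdg A + wdg B.
Proof.
move=> [q [r [/GrP[A _ qE] /GrP[B _ rE] sp]]] vp.
have /memv_addP[a aq [b br ->]] := subvP sp _ vp.
move: aq br; rewrite qE rE => /vlineP[c ->] /vlineP[d ->].
have [A' ->] := wdg_scale k0 c A; have [B' ->] := wdg_scale k0 d B.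
by exists A', B'.
Qed.

Lemma exists_Gr : (k <= n)%N -> exists p, Gr V k p.
Proof.
move=> kn; have A0 : wdg (pid_mx k : 'M[F]_(k, n)) != 0.
  have : ev (wdg (pid_mx k : 'M[F]_(k, n))) (fun j => col j (pid_mx k)) != 0.
    rewrite ev_wdg (_ : \matrix_(_, _) _ = 1%:M) ?det1 ?oner_eq0 //.
    apply/matrixP=> i j; rewrite mxE colE mulmxA pid_mx_id // pid_mx_1 mul1mx.
    by rewrite !mxE eqxx andbT.
  by apply: contraNneq => ->; rewrite ev0.
by exists (point A0); apply/GrP; eexists; last by [].
Qed.

Local Notation sigma := (secant_variety (Gr V k)).

Lemma secant_cvanish (G : W -> F) : (k <= n)%N -> pfun G ->
  cvanish sigma G <-> forall A B, G (wdg A + wdg B) = 0.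
Proof.
move=> kn pG; split=> [G0 A B|G0]; last first.
  by apply: (cvanish_closure F0 pG) => q v /secant_pointP H /H[A [B ->]].
have [AB0|AB0] := eqVneq (wdg A + wdg B) 0.
  (* A zero sum represents no point, so the value of G at 0 is read on the line of any point of the
     Grassmannian. *)
  rewrite AB0; have [p Gp] := exists_Gr kn; apply: (G0 p); last exact: mem0v.
  by apply: subset_zclosure; exists p, p; split=> //; rewrite /span2 /= addvv.
apply: (G0 (point AB0)); last exact: memv_line.
by apply: subset_zclosure; apply: (@secant_point _ A B).
Qed.

Lemma secant_mem (p : proj W) : (k <= n)%N ->
  (forall G, pfun G -> (forall A B : 'M[F]_(k, n), G (wdg A + wdg B) = 0) -> G (rep p) = 0) ->
  sigma p.
Proof.
move=> kn H; rewrite /secant_variety; apply: (zclosure_pfun (rep_neq0 p) (mem_rep p)) => G pG G0.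
apply: H => // A B; apply: (proj1 (secant_cvanish kn pG)).
exact: cvanish_closure.
Qed.

End GrassmannianPoints.

(** * The inverse of the parametrization *)

Definition det3 (F : fieldType) (a b c d e f g h i : F) : F :=
  a * (e * i - f * h) - d * (b * i - c * h) + g * (b * f - c * e).

Section SecantChart.
Variables (F : closedFieldType) (F0 : [pchar F] =i pred0) (V : vectType F) (k m : nat).
Local Open Scope classical_set_scope.
Local Notation n := (\dim {:V}).
Local Notation C := 'cV[F]_n.
Local Notation W := (extpow V k).
Hypothesis k3 : (3 <= k)%N.
Let k0 : (0 < k)%N := ltnW (ltnW k3).
Hypothesis kn : (k <= n)%N.
Variables (E : 'M[F]_(n, k)) (Q : 'M[F]_(n, m)) (P : 'M[F]_(k, n)) (R : 'M[F]_(m, n)).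
Hypotheses (PE : P *m E = 1%:M) (PQ : P *m Q = 0) (RE : R *m E = 0) (RQ : R *m Q = 1%:M).
Hypothesis EPQR : E *m P + Q *m R = 1%:M.
Variables (i0 i1 i2 : 'I_k) (a0 a1 a2 : 'I_m).
Hypotheses (i01 : i0 != i1) (i02 : i0 != i2) (i12 : i1 != i2).

Local Notation par := ('M[F]_(k, m) * 'M[F]_(k, m) * F^o)%type.
Let Y : 'I_k -> C := fun j => col j E.
Let u : 'I_m -> C := fun a => col a Q.
Local Notation Phi := (@secant_par F V k m P R).

Let T (x : W) := ev x Y.
Let y1 (x : W) i a := x1 (ev x) Y i (u a).
Let y2 (x : W) i j a b := c2 (ev x) Y i j (u a) (u b).
Let y3 (x : W) i j l a b c := c3 (ev x) Y i j l (u a) (u b) (u c).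

(** At a chart point, [bij] is t^2 d times the 2-minor that omits row i and column j of the block of
    D with rows i0, i1, i2 and columns a0, a1, a2. *)
Let b00 x := y2 x i1 i2 a1 a2.
Let b01 x := y2 x i1 i2 a0 a2.
Let b02 x := y2 x i1 i2 a0 a1.
Let b10 x := y2 x i0 i2 a1 a2.
Let b11 x := y2 x i0 i2 a0 a2.
Let b12 x := y2 x i0 i2 a0 a1.
Let b20 x := y2 x i0 i1 a1 a2.
Let b21 x := y2 x i0 i1 a0 a2.
Let b22 x := y2 x i0 i1 a0 a1.

Let dB x := det3 (b00 x) (b01 x) (b02 x) (b10 x) (b11 x) (b12 x) (b20 x) (b21 x) (b22 x).
(** Minors of the matrix of minors: by Jacobi's identity they give back entries of the block, times
    its determinant m3. *)
Let K00 x := b11 x * b22 x - b12 x * b21 x.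
Let K01 x := b10 x * b22 x - b12 x * b20 x.
Let K02 x := b10 x * b21 x - b11 x * b20 x.
Let K10 x := b01 x * b22 x - b02 x * b21 x.
Let K20 x := b01 x * b12 x - b02 x * b11 x.
Let q x := y3 x i0 i1 i2 a0 a1 a2.

Let top x b := K00 x * y3 x i0 i1 i2 b a1 a2 + K01 x * y3 x i0 i1 i2 a0 b a2
  + K02 x * y3 x i0 i1 i2 a0 a1 b.
Let left_ x a := if a == i0 then K00 x * q x else if a == i1 then K10 x * q x
  else if a == i2 then K20 x * q x
  else K00 x * y3 x a i1 i2 a0 a1 a2 + K10 x * y3 x i0 a i2 a0 a1 a2
  + K20 x * y3 x i0 i1 a a0 a1 a2.
(** D i0 a0 * D a b is the 2-minor of these rows and columns plus D a a0 * D i0 b. The minor is zero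
    for a = i0; the factors q^2 and dB equalize the powers of t, d and m3. *)
Let entry x a b := (if a == i0 then 0 else y2 x i0 a a0 b) * q x ^+ 2 * dB x + top x b * left_ x a.

(* At x = t Phi(M, D, d) the c2 are t^2 d times the 2-minors of D and the c3 are
   t^3 d times its 3-minors; M, D and d are recovered from these by adjugates. *)
Definition chart_den x := T x * dB x * K00 x * q x ^+ 2.

Definition chart_inv x : par :=
  (\matrix_(i, a) (y1 x i a * (dB x * K00 x * q x ^+ 2)),
   \matrix_(i, a) (entry x i a * q x),
   (dB x ^+ 2 * T x * K00 x : F^o)).

Section Coordinates.
Variables (t : F) (M D : 'M[F]_(k, m)) (d : F^o).
Let x := t *: Phi (M, D, d).

Lemma ev_chart Z : ev x Z = t * \sum_(r < k.+1) weight (d : F) r * ev (wdg (graph P R (M + r%:R *: D))) Z.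
Proof. by rewrite evZ ev_secant_par. Qed.

Lemma chart_T : T x = t.
Proof.
rewrite /T ev_chart -[RHS]mulr1; congr (t * _).
have <- : \sum_(r < k.+1) weight (d : F) r * (1 + 0 * r%:R + 0 * r%:R ^+ 2 + 0 * r%:R ^+ 3) = 1.
  by rewrite (weight_cubic F0) //; ring.
apply: eq_bigr => r _; congr (_ * _); rewrite (@ev_frame _ _ _ _ Y (fun j => graph_frame PE RE _ j)).
by ring.
Qed.

Lemma chart_y1 i a : y1 x i a = t * M i a.
Proof.
rewrite /y1 /x1 ev_chart; congr (t * _).
rewrite -[RHS](_ : \sum_(r < k.+1) weight (d : F) r * (M i a + D i a * r%:R + 0 * r%:R ^+ 2 + 0 * r%:R ^+ 3) = _).
  apply: eq_bigr => r _; congr (_ * _).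
  rewrite -/(x1 _ _ _ _) (x1_dual (fun j => graph_frame PE RE _ j)) (graph_coframe PQ RQ) !mxE.
  by ring.
by rewrite (weight_cubic F0) //; ring.
Qed.

Lemma chart_x2 i j a b : i != j ->
  x2 (ev x) Y i j (u a) (u b) = t * (M i a * M j b - M j a * M i b + (d : F) * (D i a * D j b - D j a * D i b)).
Proof.
move=> ij; rewrite /x2 ev_chart; congr (t * _).
pose p1 := M i a * D j b + D i a * M j b - (M j a * D i b + D j a * M i b).
rewrite -[RHS](_ : \sum_(r < k.+1) weight (d : F) r * ((M i a * M j b - M j a * M i b) + p1 * r%:R + (D i a * D j b - D j a * D i b) * r%:R ^+ 2 + 0 * r%:R ^+ 3) = _).
  apply: eq_bigr => r _; congr (_ * _).
  rewrite -/(x2 _ _ _ _ _ _) (x2_dual (fun j => graph_frame PE RE _ j)) // !(graph_coframe PQ RQ) !mxE /p1.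
  by ring.
by rewrite (weight_cubic F0) //; ring.
Qed.

(** The weights have moments 1, 0, d, d, so the products of entries of M cancel, as a mean does in a
    variance. *)
Lemma chart_y2 i j a b : i != j ->
  y2 x i j a b = t ^+ 2 * d * (D i a * D j b - D j a * D i b).
Proof.
move=> ij; rewrite /y2 /c2 -!/(y1 x _ _) !chart_y1 chart_x2 // -/(T x) chart_T; ring.
Qed.

Lemma chart_x3 i j l a b c : i != j -> i != l -> j != l ->
  x3 (ev x) Y i j l (u a) (u b) (u c) =
  t * (det3 (M i a) (M i b) (M i c) (M j a) (M j b) (M j c) (M l a) (M l b) (M l c)
   + (d : F) * (det3 (M i a) (M i b) (M i c) (D j a) (D j b) (D j c) (D l a) (D l b) (D l c)
     + det3 (D i a) (D i b) (D i c) (M j a) (M j b) (M j c) (D l a) (D l b) (D l c)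
     + det3 (D i a) (D i b) (D i c) (D j a) (D j b) (D j c) (M l a) (M l b) (M l c))
   + (d : F) * det3 (D i a) (D i b) (D i c) (D j a) (D j b) (D j c) (D l a) (D l b) (D l c)).
Proof.
move=> ij il jl; rewrite /x3 ev_chart; congr (t * _).
pose p1 := det3 (M i a) (M i b) (M i c) (M j a) (M j b) (M j c) (D l a) (D l b) (D l c)
     + det3 (M i a) (M i b) (M i c) (D j a) (D j b) (D j c) (M l a) (M l b) (M l c)
     + det3 (D i a) (D i b) (D i c) (M j a) (M j b) (M j c) (M l a) (M l b) (M l c).
rewrite -(weight_cubic F0 d _ p1 _ _ k3); apply: eq_bigr => r _; congr (_ * _).
rewrite -/(x3 _ _ _ _ _ _ _ _) (x3_dual (fun j => graph_frame PE RE _ j)) // !(graph_coframe PQ RQ).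
rewrite !mxE /p1 /det3; ring.
Qed.

Lemma chart_y3 i j l a b c : i != j -> i != l -> j != l ->
  y3 x i j l a b c = t ^+ 3 * d *
    det3 (D i a) (D i b) (D i c) (D j a) (D j b) (D j c) (D l a) (D l b) (D l c).
Proof.
move=> ij il jl; rewrite /y3 /c3 -!/(y1 x _ _) !chart_y1 !chart_x2 // chart_x3 // -/(T x) chart_T /det3.
ring.
Qed.

Let m3 := det3 (D i0 a0) (D i0 a1) (D i0 a2) (D i1 a0) (D i1 a1) (D i1 a2) (D i2 a0) (D i2 a1) (D i2 a2).

Lemma chart_dB : dB x = t ^+ 6 * d ^+ 3 * m3 ^+ 2.
Proof.
rewrite /dB /b00 /b01 /b02 /b10 /b11 /b12 /b20 /b21 /b22 !chart_y2 // /m3 /det3.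
ring.
Qed.

Lemma chart_K : [/\ K00 x = t ^+ 4 * d ^+ 2 * m3 * D i0 a0, K01 x = t ^+ 4 * d ^+ 2 * m3 * D i0 a1,
  K02 x = t ^+ 4 * d ^+ 2 * m3 * D i0 a2, K10 x = t ^+ 4 * d ^+ 2 * m3 * D i1 a0 &
  K20 x = t ^+ 4 * d ^+ 2 * m3 * D i2 a0].
Proof.
rewrite /K00 /K01 /K02 /K10 /K20 /b00 /b01 /b02 /b10 /b11 /b12 /b20 /b21 /b22 !chart_y2 // /m3 /det3.
by split; ring.
Qed.

Lemma chart_q : q x = t ^+ 3 * d * m3.
Proof. by rewrite /q chart_y3. Qed.

Lemma chart_top b : top x b = t ^+ 7 * d ^+ 3 * m3 ^+ 2 * D i0 b.
Proof.
have [E0 E1 E2 _ _] := chart_K; rewrite /top E0 E1 E2 !chart_y3 //.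
rewrite -[in LHS]/m3; set e := m3.
transitivity (t ^+ 7 * d ^+ 3 * e * (D i0 a0 * det3 (D i0 b) (D i0 a1) (D i0 a2) (D i1 b) (D i1 a1) (D i1 a2) (D i2 b) (D i2 a1) (D i2 a2)
 + D i0 a1 * det3 (D i0 a0) (D i0 b) (D i0 a2) (D i1 a0) (D i1 b) (D i1 a2) (D i2 a0) (D i2 b) (D i2 a2)
 + D i0 a2 * det3 (D i0 a0) (D i0 a1) (D i0 b) (D i1 a0) (D i1 a1) (D i1 b) (D i2 a0) (D i2 a1) (D i2 b))).
  by move: (det3 _ _ _ _ _ _ _ _ _) (det3 _ _ _ _ _ _ _ _ _) (det3 _ _ _ _ _ _ _ _ _) => *; ring.
rewrite expr2 [RHS](_ : _ = t ^+ 7 * d ^+ 3 * e * (e * D i0 b)); last by ring.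
by congr (_ * _); rewrite /e /m3 /det3; ring.
Qed.

Lemma chart_left a : left_ x a = t ^+ 7 * d ^+ 3 * m3 ^+ 2 * D a a0.
Proof.
have [E0 _ _ E1 E2] := chart_K; rewrite /left_ E0 E1 E2 chart_q.
case: eqVneq => [->|ai0]; first by ring.
case: eqVneq => [->|ai1]; first by ring.
case: eqVneq => [->|ai2]; first by ring.
have i0a : i0 != a by rewrite eq_sym. have i1a : i1 != a by rewrite eq_sym.
rewrite !chart_y3 //.
set e := m3.
transitivity (t ^+ 7 * d ^+ 3 * e * (D i0 a0 * det3 (D a a0) (D a a1) (D a a2) (D i1 a0) (D i1 a1) (D i1 a2) (D i2 a0) (D i2 a1) (D i2 a2)
 + D i1 a0 * det3 (D i0 a0) (D i0 a1) (D i0 a2) (D a a0) (D a a1) (D a a2) (D i2 a0) (D i2 a1) (D i2 a2)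
 + D i2 a0 * det3 (D i0 a0) (D i0 a1) (D i0 a2) (D i1 a0) (D i1 a1) (D i1 a2) (D a a0) (D a a1) (D a a2))).
  by move: (det3 _ _ _ _ _ _ _ _ _) (det3 _ _ _ _ _ _ _ _ _) (det3 _ _ _ _ _ _ _ _ _) => *; ring.
rewrite expr2 [RHS](_ : _ = t ^+ 7 * d ^+ 3 * e * (e * D a a0)); last by ring.
by congr (_ * _); rewrite /e /m3 /det3; ring.
Qed.

(** The coordinate d comes from the ratio dB / q^2 = t^6 d^3 m3^2 / (t^3 d m3)^2. *)
Lemma chart_invE : chart_inv x = chart_den x *: ((M, D, d) : par).
Proof.
have [K0 _ _ _ _] := chart_K.
rewrite /chart_inv /chart_den chart_dB chart_q K0 chart_T; congr (_, _, _).
- by apply/matrixP=> i a; rewrite !mxE chart_y1; ring.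
- apply/matrixP=> i a; rewrite !mxE /entry chart_top chart_left chart_dB chart_q.
  case: eqVneq => [->|ii0]; first by ring.
  by rewrite chart_y2 1?eq_sym //; ring.
- by rewrite [RHS]/GRing.scale /=; ring.
Qed.

End Coordinates.

Lemma pfun_T : pfun T.
Proof. by apply: pfun_linear => a v w; apply: ev_linear. Qed.

Lemma pfun_c2 i j v w : pfun (fun x : W => c2 (ev x) Y i j v w).
Proof.
have pe Z : pfun (fun x : W => ev x Z) by apply: pfun_linear => a y z; apply: ev_linear.
by apply: pfunB; [apply: pfunM|apply: pfunB; apply: pfunM]; apply: pe.
Qed.

Lemma pfun_c3 i j l v w z : pfun (fun x : W => c3 (ev x) Y i j l v w z).
Proof.
have pe Z : pfun (fun x : W => ev x Z) by apply: pfun_linear => a y z'; apply: ev_linear.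
rewrite /c3 /x3 /x2 /x1.
repeat first [apply: pe | apply: pfunC | apply: pfunX | apply: pfunM | apply: pfunB | apply: pfunD].
Qed.

Ltac pfun_auto := repeat first [apply: pfun_T | apply: pfun_c2 | apply: pfun_c3
  | apply: pfunC | apply: pfunX | apply: pfunM | apply: pfunB | apply: pfunD].

Lemma pfun_dB : pfun dB.
Proof. rewrite /dB /det3 /b00 /b01 /b02 /b10 /b11 /b12 /b20 /b21 /b22 /y2; pfun_auto. Qed.

Lemma pfun_K : [/\ pfun K00, pfun K01, pfun K02, pfun K10 & pfun K20].
Proof.
rewrite /K00 /K01 /K02 /K10 /K20 /b00 /b01 /b02 /b10 /b11 /b12 /b20 /b21 /b22 /y2.
split; pfun_auto.
Qed.

Lemma pfun_chart_den : pfun chart_den.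
Proof.
have [pK _ _ _ _] := pfun_K.
apply: pfunM; [apply: pfunM; [apply: pfunM|]|apply: pfunX]; [exact: pfun_T|exact: pfun_dB|exact: pK|].
exact: pfun_c3.
Qed.

Lemma pmap_chart_inv : pmap chart_inv.
Proof.
have [p00 p01 p02 p10 p20] := pfun_K; have pB := pfun_dB.
have pq i j l a b c : pfun (fun x => y3 x i j l a b c) by apply: pfun_c3.
apply: pmap_pair; first apply: pmap_pair.
- apply: pmap_mx => i a; apply: eq_pfun (fun x => esym (mxE _ _ _ _)) _.
  apply: pfunM; first by apply: pfun_linear => c v w; apply: ev_linear.
  by apply: pfunM; [apply: pfunM|apply: pfunX; apply: pq].
- apply: pmap_mx => i a; apply: eq_pfun (fun x => esym (mxE _ _ _ _)) _.
  apply: pfunM; last exact: pq.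
  apply: pfunD; apply: pfunM => //.
  + apply: pfunM; last by apply: pfunX; apply: pq.
    by case: (i == i0); [apply: pfunC|apply: pfun_c2].
  + by apply: pfunD; [apply: pfunD|]; apply: pfunM.
  + rewrite /left_; case: (i == i0); last case: (i == i1); last case: (i == i2).
    * by apply: pfunM => //; apply: pq.
    * by apply: pfunM => //; apply: pq.
    * by apply: pfunM => //; apply: pq.
    * by apply: pfunD; [apply: pfunD|]; apply: pfunM.
apply: pmap_scalar; apply: pfunM => //; apply: pfunM; last exact: pfun_T.
exact: pfunX.
Qed.

Local Notation sigma := (secant_variety (Gr V k)).

Lemma secant_chart_regular p : sigma p -> chart_den (rep p) != 0 -> regular_at sigma p.
Proof.
move=> sp hp.
have T1 a : T (Phi a) = 1.
  by case: a => [[M D] d]; rewrite -[Phi _]scale1r chart_T.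
have dense G : pfun G -> (forall t a, G (t *: Phi a) = 0) <-> (forall A B, G (wdg A + wdg B) = 0).
  exact: (secant_par_dense F0 k3 PE EPQR).
apply: (@chart_regular F F0 par W Phi chart_inv T chart_den sigma) => //.
- exact: pmap_secant_par.
- exact: pmap_chart_inv.
- exact: pfun_chart_den.
- by move=> a v w; apply: ev_linear.
- by move=> t [[M D] d]; apply: chart_invE.
- exact: zclosed_zclosure.
- move=> r a rE; apply: (secant_mem F0 k0 kn) => G pG /(proj2 (dense G pG)) G0.
  have := mem_rep r; rewrite rE => /vlineP[c ->]; exact: G0.
- by move=> G pG /(proj1 (dense G pG)) G0; apply/(secant_cvanish F0 k0 kn pG).
Qed.

(** The source of the cone map has dimension 2 * k * m + 2: two matrices, the parameter d and the
    scale. *)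
Lemma secant_chain_bound p e : closed_chain sigma p e -> (e <= (k * m).*2.+1)%N.
Proof.
move=> ch; pose B := (F^o * par)%type; pose cone (b : B) : W := (b.1 : F) *: Phi b.2.
have -> : (k * m).*2.+1 = (\dim {: B}).-1.
  by rewrite dimvf -[dim _]/(1 + (k * m + k * m + 1))%N addn1 -addnn.
have pc : pmap cone.
  apply: pmapZ; first by apply: (@pfun_linear _ B (fun b => b.1 : F)).
  by apply: (@pmap_comp _ B _ _ Phi snd); [apply: pmap_linear|apply: pmap_secant_par].
have H : (e < \dim {: B})%N.
  apply: (chain_bound F0 pc _ ch) => G pG G0.
  apply/(secant_cvanish F0 k0 kn pG)/(proj1 (secant_par_dense F0 k3 PE EPQR pG)).
  by move=> t a; apply: (G0 (t, a)).
by rewrite -ltnS prednK // (leq_ltn_trans _ H).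
Qed.

End SecantChart.

(** * Moving frames to make the denominator of the chart nonzero *)

Section FrameMoves.
Variables (F : fieldType) (C : vectType F) (k : nat) (X : ('I_k -> C) -> F).
Hypothesis XP : @multilinear_alternating F C k F^o X.
Implicit Types (Y : 'I_k -> C) (i j l m : 'I_k) (a b u v w : C).

Definition move Y l s w := update Y l (s *: w + Y l).

Lemma move_T Y l s w : X (move Y l s w) = X Y + s * x1 X Y l w.
Proof. by rewrite (alt_linear XP) update_id addrC. Qed.

Lemma move_x1 Y l s w i a : i != l ->
  x1 X (move Y l s w) i a = x1 X Y i a + s * x2 X Y i l a w.
Proof.
move=> il; have li : l != i by rewrite eq_sym.
rewrite /x1 /move updateC // (alt_linear XP) addrC /x2; congr (X _ + _).
by rewrite -{1}[Y l](update_neq Y a li) update_id.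
Qed.

Lemma move_x1_same Y l s w a : x1 X (move Y l s w) l a = x1 X Y l a.
Proof. by rewrite /x1 /move updateK. Qed.

Lemma move_x2 Y l s w i j a b : i != l -> j != l ->
  x2 X (move Y l s w) i j a b = x2 X Y i j a b + s * x3 X Y i j l a b w.
Proof.
move=> il jl; have [li lj] : l != i /\ l != j by rewrite ![l == _]eq_sym.
rewrite /x2 /move (updateC _ _ _ li) (updateC _ _ _ lj) (alt_linear XP) addrC /x3.
congr (X _ + _).
by rewrite -{1}[Y l](update_neq Y a li) -(update_neq (update Y i a) b lj) update_id.
Qed.

Lemma move_x2_fst Y l s w j a b : x2 X (move Y l s w) l j a b = x2 X Y l j a b.
Proof. by rewrite /x2 /move updateK. Qed.

Lemma move_x2_snd Y l s w i a b : i != l -> x2 X (move Y l s w) i l a b = x2 X Y i l a b.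
Proof. by move=> il; rewrite !(x2_sym _ _ _ _ il) move_x2_fst. Qed.

Lemma x3_rot Y i j l a b c : i != j -> i != l -> j != l ->
  x3 X Y i j l a b c = x3 X Y j l i b c a.
Proof.
move=> ij il jl; rewrite /x3; congr X; apply/funext=> m; rewrite /update.
case: (eqVneq m l) => [->|ml]; first by rewrite eq_sym (negPf il).
case: (eqVneq m j) => [->|mj]; last by [].
by rewrite eq_sym (negPf ij).
Qed.

Definition centered Y a := forall i, x1 X Y i a = 0.

Lemma x2_eq Y i j a : i != j -> x2 X Y i j a a = 0.
Proof.
by move=> ij; rewrite /x2 (alt_eq XP ij) // /update (negPf ij) !eqxx.
Qed.

Lemma x3_eq13 Y i j l a b : i != l -> j != l -> x3 X Y i j l a b a = 0 \/ i = j.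
Proof.
move=> il jl; case: (eqVneq i j) => [->|ij]; [by right|left].
by rewrite /x3 (alt_eq XP il) // /update (negPf il) (negPf ij) !eqxx.
Qed.

(** The linear coefficient in s is the cubic value [x3], up to X Y: this is how a nonzero cubic form
    forces quadratic forms to be nonzero. *)
Lemma move_c2 Y l s w i j a b : i != j -> i != l -> j != l ->
  centered Y a -> centered Y b -> centered Y w ->
  c2 X (move Y l s w) i j a b = X Y * x2 X Y i j a b + s * (X Y * x3 X Y i j l a b w)
    - s ^+ 2 * (x2 X Y i l a w * x2 X Y j l b w - x2 X Y i l b w * x2 X Y j l a w).
Proof.
move=> ij il jl ca cb cw; rewrite /c2 move_T cw move_x2 // !move_x1 // !ca !cb.
ring.
Qed.

Lemma move_c2_rep Y l s w i j a : i != j -> i != l -> j != l ->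
  centered Y a -> centered Y w ->
  c2 X (move Y l s w) i j w a = X Y * x2 X Y i j w a.
Proof.
move=> ij il jl ca cw; rewrite move_c2 //.
have [->|E] := x3_eq13 Y w a il jl; last by rewrite E eqxx in ij.
by rewrite !(x2_eq _ w) //; ring.
Qed.

Lemma move_c2_fst Y l s w j a b : j != l -> centered Y a -> centered Y b -> centered Y w ->
  c2 X (move Y l s w) l j a b = X Y * x2 X Y l j a b.
Proof.
by move=> jl ca cb cw; rewrite /c2 move_T cw move_x2_fst !move_x1_same ca cb; ring.
Qed.

Lemma move_c2_snd Y l s w i a b : i != l -> centered Y a -> centered Y b -> centered Y w ->
  c2 X (move Y l s w) i l a b = X Y * x2 X Y i l a b.
Proof.
by move=> il ca cb cw; rewrite /c2 move_T cw move_x2_snd // !move_x1_same ca cb; ring.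
Qed.

Lemma c2_centered Y i j a b : centered Y a -> c2 X Y i j a b = X Y * x2 X Y i j a b.
Proof. by move=> ca; rewrite /c2 !ca; ring. Qed.

Lemma c3_centered Y i j l a b c : centered Y a -> centered Y b -> centered Y c ->
  c3 X Y i j l a b c = X Y ^+ 2 * x3 X Y i j l a b c.
Proof. by move=> ca cb cc; rewrite /c3 !ca !cb !cc; ring. Qed.

(** The values at s = 1 and s = -1 differ by 2 * B. *)
Lemma quadratic_eq0 (F0 : [pchar F] =i pred0) (A B D : F) :
  (forall s, A + s * B - s ^+ 2 * D = 0) -> B = 0.
Proof.
move=> H; have := H 0; have := H 1; have := H (-1).
rewrite !expr0n !expr1n sqrrN expr1n /= !mul0r !mul1r mulN1r subr0 addr0 => h1 h2 h0.
have : 2 * B = 0.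
  rewrite (_ : 2 * B = (A + B - D) - (A - B - D)); last by ring.
  by rewrite h1 h2 subr0.
by move/eqP; rewrite mulf_eq0 (negPf (natr_char0_neq0 F0 (isT : 2%N != 0%N))) /= => /eqP.
Qed.

End FrameMoves.

Section GenericFrames.
Variables (F : fieldType) (F0 : [pchar F] =i pred0) (V : vectType F) (k m : nat).
Local Notation n := (\dim {:V}).
Local Notation C := 'cV[F]_n.
Local Notation W := (extpow V k).
Variables (x : W) (i0 i1 i2 : 'I_k) (a0 a1 a2 : 'I_m).
Hypotheses (i01 : i0 != i1) (i02 : i0 != i2) (i12 : i1 != i2).
Hypotheses (a01 : a0 != a1) (a02 : a0 != a2) (a12 : a1 != a2).
Local Notation X := (ev x).
Let XP := ev_alternating x.

Local Notation frame := ('M[F]_(n, k) * 'M[F]_(n, m))%type.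
Implicit Type G : frame.
Let Y G : 'I_k -> C := fun j => col j G.1.
Let u G : 'I_m -> C := fun a => col a G.2.

Let T G := X (Y G).
Let q G := c3 X (Y G) i0 i1 i2 (u G a0) (u G a1) (u G a2).
Let b00 G := c2 X (Y G) i1 i2 (u G a1) (u G a2).
Let b01 G := c2 X (Y G) i1 i2 (u G a0) (u G a2).
Let b02 G := c2 X (Y G) i1 i2 (u G a0) (u G a1).
Let b10 G := c2 X (Y G) i0 i2 (u G a1) (u G a2).
Let b11 G := c2 X (Y G) i0 i2 (u G a0) (u G a2).
Let b12 G := c2 X (Y G) i0 i2 (u G a0) (u G a1).
Let b20 G := c2 X (Y G) i0 i1 (u G a1) (u G a2).
Let b21 G := c2 X (Y G) i0 i1 (u G a0) (u G a2).
Let b22 G := c2 X (Y G) i0 i1 (u G a0) (u G a1).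
Let K G := b11 G * b22 G - b12 G * b21 G.
Let dB G := det3 (b00 G) (b01 G) (b02 G) (b10 G) (b11 G) (b12 G) (b20 G) (b21 G) (b22 G).

Lemma pfun_col_l j r : pfun (fun G => Y G j r 0).
Proof. by apply: (@pfun_linear _ frame) => a v w; rewrite !mxE. Qed.

Lemma pfun_col_r j r : pfun (fun G => u G j r 0).
Proof. by apply: (@pfun_linear _ frame) => a v w; rewrite !mxE. Qed.

Lemma pfun_evx (Z : frame -> 'I_k -> C) :
  (forall j r, pfun (fun G => Z G j r 0)) -> pfun (fun G => X (Z G)).
Proof. by apply: pfun_ev; apply: pmapC. Qed.

Ltac pfun_frame := repeat first [apply: pfunC | apply: pfunX | apply: pfunM | apply: pfunB
  | apply: pfunD | apply: pfun_evx => ? ? | apply: pfun_update => * | apply: pfun_col_l | apply: pfun_col_r].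

Lemma pfun_frame_T : pfun T. Proof. rewrite /T; pfun_frame. Qed.

Lemma pfun_frame_c2 i j a b : pfun (fun G => c2 X (Y G) i j (u G a) (u G b)).
Proof. rewrite /c2 /x2 /x1; pfun_frame. Qed.

Lemma pfun_frame_c3 i j l a b c : pfun (fun G => c3 X (Y G) i j l (u G a) (u G b) (u G c)).
Proof. rewrite /c3 /x3 /x2 /x1; pfun_frame. Qed.

Lemma pfun_frame_K : pfun K.
Proof. by apply: pfunB; apply: pfunM; apply: pfun_frame_c2. Qed.

Lemma pfun_frame_dB : pfun dB.
Proof.
rewrite /dB /det3; repeat first [apply: pfun_frame_c2|apply: pfunM|apply: pfunB|apply: pfunD].
Qed.

(** All columns other than a0 and a1 receive v2; only the one at a2 is read. *)
Definition mk_frame (Z : 'I_k -> C) (v0 v1 v2 : C) : frame :=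
  (\matrix_(r, j) Z j r 0,
   \matrix_(r, a) (if a == a0 then v0 else if a == a1 then v1 else v2) r 0).

Lemma mk_frameE Z v0 v1 v2 : [/\ Y (mk_frame Z v0 v1 v2) = Z,
  u (mk_frame Z v0 v1 v2) a0 = v0, u (mk_frame Z v0 v1 v2) a1 = v1 &
  u (mk_frame Z v0 v1 v2) a2 = v2].
Proof.
split; first by apply/funext=> j; apply/colP=> r; rewrite !mxE.
- by apply/colP=> r; rewrite !mxE eqxx.
- by apply/colP=> r; rewrite !mxE eq_sym (negPf a01) eqxx.
- by apply/colP=> r; rewrite !mxE eq_sym (negPf a02) eq_sym (negPf a12).
Qed.

Definition recenter G : frame :=
  mk_frame (Y G) (center X (Y G) (u G a0)) (center X (Y G) (u G a1)) (center X (Y G) (u G a2)).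

Lemma recenterE G : [/\ Y (recenter G) = Y G,
  u (recenter G) a0 = center X (Y G) (u G a0), u (recenter G) a1 = center X (Y G) (u G a1) &
  u (recenter G) a2 = center X (Y G) (u G a2)].
Proof. exact: mk_frameE. Qed.

Lemma q_recenter G : q (recenter G) = T G ^+ 3 * q G.
Proof. by have [EY E0 E1 E2] := recenterE G; rewrite /q EY E0 E1 E2 (c3_center XP). Qed.

Lemma b22_recenter G : b22 (recenter G) = T G ^+ 2 * b22 G.
Proof. by have [EY E0 E1 E2] := recenterE G; rewrite /b22 EY E0 E1 (c2_center XP). Qed.

Lemma K_recenter G : K (recenter G) = T G ^+ 4 * K G.
Proof.
have [EY E0 E1 E2] := recenterE G.
by rewrite /K /b11 /b22 /b12 /b21 EY E0 E1 E2 !(c2_center XP) // /T; ring.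
Qed.

Definition is_centered G := [/\ centered X (Y G) (u G a0), centered X (Y G) (u G a1) & centered X (Y G) (u G a2)].

Lemma recenter_centered G : is_centered (recenter G).
Proof.
have [EY E0 E1 E2] := recenterE G; rewrite /is_centered EY E0 E1 E2.
by split=> i; apply: (x1_center XP).
Qed.

(** Recentering keeps T and multiplies q and f by powers of T, so it preserves the nonvanishing of
    all three at a generic frame. *)
Lemma exists_centered (f : frame -> F) e : pfun f -> (exists G, T G != 0) -> (exists G, q G != 0) ->
  (exists G, f G != 0) -> (forall G, f (recenter G) = T G ^+ e * f G) ->
  exists G, [/\ is_centered G, T G != 0, q G != 0 & f G != 0].
Proof.
move=> pf [G1 TG] [G2 qG] [G3 fG] fr.
have [s [T1 q1]] := pfun_generic F0 pfun_frame_T (pfun_frame_c3 i0 i1 i2 a0 a1 a2) TG qG.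
have TqG : T (G1 + s *: (G2 - G1)) * q (G1 + s *: (G2 - G1)) != 0 by apply: mulf_neq0.
have [r [Tq2 f2]] := pfun_generic F0 (pfunM pfun_frame_T (pfun_frame_c3 i0 i1 i2 a0 a1 a2)) pf TqG fG.
move: Tq2 f2; set G := (_ + r *: _) => Tq2 f2.
have /andP[T2 q2] : (T G != 0) && (q G != 0) by rewrite -negb_or -mulf_eq0.
exists (recenter G); split.
- exact: recenter_centered.
- by have [EY _ _ _] := recenterE G; rewrite /T EY.
- by rewrite q_recenter mulf_neq0 ?expf_neq0.
- by rewrite fr mulf_neq0 ?expf_neq0.
Qed.

Hypotheses (hT : exists G, T G != 0) (hq : exists G, q G != 0).

Definition move_frame G l s a : frame :=
  mk_frame (move (Y G) l s (u G a)) (u G a0) (u G a1) (u G a2).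

Lemma x3_neq0 G : is_centered G -> q G != 0 ->
  x3 X (Y G) i0 i1 i2 (u G a0) (u G a1) (u G a2) != 0.
Proof.
move=> [g0 g1 g2]; rewrite /q c3_centered //.
by rewrite mulf_eq0 negb_or => /andP[].
Qed.

(** The start of a climb through the minors of sizes 1, 2 and 3 of the matrix of the [bij]. When the
    slot i2 moves along the vector at a2, the linear coefficient of b22 is T * x3. *)
Lemma b22_generic : exists G, b22 G != 0.
Proof.
apply: contrapT => /forallNP H; have {}H G : b22 G = 0 by apply/eqP/negPn/negP/H.
have [||G [Gc TG qG _]] := @exists_centered (fun => 1) 0 (pfunC _ 1) hT hq.
- by exists 0; rewrite oner_eq0.
- by move=> G; rewrite expr0 mul1r.
have x3N := x3_neq0 Gc qG; have [g0 g1 g2] := Gc.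
suff : T G * x3 X (Y G) i0 i1 i2 (u G a0) (u G a1) (u G a2) = 0.
  by apply/eqP/mulf_neq0.
apply: (quadratic_eq0 F0) => s; rewrite -[RHS](H (move_frame G i2 s a2)).
have [EY E0 E1 E2] := mk_frameE (move (Y G) i2 s (u G a2)) (u G a0) (u G a1) (u G a2).
by rewrite /b22 /move_frame EY E0 E1 move_c2.
Qed.

(** Moving the slot i1 along the vector at a1 changes only b11 among the entries of K, so the linear
    coefficient is T * x3 * b22. *)
Lemma K_generic : exists G, K G != 0.
Proof.
apply: contrapT => /forallNP H; have {}H G : K G = 0 by apply/eqP/negPn/negP/H.
have [|G [Gc TG qG bG]] := @exists_centered b22 2 (pfun_frame_c2 _ _ _ _) hT hq b22_generic.
  exact: b22_recenter.
have x3N := x3_neq0 Gc qG; have [g0 g1 g2] := Gc.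
suff : T G * x3 X (Y G) i0 i1 i2 (u G a0) (u G a1) (u G a2) * b22 G = 0.
  by apply/eqP; rewrite !mulf_neq0.
have i21 : i2 != i1 by rewrite eq_sym.
have x3E : x3 X (Y G) i0 i2 i1 (u G a0) (u G a2) (u G a1) =
    x3 X (Y G) i0 i1 i2 (u G a0) (u G a1) (u G a2).
  by rewrite x3_sym23.
pose A := T G * x2 X (Y G) i0 i2 (u G a0) (u G a2).
pose D := x2 X (Y G) i0 i1 (u G a0) (u G a1) * x2 X (Y G) i2 i1 (u G a2) (u G a1)
  - x2 X (Y G) i0 i1 (u G a2) (u G a1) * x2 X (Y G) i2 i1 (u G a0) (u G a1).
apply: (@quadratic_eq0 _ F0 (A * b22 G - b12 G * b21 G) _ (D * b22 G)) => s.
rewrite -[RHS](H (move_frame G i1 s a1)).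
have [EY E0 E1 E2] := mk_frameE (move (Y G) i1 s (u G a1)) (u G a0) (u G a1) (u G a2).
rewrite /K /b11 /b22 /b12 /b21 /move_frame EY E0 E1 E2.
rewrite (move_c2 XP _ i02) // (move_c2_snd XP) // (move_c2_snd XP) //.
rewrite [c2 _ _ i0 i2 (u G a0) (u G a1)](c2_anti XP) // (c2_anti XP _ (u G a0) (u G a1) i02).
rewrite (move_c2_rep XP) // !c2_centered // x3E /A /D /T; ring.
Qed.

(** Moving the slot i0 along the vector at a0 changes only b00, whose cofactor in dB is K. *)
Lemma dB_generic : exists G, dB G != 0.
Proof.
apply: contrapT => /forallNP H; have {}H G : dB G = 0 by apply/eqP/negPn/negP/H.
have [|G [Gc TG qG KG]] := @exists_centered K 4 pfun_frame_K hT hq K_generic.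
  exact: K_recenter.
have x3N := x3_neq0 Gc qG; have [g0 g1 g2] := Gc.
suff : T G * x3 X (Y G) i0 i1 i2 (u G a0) (u G a1) (u G a2) * K G = 0.
  by apply/eqP; rewrite !mulf_neq0.
have [i10 i20] : i1 != i0 /\ i2 != i0 by rewrite ![_ == i0]eq_sym.
pose D := x2 X (Y G) i1 i0 (u G a1) (u G a0) * x2 X (Y G) i2 i0 (u G a2) (u G a0)
  - x2 X (Y G) i1 i0 (u G a2) (u G a0) * x2 X (Y G) i2 i0 (u G a1) (u G a0).
apply: (@quadratic_eq0 _ F0 (dB G) _ (D * K G)) => s.
rewrite -[RHS](H (move_frame G i0 s a0)).
have [EY E0 E1 E2] := mk_frameE (move (Y G) i0 s (u G a0)) (u G a0) (u G a1) (u G a2).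
rewrite /dB /K /b00 /b01 /b02 /b10 /b11 /b22 /b12 /b20 /b21 /move_frame EY E0 E1 E2.
rewrite !(move_c2_fst XP) // (move_c2 XP _ i12) // !(move_c2_rep XP) //.
rewrite (x3_rot X (Y G) _ _ _ i01 i02 i12) !c2_centered // /D /T /det3; ring.
Qed.

End GenericFrames.

Lemma frame_inverse (F : fieldType) n k m (e : (k + m)%N = n) (E : 'M[F]_(n, k)) (Q : 'M[F]_(n, m)) :
  \det (castmx (erefl n, e) (row_mx E Q)) != 0 ->
  exists (P : 'M[F]_(k, n)) (R : 'M[F]_(m, n)),
    [/\ P *m E = 1%:M, P *m Q = 0, R *m E = 0, R *m Q = 1%:M & E *m P + Q *m R = 1%:M].
Proof.
case: n / e E Q => E Q; rewrite castmx_id => d0.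
have Mu : row_mx E Q \in unitmx by rewrite unitmxE unitfE.
pose Z := invmx (row_mx E Q); exists (usubmx Z), (dsubmx Z).
have := mulVmx Mu; rewrite -/Z -{1}[Z]vsubmxK mul_col_row scalar_mx_block.
move=> /eq_block_mx[E1 E2 E3 E4]; split=> //.
by rewrite -(mul_row_col E Q) vsubmxK mulmxV // scalar_mx_block.
Qed.

Lemma exists_unit_frame (F : fieldType) n k m (e : (k + m)%N = n) :
  exists G : 'M[F]_(n, k) * 'M[F]_(n, m), \det (castmx (erefl n, e) (row_mx G.1 G.2)) != 0.
Proof.
case: n / e; exists (lsubmx 1%:M, rsubmx 1%:M).
by rewrite castmx_id hsubmxK det1 oner_eq0.
Qed.

(** * Regularity where a cubic form is nonzero *)

Section RegularPoints.
Variables (F : closedFieldType) (F0 : [pchar F] =i pred0) (V : vectType F) (k m : nat).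
Local Notation n := (\dim {:V}).
Local Notation C := 'cV[F]_n.
Local Notation sigma := (secant_variety (Gr V k)).
Hypotheses (k3 : (3 <= k)%N) (m3 : (3 <= m)%N) (kmn : (k + m)%N = n).
Local Notation frame := ('M[F]_(n, k) * 'M[F]_(n, m))%type.

Let kn : (k <= n)%N.
Proof. by rewrite -kmn leq_addr. Qed.

Lemma pfun_frame_det : pfun (fun G : frame => \det (castmx (erefl n, kmn) (row_mx G.1 G.2))).
Proof.
apply: pfun_det => i j.
apply: (@pfun_linear _ frame) => a u v; rewrite !castmxE !mxE.
by case: splitP => l _; rewrite !mxE.
Qed.

(** Each condition may hold at a different frame, but all of them, invertibility of the frame
    included, are nonvanishing conditions on polynomials in the frame, so a single frame meets them
    all. *)
Lemma regular_of_c3 p (i0 i1 i2 : 'I_k) Y (u v w : C) Z :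
  i0 != i1 -> i0 != i2 -> i1 != i2 -> sigma p ->
  ev (rep p) Z != 0 -> c3 (ev (rep p)) Y i0 i1 i2 u v w != 0 -> regular_at sigma p.
Proof.
move=> i01 i02 i12 sp TZ cY; set x := rep p.
pose a0 : 'I_m := Ordinal (ltn_trans (ltn0Sn 1) m3 : (0 < m)%N).
pose a1 : 'I_m := Ordinal (ltnW m3); pose a2 : 'I_m := Ordinal m3.
have [a01 a02 a12] : [/\ a0 != a1, a0 != a2 & a1 != a2] by [].
have hT : exists G : frame, ev x (fun j => col j G.1) != 0.
  exists (mk_frame a0 a1 Z 0 0 0); have [-> _ _ _] := mk_frameE a01 a02 a12 Z 0 0 0.
  exact: TZ.
have hq : exists G : frame, c3 (ev x) (fun j => col j G.1) i0 i1 i2 (col a0 G.2) (col a1 G.2) (col a2 G.2) != 0.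
  exists (mk_frame a0 a1 Y u v w); have [-> -> -> ->] := mk_frameE a01 a02 a12 Y u v w.
  exact: cY.
have [GT TG] := hT; have [Gq qG] := hq.
have [GK KG] := K_generic F0 i01 i02 i12 a01 a02 a12 hT hq.
have [GB BG] := dB_generic F0 i01 i02 i12 a01 a02 a12 hT hq.
have [Gu uG] := @exists_unit_frame F n k m kmn.
have pT : pfun (fun G : frame => ev x (fun j => col j G.1)) by apply: pfun_frame_T.
have pB : pfun (fun G : frame => chart_den G.1 G.2 i0 i1 i2 a0 a1 a2 x).
  rewrite /chart_den; apply: pfunM; first (apply: pfunM; first apply: pfunM).
  - exact: pT.
  - exact: pfun_frame_dB.
  - exact: pfun_frame_K.
  - by apply: pfunX; apply: pfun_frame_c3.
have [G denG] : exists G : frame, chart_den G.1 G.2 i0 i1 i2 a0 a1 a2 x != 0.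
  have [s1 [e1 e2]] := pfun_generic F0 pT (pfun_frame_dB x i0 i1 i2 a0 a1 a2) TG BG.
  have [s2 [e3 e4]] := pfun_generic F0 (pfunM pT (pfun_frame_dB x i0 i1 i2 a0 a1 a2))
    (pfun_frame_K x i0 i1 i2 a0 a1 a2) (mulf_neq0 e1 e2) KG.
  have [s3 [e5 e6]] := pfun_generic F0 (pfunM (pfunM pT (pfun_frame_dB x i0 i1 i2 a0 a1 a2))
    (pfun_frame_K x i0 i1 i2 a0 a1 a2)) (pfun_frame_c3 x i0 i1 i2 a0 a1 a2) (mulf_neq0 e3 e4) qG.
  by eexists; apply: mulf_neq0 e5 (expf_neq0 2 e6).
have [s []] := pfun_generic F0 pB pfun_frame_det denG uG.
set G' := _ + _ => den det; have [P [R [PE PQ RE RQ EPQR]]] := frame_inverse det.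
exact: (secant_chart_regular F0 k3 kn PE PQ RE RQ EPQR i01 i02 i12 sp den).
Qed.

Lemma secant_local_dim_le p e : closed_chain sigma p e -> (e <= (k * m).*2.+1)%N.
Proof.
have [G det] := @exists_unit_frame F n k m kmn.
have [P [R [PE PQ RE RQ EPQR]]] := frame_inverse det.
exact: (secant_chain_bound F0 k3 kn PE EPQR).
Qed.

End RegularPoints.

(** * Points where all the cubic forms vanish *)

Section GoodFrames.
Variables (F : fieldType) (F0 : [pchar F] =i pred0) (V : vectType F) (k : nat).
Local Notation n := (\dim {:V}).
Local Notation C := 'cV[F]_n.
Local Notation W := (extpow V k).
Implicit Types (Y Z : 'I_k -> C) (i j l m : 'I_k) (u v w : C).

Lemma ev_mul (x : W) Z (G : 'M[F]_k) :
  ev x (fun j => \sum_l G l j *: Z l) = \det G * ev x Z.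
Proof.
rewrite /ev big_distrr /=; apply: eq_bigr => s _; rewrite mulrCA [\det G * _]mulrC.
rewrite -det_mulmx; congr (_ * \det _); apply/matrixP=> i j; rewrite !mxE summxE.
by apply: eq_bigr => l _; rewrite !mxE mulrC.
Qed.

Lemma functional_row (f : C -> F) : (forall a u v, f (a *: u + v) = a * f u + f v) ->
  forall u, (\row_j f (delta_mx j 0) *m u) 0 0 = f u.
Proof.
move=> fL u; have uE : u = \sum_j u j 0 *: delta_mx j 0.
  by rewrite {1}[u]matrix_sum_delta; apply: eq_bigr => j _; rewrite big_ord1.
rewrite [in RHS]uE (lin_sum fL) mxE; apply: eq_bigr => j _.
by rewrite (linZ fL) mxE mulrC.
Qed.

Variable x : W.
Local Notation X := (ev x).
Let XP := ev_alternating x.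

Definition functional_mx (f : 'I_k -> C -> F) : 'M[F]_(k, n) := \matrix_(i, j) f i (delta_mx j 0).

Lemma functional_mxE f i : (forall a u v, f i (a *: u + v) = a * f i u + f i v) ->
  forall u, (functional_mx f *m u) i 0 = f i u.
Proof.
move=> fL u; rewrite -(functional_row fL) !mxE; apply: eq_bigr => j _.
by rewrite !mxE.
Qed.

Section Reconstruction.
Variables (Y : 'I_k -> C) (i0 i1 : 'I_k) (a b : C -> F).
Hypothesis i01 : i0 != i1.
Hypothesis XY : X Y = 1.
Hypothesis aL : forall c u v, a (c *: u + v) = c * a u + a v.
Hypothesis bL : forall c u v, b (c *: u + v) = c * b u + b v.
Hypotheses (aY : forall j, a (Y j) = 0) (bY : forall j, b (Y j) = 0).
Hypothesis x3_0 : forall Z i j l u v w, i != j -> i != l -> j != l -> X Z = 1 ->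
  centered X Z u -> centered X Z v -> centered X Z w -> x3 X Z i j l u v w = 0.
Let cen := centered X Y.
Hypothesis w01 : forall u v, cen u -> cen v -> x2 X Y i0 i1 u v = a u * b v - a v * b u.
Hypothesis w0 : forall i j u v, i != j -> [set i; j]%SET != [set i0; i1]%SET -> cen u -> cen v ->
  x2 X Y i j u v = 0.

(** An invariant of frames whose slots other than i0 and i1 are moved along vectors that are
    centered for Y. *)
Let good Z := [/\ X Z = 1, forall u, cen u -> centered X Z u,
  forall u v, cen u -> cen v -> x2 X Z i0 i1 u v = a u * b v - a v * b u &
  forall i j u v, i != j -> [set i; j]%SET != [set i0; i1]%SET -> cen u -> cen v ->
    x2 X Z i j u v = 0].

Lemma good_move Z l w : good Z -> l != i0 -> l != i1 -> cen w -> good (move Z l 1 w).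
Proof.
move=> [XZ cZ Z01 Z0] l0 l1 cw.
have [i0l i1l] : i0 != l /\ i1 != l by rewrite ![_ == l]eq_sym.
have nl i : [set i; l]%SET != [set i0; i1]%SET.
  apply/eqP => /setP/(_ l); rewrite !inE eqxx orbT (negPf l0) (negPf l1) //.
split=> [|u cu i|u v cu cv|i j u v ij nij cu cv].
- by rewrite (move_T XP) XZ (cZ w cw) mulr0 addr0.
- have [->|il] := eqVneq i l; first by rewrite move_x1_same cZ.
  by rewrite (move_x1 XP) // (cZ u cu) Z0 // mulr0 addr0.
- by rewrite (move_x2 XP) // Z01 // x3_0 ?mulr0 ?addr0 //; apply: cZ.
have [il|il] := eqVneq i l; first by subst i; rewrite move_x2_fst Z0.
have [jl|jl] := eqVneq j l; first by subst j; rewrite move_x2_snd // Z0.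
by rewrite (move_x2 XP) // Z0 // x3_0 ?mulr0 ?addr0 //; apply: cZ.
Qed.

(** Slots other than i0 and i1 are moved one at a time within good frames. The last two are expanded
    bilinearly, where the terms linear in phi vanish by centering. *)
Lemma ev_good (phi : 'I_k -> C) : (forall j, cen (phi j)) ->
  X (fun j => Y j + phi j) = 1 + (a (phi i0) * b (phi i1) - a (phi i1) * b (phi i0)).
Proof.
move=> cphi; pose Ys (s : seq 'I_k) l := if (l \in s) && (l \notin [:: i0; i1]) then Y l + phi l else Y l.
have gYs s : good (Ys s).
  elim: s => [|l s IH].
    by rewrite (_ : Ys [::] = Y) //; split.
  have [/orP[ls|l01]|] := boolP ((l \in s) || (l \in [:: i0; i1])).
  - rewrite (_ : Ys _ = Ys s) //; apply/funext=> m; rewrite /Ys in_cons.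
    by case: eqP => // ->; rewrite ls.
  - rewrite (_ : Ys _ = Ys s) //; apply/funext=> m; rewrite /Ys in_cons.
    by case: eqP => // ->; rewrite l01 !andbF.
  rewrite negb_or => /andP[ls l01].
  rewrite (_ : Ys _ = move (Ys s) l 1 (phi l)).
    by move: l01; rewrite !inE negb_or => /andP[? ?]; apply: good_move.
  apply/funext=> m; rewrite /move /update /Ys in_cons.
  have [->|//] := eqVneq m l.
  by rewrite (negPf ls) l01 scale1r addrC.
have [XZ cZ Z01 _] := gYs (enum 'I_k); set Z := Ys _ in XZ cZ Z01.
have Z0 : Z i0 = Y i0 by rewrite /Z /Ys !inE eqxx andbF.
have Z1 : Z i1 = Y i1 by rewrite /Z /Ys !inE eqxx orbT andbF.
have -> : (fun j => Y j + phi j) = update (update Z i0 (phi i0 + Z i0)) i1 (phi i1 + Z i1).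
  apply/funext=> l; rewrite /update; have [->|l1] := eqVneq l i1; first by rewrite Z1 addrC.
  have [->|l0] := eqVneq l i0; first by rewrite Z0 addrC.
  by rewrite /Z /Ys mem_enum !inE (negPf l0) (negPf l1).
rewrite (alt_add XP) !(updateC _ _ _ i01) !(alt_add XP) !update_id XZ.
rewrite -{1}[Z i0](update_neq Z (phi i1) i01) update_id -!/(x1 X Z _ _) !cZ //.
rewrite -(updateC _ _ _ i01) -/(x2 X Z i0 i1 _ _) Z01 //; ring.
Qed.

(** The rows of A are the forms x1, so A is dual to Y and its kernel is the space of centered
    vectors; B has the rows i0 and i1 replaced by a and b. Up to a change of basis, every frame Z
    with A *m Z invertible is Y plus centered vectors, and density covers the remaining frames. *)
Lemma reconstruct : exists A B : 'M[F]_(k, n),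
  (forall l, l != i0 -> l != i1 -> row l A = row l B) /\ x = wdg A + wdg B.
Proof.
pose A := functional_mx (fun i => x1 X Y i).
have AE i u : (A *m u) i 0 = x1 X Y i u by apply: functional_mxE => *; apply: x1_linear.
pose f i : C -> F := if i == i0 then a else if i == i1 then b else x1 X Y i.
have fL i : forall c u v, f i (c *: u + v) = c * f i u + f i v.
  by rewrite /f; case: ifP => // _; case: ifP => // _ *; apply: x1_linear.
pose B := functional_mx f; have BE i u : (B *m u) i 0 = f i u by apply: functional_mxE.
have AY j : A *m Y j = \col_i (i == j)%:R.
  by apply/colP=> i; rewrite AE mxE (x1_frame XP) XY mulr1 eq_sym.
exists A, B; split.
  move=> l l0 l1; apply/rowP=> j; rewrite !mxE /f (negPf l0) (negPf l1) //.
have special phi : (forall j, cen (phi j)) ->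
    X (fun j => Y j + phi j) = ev (wdg A + wdg B) (fun j => Y j + phi j).
  move=> cphi; rewrite ev_good // evD; congr (_ + _).
    rewrite (ev_frame (Y := fun j => Y j + phi j)) // => j; rewrite mulmxDr AY.
    by apply/colP=> i; rewrite mxE AE cphi addr0.
  (* The values of B on Y + phi form the identity matrix with rows i0 and i1 replaced. Its transpose
     holds the values of A on Y with [wa] and [wb] in these slots, and [x2_dual] gives the
     determinant. *)
  pose wa := \sum_j a (phi j) *: Y j; pose wb := \sum_j b (phi j) *: Y j.
  have Aw (c : 'I_k -> F) i : (A *m (\sum_j c j *: Y j)) i 0 = c i.
    rewrite mulmx_sumr summxE (bigD1 i) //= big1 => [|j ji].
      by rewrite -scalemxAr AY [LHS]addr0 mxE [X in _ * X]mxE eqxx mulr1.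
    by rewrite -scalemxAr AY mxE [X in _ * X]mxE eq_sym (negPf ji) mulr0.
  have := x2_dual AY wa wb i01; rewrite /x2 ev_wdg !Aw => E.
  rewrite [RHS](_ : _ = a (phi i0) * b (phi i1) - a (phi i1) * b (phi i0)) // -E.
  rewrite ev_wdg -[LHS]det_tr; congr (\det _); apply/matrixP=> i j.
  rewrite [LHS]mxE [LHS]mxE [RHS]mxE BE /f /update.
  case: (eqVneq j i0) => [ji0|j0].
    by rewrite ji0 (negPf i01) Aw (linD aL) aY add0r.
  case: (eqVneq j i1) => [ji1|j1]; first by rewrite Aw (linD bL) bY add0r.
  have xL c u v := x1_linear XP Y j c u v.
  by rewrite (linD xL) (x1_frame XP) cphi addr0 XY mulr1 AY mxE.
pose Zm (Z : 'M[F]_(n, k)) : 'I_k -> C := fun j => col j Z.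
pose G (Z : 'M[F]_(n, k)) := X (Zm Z) - ev (wdg A + wdg B) (Zm Z).
have pZ j r : pfun (fun Z : 'M[F]_(n, k) => Zm Z j r 0) by apply: pfun_linear => c u v; rewrite !mxE.
have pG : pfun G by apply: pfunB; apply: pfun_ev => //; apply: pmapC.
have pA : pfun (fun Z : 'M[F]_(n, k) => \det (A *m Z)).
  by apply: pfun_det => i j; apply: pfun_linear => c u v; rewrite mulmxDr -scalemxAr !mxE.
have AY1 : A *m (\matrix_(r, j) Y j r 0) = 1%:M.
  apply/matrixP=> i j; have E : (A *m Y j) i 0 = (i == j)%:R by rewrite AY mxE.
  rewrite [RHS]mxE -E [LHS]mxE [RHS]mxE; apply: eq_bigr => l _.
  by rewrite [X in _ * X]mxE.
have dN : \det (A *m (\matrix_(r, j) Y j r 0)) != 0 by rewrite AY1 det1 oner_eq0.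
have G0 := pfun_eq0_generic F0 pG pA dN _.
apply: ev_inj => Z; apply/eqP; rewrite -subr_eq0; apply/eqP.
have -> : Z = Zm (\matrix_(r, j) Z j r 0).
  by apply/funext=> j; apply/colP=> r; rewrite !mxE.
apply: G0 => {}Z Zu; rewrite /G.
have Mu : A *m Z \in unitmx by rewrite unitmxE unitfE.
pose N := invmx (A *m Z); pose Z' j := \sum_l N l j *: Zm Z l.
have Z'E j : Z' j = col j (Z *m N).
  apply/colP=> r; rewrite summxE !mxE; apply: eq_bigr => l _.
  by rewrite !mxE mulrC.
have NZ y : ev y Z' = \det N * ev y (Zm Z) by apply: ev_mul.
have N0 : \det N != 0 by rewrite -unitfE -unitmxE unitmx_inv.
apply/eqP; rewrite subr_eq0 -(inj_eq (mulfI N0)) -!NZ; apply/eqP.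
have -> : Z' = fun j => Y j + (Z' j - Y j) by apply/funext=> j; rewrite addrC subrK.
apply: special => j i; rewrite -AE mulmxBr AY Z'E colE !mulmxA.
by rewrite mulmxV // mul1mx !mxE eqxx andbT subrr.
Qed.

End Reconstruction.
End GoodFrames.

(** * Reduction of frames by pivoting on a nonzero quadratic form *)

Section Classification.
Variables (F : fieldType) (F0 : [pchar F] =i pred0) (V : vectType F) (k : nat).
Local Notation n := (\dim {:V}).
Local Notation C := 'cV[F]_n.
Local Notation W := (extpow V k).
Implicit Types (Y Z : 'I_k -> C) (i j l m : 'I_k) (u v w a b c : C).
Variable x : W.
Local Notation X := (ev x).
Let XP := ev_alternating x.

Hypothesis c3_0 : forall Z i j l u v w, i != j -> i != l -> j != l -> c3 X Z i j l u v w = 0.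
Hypothesis rows : forall Z i j l a b c d, X Z != 0 -> i != j -> i != l ->
  c2 X Z i j a b * c2 X Z i l c d - c2 X Z i j a c * c2 X Z i l b d + c2 X Z i j a d * c2 X Z i l b c
  + c2 X Z i j c d * c2 X Z i l a b - c2 X Z i j b d * c2 X Z i l a c + c2 X Z i j b c * c2 X Z i l a d = 0.
Hypothesis columns : forall Z i j l m a b, X Z != 0 ->
  i != j -> i != l -> i != m -> j != l -> j != m -> l != m ->
  c2 X Z i j a b * c2 X Z l m a b - c2 X Z i l a b * c2 X Z j m a b
  + c2 X Z i m a b * c2 X Z j l a b = 0.

Let two_neq0 : (2 : F) != 0 := natr_char0_neq0 F0 (isT : 2%N != 0%N).

Lemma x3_centered Z i j l u v w : i != j -> i != l -> j != l -> X Z = 1 ->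
  centered X Z u -> centered X Z v -> centered X Z w -> x3 X Z i j l u v w = 0.
Proof.
move=> ij il jl XZ cu cv cw; have := c3_0 Z u v w ij il jl.
by rewrite c3_centered // XZ expr1n mul1r.
Qed.

Section OneFrame.
Variable Z : 'I_k -> C.
Hypothesis XZ : X Z = 1.
Local Notation cen := (centered X Z).
Local Notation om := (x2 X Z).

Let XZ0 : X Z != 0. Proof. by rewrite XZ oner_eq0. Qed.

Lemma c2_om i j a b : cen a -> c2 X Z i j a b = om i j a b.
Proof. by move=> ca; rewrite c2_centered // XZ mul1r. Qed.

(* Besides the quadratic relation of the rows [i], [j], [l], moving the slot [i]
   along [p] in the relation [c3 = 0] gives the same expression with the roles of
   [j] and [l] exchanged. *)
Lemma om_wedge i j l p a b c : i != j -> i != l -> j != l ->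
  cen p -> cen a -> cen b -> cen c ->
  om i j p a * om i l b c - om i j p b * om i l a c + om i j p c * om i l a b = 0.
Proof.
move=> ij il jl cp ca cb cc; have [ji li] : j != i /\ l != i by rewrite ![_ == i]eq_sym.
have := rows p a b c XZ0 ij il; rewrite !c2_om // => R1.
have := c3_0 (move Z i 1 p) a b c ij il jl.
rewrite /c3 (move_T XP) cp !move_x1_same ca cb cc !(move_x1 XP) // !ca !cb !cc !move_x2_fst.
have E d e : cen d -> cen e -> x2 X (move Z i 1 p) j l d e = om j l d e.
  by move=> cd ce; rewrite (move_x2 XP) // x3_centered ?mulr0 ?addr0.
have -> : x3 X (move Z i 1 p) i j l a b c = 0.
  by rewrite /x3 /move updateK -/(x3 X Z i j l a b c) x3_centered.
rewrite !E // XZ !(x2_sym _ _ _ _ ji) !(x2_sym _ _ _ _ li) => R3.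
apply: (mulfI two_neq0); rewrite mulr0 -[RHS](addr0 0) -[in X in _ = X + _]R1 -[in RHS]R3.
ring.
Qed.

(** For l = j the relation of [rows] is twice the Plücker relation. *)
Lemma om_decomposable i j a b c d : i != j -> cen a -> cen b -> cen c -> cen d ->
  om i j a b * om i j c d - om i j a c * om i j b d + om i j a d * om i j b c = 0.
Proof.
move=> ij ca cb cc cd; have := rows a b c d XZ0 ij ij; rewrite !c2_om // => R1.
by apply: (mulfI two_neq0); rewrite mulr0 -[RHS]R1; ring.
Qed.

(** The relation of [rows] alone would allow two forms that share one factor. The stronger
    [om_wedge] makes their contractions with p and with r proportional, and these contractions
    determine both forms. *)
Lemma om_parallel i j l p r u v : i != j -> i != l -> j != l ->
  cen p -> cen r -> cen u -> cen v -> om i j p r != 0 ->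
  om i j p r * om i l u v = om i l p r * om i j u v.
Proof.
move=> ij il jl cp cr cu cv g0; set g := om i j p r; set e := om i l p r.
have W1 w : cen w -> g * om i l p w = om i j p w * e.
  move=> cw; have := om_wedge ij il jl cp cr cp cw.
  rewrite (x2_eq XP _ p ij) mul0r subr0 (x2_anti XP _ r p il) mulrN => /eqP.
  by rewrite subr_eq0 => /eqP.
have W2 w : cen w -> g * om i l r w = om i j r w * e.
  move=> cw; have := om_wedge ij il jl cr cp cr cw.
  rewrite (x2_eq XP _ r ij) mul0r subr0 (x2_anti XP _ r p ij) mulNr => /eqP.
  by rewrite addrC subr_eq0 => /eqP/esym.
have W3 := om_wedge ij il jl cp cr cu cv.
apply: (mulfI g0); rewrite -/g.
have D := om_decomposable ij cp cr cu cv.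
have -> : g * (g * om i l u v) = g * (om i j p u * om i l r v - om i j p v * om i l r u).
  congr (_ * _); apply/eqP; rewrite -subr_eq0 -[X in _ == X]W3; apply/eqP; rewrite /g; ring.
have -> : g * (e * om i j u v) = e * (g * om i j u v) by ring.
have -> : g * om i j u v = om i j p u * om i j r v - om i j p v * om i j r u.
  by apply/eqP; rewrite -subr_eq0 -[X in _ == X]D; apply/eqP; rewrite /g; ring.
rewrite mulrBr !(mulrCA g) !W2 //; ring.
Qed.

End OneFrame.

(** By [om_parallel] the form of the slots i, l is c times that of i, j. Adding c times Z l to Z j
    subtracts this multiple, and only recombines the forms x1, so that the centered vectors stay the
    same. *)
Lemma kill_step Z i j l p r : X Z = 1 -> i != j -> i != l -> j != l ->
  centered X Z p -> centered X Z r -> x2 X Z i j p r != 0 ->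
  exists Z', [/\ X Z' = 1, (forall u, centered X Z' u <-> centered X Z u),
    (forall m u v, j != m -> x2 X Z' j m u v = x2 X Z j m u v),
    (forall m u v, i != m -> m != l -> centered X Z u -> centered X Z v ->
       x2 X Z' i m u v = x2 X Z i m u v) &
    forall u v, centered X Z u -> centered X Z v -> x2 X Z' i l u v = 0].
Proof.
move=> XZ ij il jl cp cr g0; pose c := x2 X Z i l p r / x2 X Z i j p r.
have [ji li lj] : [/\ j != i, l != i & l != j] by rewrite ![_ == i]eq_sym [l == j]eq_sym.
pose Z' := move Z j c (Z l).
have x1E m u : m != j -> x1 X Z' m u = x1 X Z m u - c * ((l == m)%:R * x1 X Z j u).
  move=> mj; have jm : j != m by rewrite eq_sym.
  rewrite (move_x1 XP) // (x2_sym _ _ _ _ mj) (x2_frame XP) //.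
  by rewrite (negPf lj) mul0r sub0r mulrN.
have x2E m u v : i != m -> m != j -> x2 X Z' i m u v =
    x2 X Z i m u v + c * ((l == m)%:R * x2 X Z j i u v).
  move=> im mj; have jm : j != m by rewrite eq_sym.
  rewrite (move_x2 XP) // -(x3_rot X Z _ _ _ ji jm im).
  by rewrite (x3_frame XP) // (negPf lj) (negPf li) !mul0r subrr add0r.
exists Z'; split.
- by rewrite (move_T XP) XZ (x1_frame XP) (negPf lj) mul0r mulr0 addr0.
- move=> u; split=> cu m; have [->|mj] := eqVneq m j.
  + by have := cu j; rewrite move_x1_same.
  + have := cu m; rewrite x1E // -(move_x1_same X Z j c (Z l)) -/Z' cu.
    by rewrite !mulr0 subr0.
  + by rewrite move_x1_same cu.
  + by rewrite x1E // !cu !mulr0 subr0.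
- by move=> m u v jm; rewrite move_x2_fst.
- move=> m u v im ml cu cv; have [->|mj] := eqVneq m j; first by rewrite move_x2_snd.
  by rewrite x2E // eq_sym (negPf ml) mul0r mulr0 addr0.
move=> u v cu cv; rewrite x2E // eqxx mul1r (x2_sym _ _ _ _ ji) (x2_anti XP _ v u ij) mulrN.
have := om_parallel XZ ij il jl cp cr cu cv g0 => E.
apply: (mulfI g0); rewrite mulr0 mulrBr E /c mulrA [_ * (_ / _)]mulrC divfK //.
exact: subrr.
Qed.

Lemma kill (s : seq 'I_k) Z i j p r : X Z = 1 -> i != j ->
  centered X Z p -> centered X Z r -> x2 X Z i j p r != 0 ->
  exists Z', [/\ X Z' = 1, (forall u, centered X Z' u <-> centered X Z u),
    (forall m u v, j != m -> x2 X Z' j m u v = x2 X Z j m u v) &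
    forall l u v, l \in s -> i != l -> j != l -> centered X Z u -> centered X Z v ->
      x2 X Z' i l u v = 0].
Proof.
move=> XZ ij cp cr g0; elim: s => [|l s [Z1 [XZ1 c1 e1 k1]]]; first by exists Z; split.
have [/orP li|] := boolP ((i == l) || (j == l)).
  exists Z1; split=> // m u v; rewrite in_cons => /predU1P[->|ms] im jm; last exact: k1.
  by case: li => /eqP E; [rewrite E eqxx in im|rewrite E eqxx in jm].
rewrite negb_or => /andP[il jl].
have ji : j != i by rewrite eq_sym.
have g1 : x2 X Z1 i j p r != 0 by rewrite (x2_sym _ _ _ _ ij) e1 // -(x2_sym _ _ _ _ ij).
have [Z2 [XZ2 c2' e2 k2 k3]] := kill_step XZ1 ij il jl (proj2 (c1 p) cp) (proj2 (c1 r) cr) g1.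
exists Z2; split=> //.
- by move=> u; rewrite c2' c1.
- by move=> m u v jm; rewrite e2 // e1.
move=> m u v; rewrite in_cons => ms im jm cu cv.
have [->|ml] := eqVneq m l; first by apply: k3; apply/c1.
rewrite k2 //; [|by apply/c1|by apply/c1].
by apply: k1 => //; case/predU1P: ms => [E|//]; rewrite E eqxx in ml.
Qed.

Lemma centered_linear Z (s : F) u v : centered X Z u -> centered X Z v -> centered X Z (s *: u + v).
Proof. by move=> cu cv i; rewrite (x1_linear XP) cu cv mulr0 addr0. Qed.

(** If all x2 vanish on centered vectors, the reconstruction applies with a = b = 0. Otherwise a
    nonzero x2 at i0, i1 is the pivot that clears all other x2 involving i0 or i1, and the column
    relation clears those that involve neither. *)
Lemma classify (i1' i2' : 'I_k) : i1' != i2' -> (exists Z, X Z != 0) ->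
  exists (i0 i1 : 'I_k) (A B : 'M[F]_(k, n)), [/\ i0 != i1,
    (forall l, l != i0 -> l != i1 -> row l A = row l B) & x = wdg A + wdg B].
Proof.
move=> i12' [Z0 Z00]; pose Z := update Z0 i1' ((X Z0)^-1 *: Z0 i1').
have XZ : X Z = 1 by rewrite /Z (alt_scale XP) update_id mulVf.
have [[i0 [i1 [p [r [i01 cp cr g0]]]]]|none] := pselect (exists i j p r,
    [/\ i != j, centered X Z p, centered X Z r & x2 X Z i j p r != 0]); last first.
  have om0 i j u v : i != j -> centered X Z u -> centered X Z v -> x2 X Z i j u v = 0.
    move=> ij cu cv; apply/eqP/negPn/negP => H; apply: none; by exists i, j, u, v.
  exists i1', i2'.
  have [|||||||A [B [AB xAB]]] := @reconstruct _ F0 _ _ x Z i1' i2' (fun=> 0) (fun=> 0) i12' XZ.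
  - by move=> *; rewrite mulr0 addr0.
  - by move=> *; rewrite mulr0 addr0.
  - by [].
  - by [].
  - exact: x3_centered.
  - by move=> u v cu cv; rewrite om0 // !mul0r subrr.
  - by move=> *; rewrite om0.
  by exists A, B; split.
have i10 : i1 != i0 by rewrite eq_sym.
have [Z1 [XZ1 c1 e1 k1]] := kill (enum 'I_k) XZ i01 cp cr g0.
have g1 : x2 X Z1 i1 i0 p r != 0.
  by rewrite e1 // (x2_sym _ _ _ _ i10) (x2_anti XP) // oppr_eq0.
have [Z2 [XZ2 c2' e2 k2]] := kill (enum 'I_k) XZ1 i10 (proj2 (c1 p) cp) (proj2 (c1 r) cr) g1.
have Z2_0 l u v : l != i0 -> l != i1 -> centered X Z2 u -> centered X Z2 v -> x2 X Z2 i0 l u v = 0.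
  move=> l0 l1 /c2'/c1 cu /c2'/c1 cv; rewrite e2 1?eq_sym // k1 ?mem_enum // eq_sym //.
have Z2_1 l u v : l != i0 -> l != i1 -> centered X Z2 u -> centered X Z2 v -> x2 X Z2 i1 l u v = 0.
  by move=> l0 l1 /c2' cu /c2' cv; rewrite k2 ?mem_enum // eq_sym.
have cp2 : centered X Z2 p by apply/c2'/c1.
have cr2 : centered X Z2 r by apply/c2'/c1.
have g2 : x2 X Z2 i0 i1 p r != 0.
  by rewrite e2 // (x2_sym _ _ _ _ i01) (x2_anti XP) // oppr_eq0.
have Z2_lm l m u v : l != i0 -> l != i1 -> m != i0 -> m != i1 -> l != m ->
    centered X Z2 u -> centered X Z2 v -> x2 X Z2 l m u v = 0.
  move=> l0 l1 m0 m1 lm cu cv; apply/eqP/negPn/negP => H.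
  have pf i j : pfun (fun w : C * C => x2 X Z2 i j w.1 w.2).
    apply: pfun_ev; first exact: pmapC.
    apply: pfun_update; first apply: pfun_update => [j' r'|r'].
    - exact: pfunC.
    - by apply: (@pfun_linear _ (C * C)%type) => *; rewrite !mxE.
    - by move=> r'; apply: (@pfun_linear _ (C * C)%type) => *; rewrite !mxE.
  (* The column relation needs both forms at the same pair of vectors; on the line joining two
     centered pairs both are nonzero at some point. *)
  have [s []] := @pfun_generic _ F0 (C * C)%type _ _ (p, r) (u, v) (pf i0 i1) (pf l m) g2 H.
  set a := p + s *: (u - p); set b := r + s *: (v - r) => /= f1 f2.
  have ca : centered X Z2 a.
    rewrite /a addrC; apply: centered_linear => //; rewrite addrC -scaleN1r; exact: centered_linear.
  have cb : centered X Z2 b.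
    rewrite /b addrC; apply: centered_linear => //; rewrite addrC -scaleN1r; exact: centered_linear.
  have XN : X Z2 != 0 by rewrite XZ2 oner_eq0.
  have [i0l i0m i1l i1m] : [/\ i0 != l, i0 != m, i1 != l & i1 != m] by rewrite ![_ == l]eq_sym ![_ == m]eq_sym.
  have := columns a b XN i01 i0l i0m i1l i1m lm.
  rewrite !c2_om // (Z2_0 l) // (Z2_0 m) // !mul0r subr0 addr0 => /eqP.
  by rewrite mulf_eq0 (negPf f1) (negPf f2).
exists i0, i1.
pose g := x2 X Z2 i0 i1 p r.
have c2l q (c : F) u v : c2 X Z2 i0 i1 q (c *: u + v) = c * c2 X Z2 i0 i1 q u + c2 X Z2 i0 i1 q v.
  by rewrite !(c2_anti XP _ q) // (c2_linear XP) // mulrN opprD.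
have c2f q j : c2 X Z2 i0 i1 q (Z2 j) = 0.
  by rewrite (c2_anti XP) // (c2_frame XP) // oppr0.
(* A nonzero decomposable 2-form is the wedge of its contractions with p and r, divided by its value
   at (p, r). The contractions are taken of [c2] instead of [x2] because [c2] vanishes on the
   frame. *)
have [|||||||A [B [AB xAB]]] := @reconstruct _ F0 _ _ x Z2 i0 i1
  (fun u => c2 X Z2 i0 i1 p u / g) (fun u => c2 X Z2 i0 i1 r u) i01 XZ2.
- by move=> c u v; rewrite c2l mulrDl mulrA.
- by move=> c u v; rewrite c2l.
- by move=> j; rewrite c2f mul0r.
- by move=> j; rewrite c2f.
- exact: x3_centered.
- move=> u v cu cv; rewrite !c2_om //; have := om_decomposable XZ2 i01 cp2 cr2 cu cv.
  rewrite -/g => D; apply: (mulfI g2).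
  rewrite -/g -[LHS]subr0 -[X in _ - X]D; field; exact: g2.
- move=> i j u v ij nij cu cv.
  have sy : x2 X Z2 i j u v = 0 -> x2 X Z2 j i v u = 0 by rewrite (x2_sym _ _ _ _ ij).
  have [ii0|ii0] := eqVneq i i0.
    have ji0 : j != i0 by rewrite -ii0 eq_sym.
    have ji1 : j != i1 by apply: contraNneq nij => ji1; rewrite ii0 ji1.
    by rewrite ii0 Z2_0.
  have [ii1|ii1] := eqVneq i i1.
    have ji1 : j != i1 by rewrite -ii1 eq_sym.
    have ji0 : j != i0 by apply: contraNneq nij => ji0; rewrite ii1 ji0 finset.setUC.
    by rewrite ii1 Z2_1.
  have [jj0|jj0] := eqVneq j i0.
    by rewrite (x2_sym _ _ _ _ ij) jj0 Z2_0.
  have [jj1|jj1] := eqVneq j i1.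
    by rewrite (x2_sym _ _ _ _ ij) jj1 Z2_1.
  exact: Z2_lm.
by exists A, B; split.
Qed.

End Classification.

(** * Points at distance two *)

Section SecantRelations.
Variables (F : fieldType) (F0 : [pchar F] =i pred0) (V : vectType F) (k : nat).
Local Notation n := (\dim {:V}).
Local Notation C := 'cV[F]_n.
Local Notation W := (extpow V k).
Local Notation sigma := (secant_variety (Gr V k)).
Hypotheses (k0 : (0 < k)%N) (kn : (k <= n)%N).

Definition dual_to (A : 'M[F]_(k, n)) (Z : 'I_k -> C) := forall j, A *m Z j = \col_i (i == j)%:R.

Lemma dual_normalize (A : 'M[F]_(k, n)) (Z : 'I_k -> C) :
  ev (wdg A) Z != 0 -> exists2 A', dual_to A' Z & wdg A = ev (wdg A) Z *: wdg A'.
Proof.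
rewrite ev_wdg; set M := \matrix_(_, _) _ => M0.
have Mu : M \in unitmx by rewrite unitmxE unitfE.
exists (invmx M *m A); last by rewrite -wdg_mul mulKVmx.
move=> j; rewrite -mulmxA (_ : A *m Z j = col j M); last by apply/colP=> i; rewrite [RHS]mxE [RHS]mxE.
by rewrite colE mulmxA mulVmx // mul1mx; apply/colP=> i; rewrite !mxE eqxx andbT.
Qed.

(** Row operations make a generic pair of matrices dual to the same frame Z, where [c2] has a closed
    form; all other points follow by density. *)
Lemma secant_relation (G : W -> F) p Z : pfun G -> sigma p -> ev (rep p) Z != 0 ->
  (forall al be A B, dual_to A Z -> dual_to B Z -> G (al *: wdg A + be *: wdg B) = 0) ->
  G (rep p) = 0.
Proof.
move=> pG sp evZ GZ.
(* Otherwise evaluation at Z would vanish on the whole secant variety, p included. *)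
have [A0 A00] : exists A0 : 'M[F]_(k, n), ev (wdg A0) Z != 0.
  apply: contrapT => /forallNP H.
  have pe : pfun (fun x : W => ev x Z) by apply: pfun_linear => a u v; apply: ev_linear.
  have : cvanish sigma (fun x : W => ev x Z).
    apply/(secant_cvanish F0 k0 kn pe) => A B; rewrite evD.
    have E D : ev (wdg D) Z = 0 by apply/eqP/negPn/negP/H.
    by rewrite !E addr0.
  by move/(_ p _ sp (mem_rep p)) => /eqP; apply/negP.
suff : cvanish sigma G by move/(_ p _ sp (mem_rep p)).
apply/(secant_cvanish F0 k0 kn pG) => A B.
pose mm := ('M[F]_(k, n) * 'M[F]_(k, n))%type.
have pw1 : pmap (fun p : mm => wdg p.1).
  by apply: pmap_wdg => i j; apply: (@pfun_linear _ mm) => a u v; rewrite !mxE.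
have pw2 : pmap (fun p : mm => wdg p.2).
  by apply: pmap_wdg => i j; apply: (@pfun_linear _ mm) => a u v; rewrite !mxE.
have pGw : pfun (fun p : mm => G (wdg p.1 + wdg p.2)).
  exact: (pfun_comp (pmapD pw1 pw2) pG).
have pg : pfun (fun p : mm => ev (wdg p.1) Z * ev (wdg p.2) Z).
  by apply: pfunM; apply: pfun_ev => // *; apply: pfunC.
have gN : ev (wdg (A0, A0).1) Z * ev (wdg (A0, A0).2) Z != 0 by apply: mulf_neq0.
apply: (pfun_eq0_generic F0 pGw pg gN _ (A, B)) => {A B} -[A B] /=.
rewrite mulf_eq0 negb_or => /andP[/dual_normalize[A' dA ->] /dual_normalize[B' dB ->]].
exact: GZ.
Qed.

Lemma c2_dual al be A B (Z : 'I_k -> C) i j u v : i != j -> dual_to A Z -> dual_to B Z ->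
  c2 (ev (al *: wdg A + be *: wdg B)) Z i j u v = al * be *
   (((A - B) *m u) i 0 * ((A - B) *m v) j 0 - ((A - B) *m u) j 0 * ((A - B) *m v) i 0).
Proof.
move=> ij dA dB.
have e1 i' u' : x1 (ev (al *: wdg A + be *: wdg B)) Z i' u'
    = al * x1 (ev (wdg A)) Z i' u' + be * x1 (ev (wdg B)) Z i' u' by rewrite /x1 evD !evZ.
have e2 : x2 (ev (al *: wdg A + be *: wdg B)) Z i j u v
    = al * x2 (ev (wdg A)) Z i j u v + be * x2 (ev (wdg B)) Z i j u v by rewrite /x2 evD !evZ.
rewrite /c2 e2 !e1 evD !evZ (ev_frame dA) (ev_frame dB).
rewrite !(x1_dual dA) !(x1_dual dB) (x2_dual dA) // (x2_dual dB) //.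
have E y l : ((A - B) *m y) l 0 = (A *m y) l 0 - (B *m y) l 0.
  by rewrite mulmxBl mxE [X in _ + X]mxE.
by rewrite !E; ring.
Qed.

Lemma pfun_c2_ev Z i j u v : pfun (fun x : W => c2 (ev x) Z i j u v).
Proof.
have pe Y : pfun (fun x : W => ev x Y) by apply: pfun_linear => a y z; apply: ev_linear.
by apply: pfunB; [apply: pfunM|apply: pfunB; apply: pfunM]; apply: pe.
Qed.

(** With D_i the rows of A - B, the forms are multiples of D_i ^ D_j and D_i ^ D_l, whose wedge is
    zero; the sum is this wedge on four vectors. *)
Lemma secant_rows p Z i j l (a b c d : C) : sigma p -> ev (rep p) Z != 0 -> i != j -> i != l ->
  let X := ev (rep p) in
  c2 X Z i j a b * c2 X Z i l c d - c2 X Z i j a c * c2 X Z i l b d + c2 X Z i j a d * c2 X Z i l b c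
  + c2 X Z i j c d * c2 X Z i l a b - c2 X Z i j b d * c2 X Z i l a c + c2 X Z i j b c * c2 X Z i l a d = 0.
Proof.
move=> sp evZ ij il /=; pose G (x : W) := let X := ev x in
  c2 X Z i j a b * c2 X Z i l c d - c2 X Z i j a c * c2 X Z i l b d + c2 X Z i j a d * c2 X Z i l b c
  + c2 X Z i j c d * c2 X Z i l a b - c2 X Z i j b d * c2 X Z i l a c + c2 X Z i j b c * c2 X Z i l a d.
apply: (@secant_relation G p Z _ sp evZ) => [|al be A B dA dB].
  rewrite /G; repeat first [apply: pfun_c2_ev | apply: pfunM | apply: pfunB | apply: pfunD].
rewrite /G !c2_dual //; ring.
Qed.

(** For fixed a and b the values are multiples of the 2-minors of a matrix with two columns; this is
    their Plücker relation in the row indices. *)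
Lemma secant_columns p Z i j l m (a b : C) : sigma p -> ev (rep p) Z != 0 ->
  i != j -> i != l -> i != m -> j != l -> j != m -> l != m ->
  let X := ev (rep p) in
  c2 X Z i j a b * c2 X Z l m a b - c2 X Z i l a b * c2 X Z j m a b
  + c2 X Z i m a b * c2 X Z j l a b = 0.
Proof.
move=> sp evZ ij il im jl jm lm /=; pose G (x : W) := let X := ev x in
  c2 X Z i j a b * c2 X Z l m a b - c2 X Z i l a b * c2 X Z j m a b
  + c2 X Z i m a b * c2 X Z j l a b.
apply: (@secant_relation G p Z _ sp evZ) => [|al be A B dA dB].
  rewrite /G; repeat first [apply: pfun_c2_ev | apply: pfunM | apply: pfunB | apply: pfunD].
rewrite /G !c2_dual //; ring.
Qed.

End SecantRelations.

Section DistanceTwo.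
Variables (F : fieldType) (F0 : [pchar F] =i pred0) (V : vectType F) (k : nat).
Local Open Scope classical_set_scope.
Local Notation n := (\dim {:V}).
Local Notation C := 'cV[F]_n.
Local Notation W := (extpow V k).
Hypothesis k0 : (0 < k)%N.

Definition set_row (A : 'M[F]_(k, n)) (i : 'I_k) (r : 'rV[F]_n) : 'M[F]_(k, n) :=
  \matrix_(l, j) if l == i then r 0 j else A l j.

Lemma set_row_linear A i a r s : wdg (set_row A i (a *: r + s)) = a *: wdg (set_row A i r) + wdg (set_row A i s).
Proof.
apply: ev_inj => Y; rewrite ev_linear !ev_wdg -[X in _ = _ + X]mul1r.
apply: (@determinant_multilinear _ _ _ _ _ i); last 2 first.
- apply/matrixP=> l j; rewrite !mxE; apply: eq_bigr => m _; rewrite !mxE.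
  by rewrite eq_sym (negPf (neq_lift _ _)).
- apply/matrixP=> l j; rewrite !mxE; apply: eq_bigr => m _; rewrite !mxE.
  by rewrite eq_sym (negPf (neq_lift _ _)).
apply/rowP=> j; rewrite !mxE mul1r big_distrr -big_split /=.
by apply: eq_bigr => m _; rewrite !mxE eqxx mulrDl mulrA.
Qed.

Lemma set_row_id A i : set_row A i (row i A) = A.
Proof. by apply/matrixP=> l j; rewrite !mxE; case: eqP => [->|]. Qed.

Lemma wdg_c2 (D : 'M[F]_(k, n)) (Z : 'I_k -> C) i j u v : i != j -> ev (wdg D) Z != 0 ->
  c2 (ev (wdg D)) Z i j u v = 0.
Proof.
move=> ij /dual_normalize[D' dD ->].
have := @c2_dual F V k (ev (wdg D) Z) 0 D' D' Z i j u v ij dD dD.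
by rewrite scale0r addr0 mulr0 mul0r.
Qed.

Lemma set_row_mul A i r (y : C) l :
  (set_row A i r *m y) l 0 = if l == i then (r *m y) 0 0 else (A *m y) l 0.
Proof. by rewrite !mxE; case: ifP => li; rewrite ?mxE; apply: eq_bigr => m _; rewrite mxE li. Qed.

Lemma line_in_Gr A i r s (p q : proj W) :
  val p = <[wdg (set_row A i r)]>%VS -> val q = <[wdg (set_row A i s)]>%VS ->
  span2 p q `<=` Gr V k.
Proof.
move=> pE qE x xpq; have /memv_addP[y + [z + xE]] := subvP xpq _ (mem_rep x).
rewrite pE qE => /vlineP[a aE] /vlineP[b bE].
(* The coefficient b is split as (b - 1) + 1 to fit the shape in which linearity of the row is
   stated. *)
have {}xE : rep x = wdg (set_row A i (a *: r + ((b - 1) *: s + s))).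
  by rewrite !set_row_linear xE aE bE scalerBl scale1r subrK.
by apply/GrP; exists (set_row A i (a *: r + ((b - 1) *: s + s))); rewrite -xE ?rep_neq0 // val_rep.
Qed.

Lemma pointE (x : W) (x0 : x != 0) : val (point x0) = <[x]>%VS.
Proof. by []. Qed.

Lemma dual_sum_neq0 (A B : 'M[F]_(k, n)) (Z : 'I_k -> C) :
  dual_to A Z -> dual_to B Z -> wdg A + wdg B != 0.
Proof.
move=> dA dB; apply/eqP=> E; have := congr1 (fun x => ev x Z) E.
rewrite evD ev0 (ev_frame dA) (ev_frame dB) => /eqP; apply/negP.
exact: (natr_char0_neq0 F0 (isT : 2%N != 0%N)).
Qed.

(** Replacing one row at a time gives a path of length two. A shorter path would make the sum
    decomposable, but [c2] vanishes on decomposable vectors and has the value 1 on the sum at w0,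
    w1. *)
Lemma distance_two (A B : 'M[F]_(k, n)) (i0 i1 : 'I_k) (Z : 'I_k -> C) (w0 w1 : C) (p : proj W) :
  i0 != i1 -> (forall l, l != i0 -> l != i1 -> row l A = row l B) ->
  dual_to A Z -> dual_to B Z -> A *m w0 = 0 -> A *m w1 = 0 ->
  B *m w0 = \col_i (i == i0)%:R -> B *m w1 = \col_i (i == i1)%:R ->
  val p = <[wdg A + wdg B]>%VS -> Sigma2 V k p.
Proof.
move=> i01 AB dA dB Aw0 Aw1 Bw0 Bw1 pE.
pose M := set_row A i0 (row i0 B).
have dM : dual_to M Z.
  move=> j; apply/colP=> l; rewrite set_row_mul -row_mul dA dB !mxE.
  by case: eqP => [->|].
have nz D : dual_to D Z -> wdg D != 0.
  move=> dD; apply/eqP=> D0; have := ev_frame dD; rewrite D0 ev0 => /eqP.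
  by rewrite eq_sym oner_eq0.
have ME : M = set_row B i1 (row i1 A).
  apply/matrixP=> l j; rewrite !mxE; case: (eqVneq l i0) => [->|l0]; first by rewrite (negPf i01).
  by case: (eqVneq l i1) => [->//|l1]; have /rowP/(_ j) := AB l l0 l1; rewrite !mxE.
have cAB : c2 (ev (wdg A + wdg B)) Z i0 i1 w0 w1 = 1.
  rewrite -[wdg A]scale1r -[wdg B]scale1r c2_dual // !mulmxBl Aw0 Aw1 Bw0 Bw1 !mxE !eqxx.
  by rewrite [i1 == i0]eq_sym !(negPf i01) /=; ring.
have notG D : wdg A + wdg B = wdg D -> False.
  move=> E; have := cAB; rewrite E wdg_c2 // => [/eqP|]; first by rewrite eq_sym oner_eq0.
  by rewrite -E evD (ev_frame dA) (ev_frame dB) (natr_char0_neq0 F0 (isT : 2%N != 0%N)).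
exists (wdg A), (wdg B), (point (nz A dA)), (point (nz B dB)); split=> //.
- by split; apply: nz.
- by split; eexists.
split.
  exists (fun i => if i == 0%N then point (nz A dA) else if i == 1%N then point (nz M dM) else point (nz B dB)).
  have GD D (dD : dual_to D Z) : Gr V k (point (nz D dD)) by apply/GrP; exists D => //; apply: nz.
  split=> // [i _|[|[|//]] _].
    by case: ifP => // _; case: ifP.
    by apply: (@line_in_Gr A i0 (row i0 A) (row i0 B)); rewrite pointE ?set_row_id.
  by apply: (@line_in_Gr B i1 (row i1 A) (row i1 B)); rewrite pointE -?ME ?set_row_id.
move=> [|[|//]] [c [c0 cs cG cl]].
  have : wdg B \in <[wdg A]>%VS.
    by rewrite -(pointE (nz A dA)) -c0 cs memv_line.
  move=> /vlineP[a E]; have [D DE] := wdg_scale k0 (1 + a) A.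
  by case: (notG D); rewrite E -DE scalerDl scale1r.
have AB0 := dual_sum_neq0 dA dB.
have : Gr V k (point AB0).
  apply: (cl 0%N isT); rewrite c0 cs /span2 /= -memvE.
  by rewrite memv_add // memv_line.
move=> /GrP[D _]; rewrite pointE => E.
have := memv_line (wdg A + wdg B); rewrite E => /vlineP[a].
by have [D' ->] := wdg_scale k0 a D => /notG.
Qed.

End DistanceTwo.

(** * Density of the points at distance two *)

Section DistanceTwoClosure.
Variables (F : fieldType) (F0 : [pchar F] =i pred0) (V : vectType F) (k : nat).
Local Open Scope classical_set_scope.
Local Notation n := (\dim {:V}).
Local Notation C := 'cV[F]_n.
Local Notation W := (extpow V k).
Hypotheses (k0 : (0 < k)%N) (kn : (k + 2 <= n)%N).
Variables (i0 i1 : 'I_k).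
Hypothesis i01 : i0 != i1.
Local Notation s0 := (rshift k (0 : 'I_2)).
Local Notation s1 := (rshift k (1 : 'I_2)).

(** A pair of matrices that agree outside the rows i0 and i1 is stored as one matrix with k + 2
    rows; generic pairs are then the matrices of full rank. *)
Definition swap_rows (N : 'M[F]_(k + 2, n)) : 'M[F]_(k, n) :=
  set_row (set_row (usubmx N) i0 (row s0 N)) i1 (row s1 N).

Lemma swap_rows_mul N (y : C) l : (swap_rows N *m y) l 0 =
  if l == i1 then (N *m y) s1 0 else if l == i0 then (N *m y) s0 0 else (N *m y) (lshift 2 l) 0.
Proof.
have E s : (row s N *m y) 0 0 = (N *m y) s 0 by rewrite -row_mul mxE.
rewrite !set_row_mul !E; do 2![case: ifP => // _].
by rewrite mul_usub_mx mxE.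
Qed.

Lemma swap_rowsE N l : l != i0 -> l != i1 -> row l (usubmx N) = row l (swap_rows N).
Proof. by move=> l0 l1; apply/rowP=> j; rewrite !mxE (negPf l0) (negPf l1). Qed.

Lemma swap_rows_col_mx (A B : 'M[F]_(k, n)) : (forall l, l != i0 -> l != i1 -> row l A = row l B) ->
  swap_rows (col_mx A (col_mx (row i0 B) (row i1 B))) = B.
Proof.
move=> AB; apply/matrixP=> l j; rewrite /swap_rows col_mxKu !mxE.
case: (eqVneq l i1) => [->|l1].
  rewrite (unsplitK (inr _)) mxE (_ : (1 : 'I_2) = rshift 1 (0 : 'I_1)); last exact/val_inj.
  by rewrite (unsplitK (inr _)) mxE.
case: (eqVneq l i0) => [->|l0]; last by have /rowP/(_ j) := AB l l0 l1; rewrite !mxE.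
rewrite (unsplitK (inr _)) mxE (_ : (0 : 'I_2) = lshift 1 (0 : 'I_1)); last exact/val_inj.
by rewrite (unsplitK (inl _)) mxE.
Qed.

Lemma sigma2_generic (N : 'M[F]_(k + 2, n)) (T : 'M[F]_(n, k + 2)) (p : proj W) : N *m T = 1%:M ->
  wdg (usubmx N) + wdg (swap_rows N) != 0 /\
  (val p = <[wdg (usubmx N) + wdg (swap_rows N)]>%VS -> Sigma2 V k p).
Proof.
move=> NT.
(* The columns of T belonging to the spare rows are added in the slots i0 and i1, which makes the
   frame dual to both matrices. *)
pose Z j := col (lshift 2 j) T + (j == i0)%:R *: col s0 T + (j == i1)%:R *: col s1 T.
have NE r s : (N *m col s T) r 0 = (r == s)%:R by rewrite colE mulmxA NT mul1mx mxE eqxx andbT.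
have NZ j r : (N *m Z j) r 0 = (r == lshift 2 j)%:R + (j == i0)%:R * (r == s0)%:R + (j == i1)%:R * (r == s1)%:R.
  have D m (x y : 'cV[F]_m) l : (x + y) l 0 = x l 0 + y l 0 by rewrite mxE.
  have S m (x : 'cV[F]_m) c l : (c *: x) l 0 = c * x l 0 by rewrite mxE.
  by rewrite /Z !mulmxDr -!scalemxAr !D !S !NE.
have i10 : i1 != i0 by rewrite eq_sym.
have dA : dual_to (usubmx N) Z.
  move=> j; apply/colP=> l; rewrite mul_usub_mx [RHS]mxE mxE NZ.
  by rewrite !eq_lrshift !mulr0 !addr0 (inj_eq (@lshift_inj _ _)).
have dB : dual_to (swap_rows N) Z.
  move=> j; apply/colP=> l; rewrite swap_rows_mul [RHS]mxE !NZ !(inj_eq (@rshift_inj _ _)) !(inj_eq (@lshift_inj _ _)) ?eq_lrshift ?eq_rlshift.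
  case: (eqVneq l i1) => [->|l1]; first by rewrite mulr0 mulr1 !add0r eq_sym.
  case: (eqVneq l i0) => [->|l0]; first by rewrite mulr0 mulr1 addr0 add0r eq_sym.
  by rewrite !mulr0 !addr0.
split=> [|pE]; first exact: (dual_sum_neq0 F0 dA dB).
apply: (@distance_two F F0 V k k0 _ _ i0 i1 Z (col s0 T) (col s1 T) p i01 (@swap_rowsE N) dA dB _ _ _ _ pE).
- by apply/colP=> l; rewrite mul_usub_mx mxE NE !mxE eq_lrshift.
- by apply/colP=> l; rewrite mul_usub_mx mxE NE !mxE eq_lrshift.
- apply/colP=> l; rewrite swap_rows_mul [RHS]mxE !NE !(inj_eq (@rshift_inj _ _)) eq_lrshift.
  by case: (eqVneq l i1) => [->|_]; [rewrite (negPf i10)|case: (l == i0)].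
- apply/colP=> l; rewrite swap_rows_mul [RHS]mxE !NE !(inj_eq (@rshift_inj _ _)) eq_lrshift.
  by case: (l == i1) => //; case: (l == i0).
Qed.

Lemma sigma2_closure (A B : 'M[F]_(k, n)) (p : proj W) :
  (forall l, l != i0 -> l != i1 -> row l A = row l B) -> rep p = wdg A + wdg B ->
  zclosure (Sigma2 V k) p.
Proof.
move=> AB pE; apply: (zclosure_pfun (rep_neq0 p) (mem_rep p)) => H pH HS.
pose mm := 'M[F]_(k + 2, n).
pose f (N : mm) := H (wdg (usubmx N) + wdg (swap_rows N)).
pose g (N : mm) := \det (N *m (pid_mx (k + 2) : 'M_(n, k + 2))).
have -> : H (rep p) = f (col_mx A (col_mx (row i0 B) (row i1 B))).
  by rewrite /f swap_rows_col_mx // col_mxKu pE.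
have pN i j : pfun (fun N : mm => N i j) by apply: pfun_linear => a u v; rewrite !mxE.
have pf : pfun f.
  apply: (pfun_comp _ pH); apply: pmapD; apply: pmap_wdg => i j.
    by apply: eq_pfun (pN (lshift 2 i) j) => N; rewrite mxE.
  apply: (@eq_pfun _ _ (fun N : mm => if i == i1 then N s1 j else if i == i0 then N s0 j else N (lshift 2 i) j)).
    by move=> N; rewrite !mxE; do 2![case: ifP; rewrite ?mxE //].
  by case: (i == i1); [|case: (i == i0)]; apply: pN.
have pg : pfun g.
  apply: pfun_det => i j; apply: (@pfun_linear _ mm) => a u v.
  by rewrite mulmxDl -scalemxAl !mxE.
have g1 : g (pid_mx (k + 2)) != 0.
  by rewrite /g pid_mx_id // pid_mx_1 det1 oner_eq0.
apply: (pfun_eq0_generic F0 pf pg g1) => N gN.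
have Nu : N *m (pid_mx (k + 2) : 'M_(n, k + 2)) \in unitmx by rewrite unitmxE unitfE.
have NT := mulmxV Nu; rewrite -mulmxA in NT.
have [x0 _] := sigma2_generic p NT.
by apply: (HS (point x0)) (memv_line _); apply: (sigma2_generic _ NT).2.
Qed.

End DistanceTwoClosure.

(** * Normal form of the points at distance two *)

Section SigmaTwoNormalForm.
Variables (F : fieldType) (F0 : [pchar F] =i pred0) (V : vectType F) (k : nat).
Local Open Scope classical_set_scope.
Local Notation n := (\dim {:V}).
Local Notation C := 'cV[F]_n.
Local Notation W := (extpow V k).
Hypothesis k0 : (0 < k)%N.
Variables (i0 i1 : 'I_k).
Hypotheses (i0E : i0 = 0%N :> nat) (i1E : i1 = 1%N :> nat).

Lemma ev_neq0 (x : W) : x != 0 -> exists Y, ev x Y != 0.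
Proof.
move=> x0; apply: contrapT => /forallNP H; case/eqP: x0; apply: ev_inj => Y.
by rewrite ev0; apply/eqP/negPn/negP/H.
Qed.

Lemma common_frame (x y z : W) : x != 0 -> y != 0 -> z != 0 ->
  exists Y, [/\ ev x Y != 0, ev y Y != 0 & ev z Y != 0].
Proof.
pose e (x : W) (Y : 'M[F]_(n, k)) := ev x (fun j => col j Y).
have eP u : u != 0 -> exists Y, e u Y != 0.
  move=> /ev_neq0[Y Y0]; exists (\matrix_(i, j) Y j i 0).
  rewrite /e (_ : (fun j => _) = Y) //; apply/funext=> j; apply/colP=> i.
  by rewrite !mxE.
have pe u : pfun (e u).
  apply: pfun_ev => [|j r]; first exact: pmapC.
  by apply: (@pfun_linear _ 'M[F]_(n, k)) => a v w; rewrite !mxE.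
move=> /eP[Yx ex] /eP[Yy ey] /eP[Yz ez].
have [s [es1 es2]] := pfun_generic F0 (pe x) (pe y) ex ey.
set Y' := _ + _ in es1 es2.
have [t [et1 et2]] := pfun_generic F0 (pfunM (pe x) (pe y)) (pe z) (mulf_neq0 es1 es2) ez.
by move: et1; rewrite mulf_eq0 negb_or => /andP[et0 et1]; eexists; split; eassumption.
Qed.

Lemma rank1_factor m q (D : 'M[F]_(m, q)) :
  (forall i j (u v : 'cV_q), i != j -> (D *m u) i 0 * (D *m v) j 0 - (D *m u) j 0 * (D *m v) i 0 = 0) ->
  exists (c : 'cV_m) (r : 'rV_q), D = c *m r.
Proof.
move=> minors; have [->|/matrix0Pn[i [j Dij]]] := eqVneq D 0.
  by exists 0, 0; rewrite mul0mx.
have E a b : D a b = (D *m (delta_mx b 0 : 'cV_q)) a 0 by rewrite -colE mxE.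
exists ((D i j)^-1 *: col j D), (row i D); apply/matrixP=> a b.
rewrite mxE big_ord1 !mxE; have [->|ai] := eqVneq a i; first by rewrite mulVf ?mul1r.
apply: (mulfI Dij); rewrite !mulrA divff // mul1r.
have := minors i a (delta_mx j 0) (delta_mx b 0); rewrite -!E => /(_ _)/eqP.
by rewrite eq_sym ai subr_eq0 => /(_ isT)/eqP.
Qed.

Lemma rank_factor m q s (D : 'M[F]_(m, q)) : (\rank D <= s)%N ->
  exists (c : 'M_(m, s)) (r : 'M_(s, q)), D = c *m r.
Proof.
move=> Ds; exists (col_ebase D *m pid_mx (\rank D)), (pid_mx (\rank D) *m row_ebase D).
rewrite mulmxA -[_ *m pid_mx _ *m pid_mx _]mulmxA mul_pid_mx minnn (minn_idPr Ds).
by rewrite mulmx_ebase.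
Qed.

Lemma clear_rows s (c : 'M[F]_(k, s)) : exists2 G, G \in unitmx &
  forall l : 'I_k, (s <= l)%N -> row l (G *m c) = 0.
Proof.
exists (invmx (col_ebase c)) => [|l sl]; first by rewrite unitmx_inv col_ebase_unit.
rewrite -{2}[c]mulmx_ebase !mulmxA mulVmx ?col_ebase_unit // mul1mx row_mul.
rewrite (_ : row l _ = 0) ?mul0mx //; apply/rowP=> j; rewrite !mxE.
by rewrite (gtn_eqF (leq_trans (ltn_ord j) sl)).
Qed.

(** The sum of the two wedges lies on the line, so it is decomposable and its [c2] vanish; these are
    the 2-minors of A - B. *)
Lemma line_minors (p q : proj W) (A B : 'M[F]_(k, n)) Z : dual_to A Z -> dual_to B Z ->
  val p = <[wdg A]>%VS -> val q = <[wdg B]>%VS -> span2 p q `<=` Gr V k ->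
  exists (c : 'cV_k) (r : 'rV_n), A - B = c *m r.
Proof.
move=> dA dB pE qE pqG; apply: rank1_factor => i j u v ij.
have AB0 := dual_sum_neq0 F0 dA dB.
have : Gr V k (point AB0) by apply: pqG; rewrite /span2 /= -memvE pE qE memv_add // memv_line.
move=> /GrP[D _ E]; have := memv_line (wdg A + wdg B).
rewrite -(pointE AB0) E => /vlineP[a]; have [D' ->] := wdg_scale k0 a D => E'.
rewrite -[LHS]mul1r -(mul1r 1) -(c2_dual 1 1 u v ij dA dB) !scale1r E'.
apply: wdg_c2 => //; rewrite -E' evD (ev_frame dA) (ev_frame dB).
exact: (natr_char0_neq0 F0 (isT : 2%N != 0%N)).
Qed.

Lemma rank1_line_path (p q : proj W) (A B : 'M[F]_(k, n)) (c : 'cV_k) (r : 'rV_n) :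
  wdg A != 0 -> wdg B != 0 -> val p = <[wdg A]>%VS -> val q = <[wdg B]>%VS ->
  A - B = c *m r -> line_path 1 p q.
Proof.
move=> A0 B0 pE qE ABE; have [G Gu Gc] := clear_rows c.
have G0 : \det G != 0 by rewrite -unitfE -unitmxE.
have GE D (D0 : wdg D != 0) (x : proj W) : val x = <[wdg D]>%VS -> val x = <[wdg (G *m D)]>%VS.
  move=> xE; apply: val_point; first by rewrite wdg_mul scaler_eq0 negb_or G0.
  by rewrite xE wdg_mul memvZ // memv_line.
have GB : G *m B = set_row (G *m A) i0 (row i0 (G *m B)).
  apply/matrixP=> l j; rewrite [RHS]mxE; case: (eqVneq l i0) => [->|l0]; first by rewrite [RHS]mxE.
  have -> : B = A - c *m r by rewrite -ABE subKr.
  rewrite mulmxBr mulmxA [LHS]mxE [X in _ + X]mxE.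
  have /(congr1 (fun x : 'rV_1 => x *m r)) : row l (G *m c) = 0.
    by apply: Gc; rewrite lt0n; apply: contraNneq l0 => lE; apply/eqP/val_inj; rewrite /= lE i0E.
  by rewrite mul0mx -row_mul => /rowP/(_ j); rewrite mxE => ->; rewrite !mxE subr0.
exists (fun i => if i == 0%N then p else q); split=> // [i _|[|//] _ /=].
  by case: ifP => _; apply/GrP; [exists A|exists B].
apply: (@line_in_Gr F V k (G *m A) i0 (row i0 (G *m A)) (row i0 (G *m B))).
  by rewrite set_row_id; apply: GE.
by rewrite -GB; apply: GE.
Qed.

(** Each step of a path of length two changes a matrix dual to a common frame by rank at most 1, so
    row operations leave A and B different in two rows only. *)
Lemma sigma2_normal p : Sigma2 V k p -> exists N T, N *m T = 1%:M /\
  val p = <[wdg (usubmx N) + wdg (swap_rows i0 i1 N)]>%VS.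
Proof.
have i01 : i0 != i1 by apply/eqP => /(congr1 val) /=; rewrite i0E i1E.
move=> [u [v [x [y [[u0 v0] [_ _] [xE yE] [[c [c0 c2 cG cl]] dmin] pE]]]]].
have [/GrP[A0 A00 A0E] /GrP[M0 M00 M0E] /GrP[B0 B00 B0E]] := And3 (cG 0%N isT) (cG 1%N isT) (cG 2%N isT).
have [Z [AZ MZ BZ]] := common_frame A00 M00 B00.
have [[A dA AE] [M dM ME] [B dB BE]] := And3 (dual_normalize AZ) (dual_normalize MZ) (dual_normalize BZ).
have lineZ a (w : W) : a != 0 -> <[a *: w]>%VS = <[w]>%VS.
  move=> a0; apply/eqP; rewrite eqEsubv -!memvE memvZ ?memv_line //=.
  by apply/vlineP; exists a^-1; rewrite scalerA mulVf ?scale1r.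
have nz D : dual_to D Z -> wdg D != 0.
  move=> dD; apply/eqP=> D0; have := ev_frame dD; rewrite D0 ev0 => /eqP.
  by rewrite eq_sym oner_eq0.
rewrite AE lineZ // in A0E; rewrite ME lineZ // in M0E; rewrite BE lineZ // in B0E.
have [c1 [r1 D1]] := line_minors dA dM A0E M0E (cl 0%N isT).
have [c3 [r3 D3]] := line_minors dM dB M0E B0E (cl 1%N isT).
have D : A - B = row_mx c1 c3 *m col_mx r1 r3 by rewrite mul_row_col -D1 -D3 addrA subrK.
have [G Gu Gc] := clear_rows (row_mx c1 c3).
pose A' := G *m A; pose B' := G *m B.
have G0 : \det G != 0 by rewrite -unitfE -unitmxE.
have wA : wdg A' = \det G *: wdg A by rewrite wdg_mul.
have wB : wdg B' = \det G *: wdg B by rewrite wdg_mul.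
have AB' l : l != i0 -> l != i1 -> row l A' = row l B'.
  move=> l0 l1; apply/eqP; rewrite -subr_eq0 -linearB /= -mulmxBr D mulmxA row_mul Gc ?mul0mx //.
  by rewrite leqNgt; apply/negP; case E: (val l) => [|[|m]] //= _;
    [move/eqP: l0|move/eqP: l1]; apply; apply/val_inj; rewrite /= E ?i0E ?i1E.
pose sel (E : 'M[F]_(k, n)) := col_mx (row i0 E) (row i1 E).
pose S : 'M[F]_(1 + 1, k) := col_mx (row i0 1%:M) (row i1 1%:M).
have selE E : sel E = S *m E by rewrite mul_col_mx -!row_mul !mul1mx.
(* If the difference had rank at most 1, a path of length 1 would join the two points. *)
have frD : row_free (sel (A' - B')).
  rewrite /row_free eqn_leq rank_leq_row /= leqNgt ltnS; apply/negP => rk.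
  have rk1 : (\rank (A' - B')%R <= 1)%N.
    apply: leq_trans rk; apply: mxrankS; apply/row_subP => l.
    have [->|l0] := eqVneq l i0.
      rewrite (_ : row i0 _ = row (lshift 1 0) (sel (A' - B'))) ?row_sub //.
      by rewrite rowKu; apply/rowP=> j; rewrite !mxE.
    have [->|l1] := eqVneq l i1.
      rewrite (_ : row i1 _ = row (rshift 1 0) (sel (A' - B'))) ?row_sub //.
      by rewrite rowKd; apply/rowP=> j; rewrite !mxE.
    by rewrite linearB /= AB' // subrr sub0mx.
  have [c' [r' E]] := rank_factor rk1.
  have [wA0 wB0] : wdg A' != 0 /\ wdg B' != 0.
    by rewrite wA wB !scaler_eq0 !negb_or G0 !nz.
  have := dmin 1%N; rewrite ltnn => H; suff : false by []; apply: H; rewrite -c0 -c2.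
  by apply: rank1_line_path wA0 wB0 _ _ E; rewrite ?wA ?wB lineZ.
have [a aE] : exists a, u = a *: wdg A'.
  have := memv_line u; rewrite -xE -c0 A0E -(lineZ _ (wdg A) G0) -wA => /vlineP[a ->].
  by exists a.
have [b bE] : exists b, v = b *: wdg B'.
  have := memv_line v; rewrite -yE -c2 B0E -(lineZ _ (wdg B) G0) -wB => /vlineP[b ->].
  by exists b.
have a0 : a != 0 by apply: contraNneq u0 => a0; rewrite aE a0 scale0r.
have b0 : b != 0 by apply: contraNneq v0 => b0; rewrite bE b0 scale0r.
(* Scaling the row i0 absorbs the coefficients of u and v into the matrices. *)
pose sc (a : F) : 'M[F]_k := diag_mx (\row_l if l == i0 then a else 1).
have scE d (E : 'M[F]_(k, n)) l : row l (sc d *m E) = (if l == i0 then d else 1) *: row l E.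
  by apply/rowP=> j; rewrite mul_diag_mx !mxE.
have scdet d : \det (sc d) = d.
  by rewrite det_diag (bigD1 i0) //= big1 => [|l l0]; rewrite mxE ?eqxx ?mulr1 // (negPf l0).
pose A1 := sc a *m A'; pose B1 := sc b *m B'.
have AB1 l : l != i0 -> l != i1 -> row l A1 = row l B1.
  by move=> l0 l1; rewrite !scE (negPf l0) AB'.
pose N : 'M[F]_(k + 2, n) := col_mx A1 (sel B1).
have NB : swap_rows i0 i1 N = B1 by apply: swap_rows_col_mx.
have NA : usubmx N = A1 by apply: col_mxKu.
suff /row_freeP[T NT] : row_free N.
  exists N, T; split=> //; rewrite NA NB (wdg_mul (sc a)) (wdg_mul (sc b)) !scdet.
  by rewrite -aE -bE.
pose Z' := \matrix_(i, j) Z j i 0 *m invmx G.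
have dZ E : dual_to E Z -> G *m E *m Z' = 1%:M.
  move=> dE; rewrite /Z' mulmxA -[G *m E *m _]mulmxA (_ : E *m _ = 1%:M) ?mulmx1 ?mulmxV //.
  apply/matrixP=> i j; have /colP/(_ i) := dE j; rewrite !mxE => <-.
  by apply: eq_bigr => m _; rewrite !mxE.
have [hA' hB'] : A' *m Z' = 1%:M /\ B' *m Z' = 1%:M by rewrite !dZ.
clearbody A' B'.
have kill (z : 'rV_(1 + 1)) : z *m sel (sc b *m (A' - B')) = 0 -> z = 0.
  rewrite /sel !scE eqxx [i1 == _]eq_sym (negPf i01) scale1r -{1}[z]hsubmxK mul_row_col.
  rewrite -scalemxAr scalemxAl -mul_row_col => /eqP.
  rewrite mulmx_free_eq0 // -row_mx0 => /eqP/eq_row_mx[/eqP + z2].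
  rewrite scaler_eq0 (negPf b0) /= => /eqP z1.
  by rewrite -[z]hsubmxK z1 z2 row_mx0.
apply: inj_row_free => y0; rewrite -[y0]hsubmxK mul_row_col.
pose yl := lsubmx y0; pose z : 'rV[F]_(1 + 1) := rsubmx y0 => E0.
have {E0}E : yl *m A1 + z *m sel B1 = 0 := E0.
suff [y1 y2] : lsubmx y0 = 0 /\ rsubmx y0 = 0 by rewrite y1 y2 row_mx0.
(* [Z'] is a right inverse of both A' and B'. Testing the relation against it and substituting the
   result isolates A' - B', whose two nonzero rows are independent. *)
have E1 : yl *m sc a + z *m S *m sc b = 0.
  have hA : A1 *m Z' = sc a by rewrite -mulmxA hA' mulmx1.
  have hB : B1 *m Z' = sc b by rewrite -mulmxA hB' mulmx1.
  have := congr1 (fun X => X *m Z') E; rewrite /= mulmxDl mul0mx -mulmxA hA selE.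
  by rewrite -[z *m _ *m Z']mulmxA -[S *m _ *m Z']mulmxA hB mulmxA.
have E2 : z *m sel (sc b *m (A' - B')) = 0.
  have H : z *m S *m sc b *m A' = z *m sel B1.
    by apply: (addrI (yl *m A1)); rewrite E {1}/A1 mulmxA -mulmxDl E1 mul0mx.
  by rewrite selE !mulmxBr !mulmxA H selE /B1 !mulmxA subrr.
have z0 := kill z E2.
split; last exact: z0.
move: E1; rewrite z0 !mul0mx addr0 => /(congr1 (fun X => X *m invmx (sc a))).
by rewrite mul0mx mulmxK ?unitmxE ?scdet ?unitfE.
Qed.

End SigmaTwoNormalForm.

(** * Tangent spaces at points of distance two *)

Section DualFamily.
Variables (F : fieldType) (W : vectType F).

Lemma dual_family_dim (J : finType) (D : {set J}) (f : J -> W) (phi : J -> W -> F) (U : {vspace W}) :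
  (forall i, i \in D -> f i \in U) ->
  (forall i a u v, phi i (a *: u + v) = a * phi i u + phi i v) ->
  (forall i, i \in D -> phi i (f i) != 0) ->
  (forall i j, i \in D -> j \in D -> i != j -> phi i (f j) = 0) -> (#|D| <= \dim U)%N.
Proof.
move=> fU phiL phi1 phi0; pose X := [tuple f (enum_val i) | i < #|D|].
have XU : (<<X>> <= U)%VS.
  by apply/span_subvP => _ /mapP[i _ ->]; apply/fU/enum_valP.
have fX : free X.
  apply/freeP => c c0 i; have iD := enum_valP i.
  have := congr1 (phi (enum_val i)) c0; rewrite (lin0 (phiL _)) (lin_sum (phiL _)).
  rewrite (bigD1 i) //= big1 => [|j ji]; last first.
    rewrite (nth_map i) ?size_enum_ord // nth_ord_enum (linZ (phiL _)).
    rewrite phi0 ?mulr0 ?enum_valP //.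
    by rewrite (inj_eq enum_val_inj) eq_sym.
  rewrite (nth_map i) ?size_enum_ord // nth_ord_enum (linZ (phiL _)) addr0 => /eqP.
  by rewrite mulf_eq0 (negPf (phi1 _ iD)) orbF => /eqP.
by rewrite -(size_tuple X) -(eqnP fX) dimvS.
Qed.

End DualFamily.

Section SlotFamilies.
Variables (F : fieldType) (V : vectType F) (a b : nat).
Local Notation n := (\dim {:V}).
Local Notation k := (2 + a)%N.
Local Notation W := (extpow V k).

Definition tup (X : Type) (x y : X) (g : 'I_a -> X) (i : 'I_k) : X :=
  match split i with inl i' => if i' == 0 then x else y | inr l => g l end.

Definition rowsmx (f : 'I_k -> 'rV[F]_n) : 'M[F]_(k, n) := \matrix_(i, j) f i 0 j.

Local Notation P := ('I_2 + 'I_2)%type.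
Local Notation T := (P + 'I_a + 'I_b)%type.
Definition slotP (t : P) : T := inl (inl t).
Definition slotL (l : 'I_a) : T := inl (inr l).
Definition slotR (r : 'I_b) : T := inr r.

Definition patch (l : 'I_a) (X : Type) (w : X) (g : 'I_a -> X) := fun l' => if l' == l then w else g l'.

Variables (E : T -> 'rV[F]_n) (Ed : T -> 'cV[F]_n) (U : {vspace W}).
Hypothesis EEd : forall s t, (E s *m Ed t) 0 0 = (s == t)%:R.
Hypothesis U1 : forall t w, wdg (rowsmx (tup (E (slotP t)) w (E \o slotL))) \in U.
Hypothesis U2 : forall s t l w, s != t ->
  wdg (rowsmx (tup (E (slotP s)) (E (slotP t)) (patch l w (E \o slotL)))) \in U.

Lemma tup_inj (X : eqType) (x y : X) g : x != y -> injective g ->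
  (forall l, g l != x) -> (forall l, g l != y) -> injective (tup x y g).
Proof.
move=> xy gi gx gy i j; rewrite /tup -[i]splitK -[j]splitK !unsplitK.
case: (split i) (split j) => [i'|l] [j'|m].
- case: (eqVneq i' 0) (eqVneq j' 0) => [->|i0] [->|j0] // /eqP; rewrite ?(negPf xy) 1?eq_sym ?(negPf xy) //.
  by move=> _; congr (unsplit (inl _)); case: i' i0 => [[|[|]]] //= ? _; case: j' j0 => [[|[|]]] //= ? _; apply/val_inj.
- by case: (i' == 0) => /esym/eqP; rewrite ?(negPf (gx _)) ?(negPf (gy _)).
- by case: (j' == 0) => /eqP; rewrite ?(negPf (gx _)) ?(negPf (gy _)).
- by move/gi->.
Qed.

Lemma tup_comp (X Y : Type) (h : X -> Y) x y g i : h (tup x y g i) = tup (h x) (h y) (h \o g) i.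
Proof. by rewrite /tup; case: (split i) => // i'; case: ifP. Qed.

Lemma tup_imageP (X : eqType) (x y : X) g z :
  reflect (exists i, z = tup x y g i) [|| z == x, z == y | [exists l, z == g l]].
Proof.
apply: (iffP or3P) => [[/eqP->|/eqP->|/existsP[l /eqP->]]|[i ->]].
- by exists (unsplit (inl 0)); rewrite /tup unsplitK.
- by exists (unsplit (inl 1)); rewrite /tup unsplitK.
- by exists (unsplit (inr l)); rewrite /tup unsplitK.
rewrite /tup; case: (split i) => [i'|l].
  by case: ifP => _; [apply: Or31|apply: Or32].
by apply: Or33; apply/existsP; exists l.
Qed.

Local Notation J := ({set P} * {set 'I_a} * {set 'I_b})%type.
(** A wedge of basis vectors is indexed by the slots of P and R that it uses and by the slots of L
    that it omits, so the sets remain small. *)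
Definition slots (d : J) : {set T} :=
  [set t | match t with inl (inl t) => t \in d.1.1 | inl (inr l) => l \notin d.1.2 | inr r => r \in d.2 end].
Definition cards (p q r : nat) : {set J} :=
  finset.setX (finset.setX [set A : {set P} | #|A| == p] [set A : {set 'I_a} | #|A| == q])
    [set A : {set 'I_b} | #|A| == r].

Lemma slots_inj : injective slots.
Proof.
move=> [[A B] D] [[A' B'] D'] /setP S; congr (_, _, _); apply/setP=> t.
- by have := S (slotP t); rewrite !inE.
- by have := S (slotL t); rewrite !inE /= => /negb_inj.
- by have := S (slotR t); rewrite !inE.
Qed.

Definition good (d : J) (c : 'I_k -> T) :=
  [/\ injective c, slots d = [set c i | i : 'I_k] & wdg (rowsmx (E \o c)) \in U].

Lemma good_tup d x y g : x != y -> injective g -> (forall l, g l != x) -> (forall l, g l != y) ->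
  (forall t, (t \in slots d) = [|| t == x, t == y | [exists l, t == g l]]) ->
  wdg (rowsmx (tup (E x) (E y) (E \o g))) \in U -> exists c, good d c.
Proof.
move=> xy gi gx gy S Uc; exists (tup x y g); split; first exact: tup_inj.
  apply/setP=> t; rewrite S; apply/idP/imsetP => [/tup_imageP[i ->]|[i _ ->]].
    by exists i.
  by apply/tup_imageP; exists i.
rewrite (_ : E \o _ = tup (E x) (E y) (E \o g)) //; apply/funext=> i.
exact: tup_comp.
Qed.

Lemma slotL_inj : injective slotL.
Proof. by move=> l m [->]. Qed.

Lemma slotL_image (t : T) : [exists l, t == slotL l] = if t is inl (inr _) then true else false.
Proof.
case: t => [[t|l]|r].
- by apply/existsP => -[].
- by apply/existsP; exists l.
- by apply/existsP => -[].
Qed.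

Lemma patch_image l w (t : T) : [exists m, t == patch l w slotL m] =
  (t == w) || (if t is inl (inr m) then m != l else false).
Proof.
apply/existsP/orP => [[m]|[/eqP->|]].
- rewrite /patch; case: (eqVneq m l) => [_ /eqP->|ml /eqP->]; first by left.
  by right.
- by exists l; rewrite /patch eqxx.
- by case: t => [[t|m]|r] // ml; exists m; rewrite /patch (negPf ml).
Qed.

Lemma patch_inj l w : (forall m, w != slotL m) -> injective (patch l w slotL).
Proof.
move=> wL m m'; rewrite /patch; case: (eqVneq m l) => [->|_]; case: (eqVneq m' l) => [->|_] //.
- by move/eqP; rewrite (negPf (wL _)).
- by move/esym/eqP; rewrite (negPf (wL _)).
- exact: slotL_inj.
Qed.

Lemma patch_comp l w : E \o patch l w slotL = patch l (E w) (E \o slotL).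
Proof. by apply/funext=> m; rewrite /patch /=; case: eqP. Qed.

Lemma patch_neq l w (x : T) : w != x -> (forall m, slotL m != x) -> forall m, patch l w slotL m != x.
Proof. by move=> wx Lx m; rewrite /patch; case: (m == l). Qed.

Lemma sumE :
  ((forall s t : P, (slotP s == slotP t) = (s == t)) * (forall l m, (slotL l == slotL m) = (l == m)) *
   (forall r s, (slotR r == slotR s) = (r == s)) *
   (forall t l, (slotP t == slotL l) = false) * (forall t r, (slotP t == slotR r) = false) *
   (forall t l, (slotL l == slotP t) = false) * (forall t r, (slotR r == slotP t) = false) *
   (forall l r, (slotL l == slotR r) = false) * (forall l r, (slotR r == slotL l) = false))%type.
Proof. by []. Qed.

(** The families have 6, 4b, 4a and 6ab members. [U1] covers the first two; in the other two a
    vector of L is replaced by one of P or R, as [U2] allows. *)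
Lemma good_cards d : d \in cards 2 0 0 :|: cards 1 0 1 :|: cards 3 1 0 :|: cards 2 1 1 ->
  exists c, good d c.
Proof.
case: d => -[A B] D; rewrite !inE /= !cards_eq0.
case/orP => [/orP[/orP[]|]|] /andP[/andP[cA cB] cD].
- have /cards2P[s [t [st AE]]] := cA; rewrite (eqP cB) (eqP cD).
  apply: (@good_tup _ (slotP s) (slotP t) slotL) => //.
  + exact: slotL_inj.
  + by move=> u; rewrite slotL_image !inE AE; case: u => [[u|l]|r]; rewrite ?inE ?orbT ?orbF.
- have [/cards1P[t AE] /cards1P[r DE]] := (cA, cD); rewrite (eqP cB).
  apply: (@good_tup _ (slotP t) (slotR r) slotL) => //.
  + exact: slotL_inj.
  + by move=> u; rewrite slotL_image !inE AE DE; case: u => [[u|l]|x]; rewrite ?inE ?orbT ?orbF.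
- have /cards1P[l BE] := cB; rewrite (eqP cD).
  have [s sA] : exists s, s \in A by apply/set0Pn; rewrite -card_gt0 (eqP cA).
  have : #|A :\ s| == 2 by have := cardsD1 s A; rewrite sA (eqP cA) => /eqP; rewrite eqSS eq_sym.
  move=> /cards2P[t [z [tz AE]]].
  have [tA zA] : t \in A :\ s /\ z \in A :\ s by rewrite AE !inE !eqxx orbT.
  have [ts zs] : t != s /\ z != s by move: tA zA; rewrite !inE => /andP[-> _] /andP[-> _].
  apply: (@good_tup _ (slotP s) (slotP t) (patch l (slotP z) slotL)).
  + by rewrite sumE eq_sym.
  + exact: patch_inj.
  + by apply: patch_neq => //; rewrite sumE.
  + by apply: patch_neq => //; rewrite sumE eq_sym.
  + move=> u; rewrite patch_image !inE (_ : A = s |: [set t; z]) ?BE; last by rewrite -AE finset.setD1K.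
    by case: u => [[u|m]|r]; rewrite ?inE ?sumE ?orbF.
  + by rewrite patch_comp; apply: U2; rewrite eq_sym.
- have [/cards2P[s [t [st AE]]] /cards1P[l BE] /cards1P[r DE]] := And3 cA cB cD.
  apply: (@good_tup _ (slotP s) (slotP t) (patch l (slotR r) slotL)).
  + by rewrite sumE.
  + exact: patch_inj.
  + exact: patch_neq.
  + exact: patch_neq.
  + by move=> u; rewrite patch_image !inE AE BE DE; case: u => [[u|m]|x]; rewrite ?inE ?orbF.
  + by rewrite patch_comp; apply: U2.
Qed.

Lemma good_ev d c d' c' : good d c -> good d' c' -> ev (wdg (rowsmx (E \o c))) (Ed \o c') =
  \det (\matrix_(i, j) (c i == c' j)%:R).
Proof.
move=> _ _; rewrite ev_wdg; congr (\det _); apply/matrixP=> i j; rewrite [LHS]mxE [RHS]mxE -EEd !mxE.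
by apply: eq_bigr => m _; rewrite mxE.
Qed.

(** Evaluation on the dual vectors separates the wedges: for two different sets of slots the
    incidence matrix has a zero row. *)
Lemma tangent_dim : (6 + 4 * b + 4 * a + 6 * a * b <= \dim U)%N.
Proof.
pose D := cards 2 0 0 :|: cards 1 0 1 :|: cards 3 1 0 :|: cards 2 1 1.
have /choice[c cP] : forall d : J, exists c : 'I_k -> T, d \in D -> good d c.
  move=> d; have [dD|dD] := boolP (d \in D); last by exists (fun=> slotP (inl 0)).
  by have [c cP] := good_cards dD; exists c.
have cardD : #|D| = (6 + 4 * b + 4 * a + 6 * a * b)%N.
  have cc p q r : #|cards p q r| = ('C(4, p) * 'C(a, q) * 'C(b, r))%N.
    by rewrite !cardsX !card_draws card_sum !card_ord.
  have dis p q r p' q' r' : (q != q') || (r != r') -> cards p q r :&: cards p' q' r' = finset.set0.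
    move=> H; apply/setP=> d; rewrite !inE; apply/negbTE/negP.
    case/andP => /andP[/andP[_ /eqP E1] /eqP E2] /andP[/andP[_ /eqP E3] /eqP E4].
    by move: H; rewrite -E1 -E2 -E3 -E4 !eqxx.
  rewrite !cardsU !finset.setIUl !dis // !finset.setU0 cards0 !subn0 !cc.
  by rewrite !bin0 !bin1 !muln1.
rewrite -cardD; apply: (@dual_family_dim F W J D (fun d => wdg (rowsmx (E \o c d)))
  (fun d x => ev x (Ed \o c d))) => [d /cP[]//|d x u v|d dD|d d' dD dD' dd'].
- exact: ev_linear.
- rewrite (good_ev (cP d dD) (cP d dD)) (_ : \matrix_(_, _) _ = 1%:M) ?det1 ?oner_eq0 //.
  have [ci _ _] := cP d dD; apply/matrixP=> i j; by rewrite !mxE (inj_eq ci).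
have [[ci cE _] [ci' cE' _]] := (cP d dD, cP d' dD').
rewrite (good_ev (cP d' dD') (cP d dD)).
have [t] : exists2 t, t \in slots d' & t \notin slots d.
  apply/subsetPn; apply: contraNN dd' => sub; apply/eqP/slots_inj/esym/eqP.
  by rewrite eqEcard sub cE cE' (card_imset _ ci) (card_imset _ ci') leqnn.
rewrite cE' => /imsetP[i _ ->] ti; rewrite (expand_det_row _ i) big1 // => j _.
rewrite mxE (_ : (_ == _) = false) ?mul0r //; apply: contraNF ti => /eqP->.
by rewrite cE; apply/imsetP; exists j.
Qed.

End SlotFamilies.

Section SecantSlots.
Variables (F : fieldType) (F0 : [pchar F] =i pred0) (V : vectType F) (a : nat).
Local Notation n := (\dim {:V}).
Local Notation k := (2 + a)%N.
Local Notation W := (extpow V k).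
Local Notation sigma := (secant_variety (Gr V k)).
Hypothesis kn : (k <= n)%N.
Local Notation i0 := (lshift a (0 : 'I_2)).
Local Notation i1 := (lshift a (1 : 'I_2)).
Implicit Types (x y z w : 'rV[F]_n) (g : 'I_a -> 'rV[F]_n).

Definition tupw x y g : W := wdg (rowsmx (tup x y g)).

Lemma set_row_tup0 x y g z : set_row (rowsmx (tup x y g)) i0 z = rowsmx (tup z y g).
Proof.
apply/matrixP=> i j; rewrite !mxE /tup -[i]splitK unsplitK.
by case: (split i) => [i'|l] /=; rewrite ?eq_lshift ?eq_rlshift //; case: (i' == 0).
Qed.

Lemma set_row_tup1 x y g z : set_row (rowsmx (tup x y g)) i1 z = rowsmx (tup x z g).
Proof.
apply/matrixP=> i j; rewrite !mxE /tup -[i]splitK unsplitK.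
case: (split i) => [i'|l] /=; rewrite ?eq_lshift ?eq_rlshift //.
by case: i' => [[|[|]]].
Qed.

Lemma set_row_patch x y g l z :
  set_row (rowsmx (tup x y g)) (rshift 2 l) z = rowsmx (tup x y (patch l z g)).
Proof.
apply/matrixP=> i j; rewrite !mxE /tup /patch -[i]splitK unsplitK.
by case: (split i) => [i'|m] /=; rewrite ?eq_lrshift ?eq_rshift //; case: (m == l).
Qed.

Lemma tupw_linear_l c x z y g : tupw (c *: x + z) y g = c *: tupw x y g + tupw z y g.
Proof. by rewrite /tupw -(set_row_tup0 x y g (_ + _)) set_row_linear !set_row_tup0. Qed.

Lemma tupw_linear_r c x z y g : tupw y (c *: x + z) g = c *: tupw y x g + tupw y z g.
Proof. by rewrite /tupw -(set_row_tup1 y x g (_ + _)) set_row_linear !set_row_tup1. Qed.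

Lemma tupwxx x g : tupw x x g = 0.
Proof.
have [_ A] := wedge_multilinear_alternating V k.
apply: (A _ i0 i1); first by rewrite eq_lshift.
by apply: eq_bigr => j _; rewrite !mxE /tup !(unsplitK (inl _)).
Qed.

Lemma tupwDl x z y g : tupw (x + z) y g = tupw x y g + tupw z y g.
Proof. by rewrite -{1}[x]scale1r tupw_linear_l scale1r. Qed.

Lemma tupwDr x z y g : tupw y (x + z) g = tupw y x g + tupw y z g.
Proof. by rewrite -{1}[x]scale1r tupw_linear_r scale1r. Qed.

Lemma tupwNl x y g : tupw (- x) y g = - tupw x y g.
Proof.
apply/eqP; rewrite -addr_eq0 -tupwDl addNr; apply/eqP/(addrI (tupw 0 y g)).
by rewrite -tupwDl !addr0.
Qed.

Lemma tupwC x y g : tupw x y g = - tupw y x g.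
Proof.
apply/eqP; rewrite -addr_eq0; have := tupwxx (x + y) g.
by rewrite tupwDl !tupwDr !tupwxx add0r addr0 => ->.
Qed.

Variables (p : proj W) (U : {vspace W}).
Hypothesis pU : is_affine_tangent_space sigma p U.

(** Adding multiples of w to one row of X stays among sums of two decomposable vectors, so a whole
    line lies in the cone. *)
Lemma secant_slot c (X Y : 'M[F]_(k, n)) i w : c != 0 -> rep p = c *: (wdg X + wdg Y) ->
  wdg (set_row X i w) \in U.
Proof.
move=> c0 pE; apply: (tangent_line F0 pU) => f If s.
have [Y' YE] := wdg_scale (isT : (0 < k)%N) c Y.
have [X' XE] := wdg_scale (isT : (0 < k)%N) c (set_row X i ((s / c) *: w + row i X)).
have -> : rep p + s *: wdg (set_row X i w) = wdg X' + wdg Y'.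
  rewrite -XE -YE pE set_row_linear set_row_id !scalerDr scalerA [c * _]mulrC divfK //.
  by rewrite addrC addrA.
have pf : pfun (mev f) by exists f.
exact: (proj1 (secant_cvanish F0 (isT : (0 < k)%N) kn pf) (vanishing_cvanish If)).
Qed.

Variables (c : F) (g : 'I_a -> 'rV[F]_n).
Hypothesis c0 : c != 0.
Local Notation dec x y x' y' := (rep p = c *: (tupw x y g + tupw x' y' g)).

Lemma decC x y x' y' : dec x y x' y' -> dec x' y' x y.
Proof. by rewrite addrC. Qed.

Lemma dec_turn x y x' y' : dec x y x' y' -> dec (- y) x x' y'.
Proof. by rewrite tupwNl -tupwC. Qed.

Lemma dec_slot x y x' y' l w : dec x y x' y' -> tupw x y (patch l w g) \in U.
Proof. by move=> /(secant_slot (rshift 2 l) w c0); rewrite set_row_patch. Qed.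

(* a1 ^ a2 + b1 ^ b2 = a1 ^ (a2 + b1) + b1 ^ (b2 + a1) *)
Lemma dec_cross x y x' y' l w : dec x y x' y' -> tupw x x' (patch l w g) \in U.
Proof.
move=> D; have D' : dec x (y + x') x' (y' + x).
  by rewrite D !tupwDr (tupwC x' x) addrACA subrr addr0.
have := memvB (dec_slot l w D') (dec_slot l w D).
by rewrite tupwDr addrAC subrr add0r.
Qed.

(** Writing x ^ y as (-y) ^ x in either summand lets [dec_cross] pair any vector of one summand with
    any vector of the other. *)
Lemma dec_all x y x' y' l w : dec x y x' y' ->
  [/\ tupw x x' (patch l w g) \in U, tupw x y' (patch l w g) \in U,
      tupw y x' (patch l w g) \in U & tupw y y' (patch l w g) \in U].
Proof.
move=> D; split; first exact: dec_cross D.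
- by rewrite tupwC -tupwNl; apply: dec_cross (dec_turn (decC D)).
- by rewrite -memvN -tupwNl; apply: dec_cross (dec_turn D).
by rewrite -memvN -tupwNl tupwC -tupwNl; apply: dec_cross (dec_turn (decC (dec_turn D))).
Qed.

Lemma dec_first x y x' y' w : dec x y x' y' -> tupw x w g \in U /\ tupw y w g \in U.
Proof.
move=> D; split; first by have := secant_slot i1 w c0 D; rewrite set_row_tup1.
by rewrite tupwC memvN; have := secant_slot i0 w c0 D; rewrite set_row_tup0.
Qed.

Lemma dec_tangent (e : 'I_2 + 'I_2 -> 'rV[F]_n) :
  dec (e (inl 0)) (e (inl 1)) (e (inr 0)) (e (inr 1)) ->
  (forall t w, tupw (e t) w g \in U) /\
  (forall s t l w, s != t -> tupw (e s) (e t) (patch l w g) \in U).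
Proof.
have I2 (i : 'I_2) : i = 0 \/ i = 1.
  by case: i => [[|[|//]] i]; [left|right]; apply/val_inj.
move=> D; split=> [t w|].
  have [H1 H2] := dec_first w D; have [H3 H4] := dec_first w (decC D).
  by case: t => i; case: (I2 i) => ->.
have C s t l w : tupw (e s) (e t) (patch l w g) \in U -> tupw (e t) (e s) (patch l w g) \in U.
  by rewrite tupwC memvN.
move=> s t l w; have [H1 H2 H3 H4] := dec_all l w D.
have H5 := dec_slot l w D; have H6 := dec_slot l w (decC D).
have [C1 C2 C3 C4] := And4 (C _ _ _ _ H1) (C _ _ _ _ H2) (C _ _ _ _ H3) (C _ _ _ _ H4).
have [C5 C6] := (C _ _ _ _ H5, C _ _ _ _ H6).
by case: s t => i [] j; case: (I2 i) => ->; case: (I2 j) => -> /=; rewrite ?eqxx.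
Qed.

End SecantSlots.

Section SigmaTwoTangent.
Variables (F : fieldType) (F0 : [pchar F] =i pred0) (V : vectType F) (a : nat).
Local Notation n := (\dim {:V}).
Local Notation k := (2 + a)%N.
Local Notation W := (extpow V k).
Local Notation sigma := (secant_variety (Gr V k)).
Hypothesis kn : (k <= n)%N.
Local Notation i0 := (lshift a (0 : 'I_2)).
Local Notation i1 := (lshift a (1 : 'I_2)).

Lemma extend_rows r q (N : 'M[F]_(r, q)) T : N *m T = 1%:M ->
  exists b (M : 'M_(b, q)) T', (r + b)%N = q /\ col_mx N M *m T' = 1%:M.
Proof.
move=> NT; have rN : row_free N by apply/row_freeP; exists T.
exists (\rank (N^C)%MS), (row_base (N^C)%MS).
have e : (r + \rank (N^C)%MS)%N = q.
  by rewrite mxrank_compl (eqP rN) subnKC // -(eqP rN) rank_leq_col.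
have /row_freeP[T' H] : row_free (col_mx N (row_base (N^C)%MS)).
  have full := addsmx_compl_full N; rewrite /row_full in full.
  by rewrite /row_free -addsmxE (adds_eqmx (eqmx_refl N) (eq_row_base _)) (eqP full) eq_sym e.
by exists T'.
Qed.

Variables (N : 'M[F]_(k + 2, n)) (b : nat) (M : 'M[F]_(b, n)) (T : 'M[F]_(n, k + 2 + b)).
Hypothesis NMT : col_mx N M *m T = 1%:M.
Local Notation P := ('I_2 + 'I_2)%type.
Local Notation S := (P + 'I_a + 'I_b)%type.

Let idx (t : S) : 'I_(k + 2 + b) :=
  match t with
  | inl (inl (inl i)) => lshift b (lshift 2 (lshift a i))
  | inl (inl (inr i)) => lshift b (rshift k i)
  | inl (inr l) => lshift b (lshift 2 (rshift 2 l))
  | inr r => rshift (k + 2) r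
  end.

Let E (t : S) : 'rV[F]_n := row (idx t) (col_mx N M).

Let EEd s t : (E s *m col (idx t) T) 0 0 = (s == t)%:R.
Proof.
rewrite -row_mul colE mulmxA NMT mul1mx !mxE andbT; congr (_%:R).
by case: s t => [[[i|i]|l]|r] [[[j|j]|m]|s];
  rewrite /idx ?eq_lshift ?eq_rshift ?eq_lrshift ?eq_rlshift.
Qed.

Lemma sigma2_tangent_dim p U : val p = <[wdg (usubmx N) + wdg (swap_rows i0 i1 N)]>%VS ->
  is_affine_tangent_space sigma p U -> (6 + 4 * b + 4 * a + 6 * a * b <= \dim U)%N.
Proof.
move=> pE pU; have := mem_rep p; rewrite pE => /vlineP[c cE].
have c0 : c != 0 by apply: contraTneq (rep_neq0 p) => c0; rewrite cE c0 scale0r eqxx.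
pose e t := E (inl (inl t)); pose g l := E (inl (inr l)).
have [|H1 H2] := @dec_tangent F F0 V a kn p U pU c g c0 e.
  have I2 (i : 'I_2) : i = 0 \/ i = 1 by case: i => [[|[|//]] ?]; [left|right]; apply/val_inj.
  have [e0 e1] : e (inl 0) = row (lshift 2 i0) N /\ e (inl 1) = row (lshift 2 i1) N.
    by rewrite /e /E /idx !rowKu.
  have [e2 e3] : e (inr 0) = row (rshift k 0) N /\ e (inr 1) = row (rshift k 1) N.
    by rewrite /e /E /idx !rowKu.
  have eg l : g l = row (lshift 2 (rshift 2 l)) N by rewrite /g /E /idx rowKu.
  have RE x y h i j : rowsmx (tup x y h) i j = tup x y h i 0 j :> F by rewrite mxE.
  have SE i j : swap_rows i0 i1 N i j =
      if i == i1 then N (rshift k 1) j else if i == i0 then N (rshift k 0) j else N (lshift 2 i) j.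
    by rewrite !mxE; do 2![case: ifP => _; rewrite ?mxE //].
  rewrite cE /tupw; congr (_ *: (wdg _ + wdg _)); apply/matrixP=> i j; rewrite RE ?SE.
    rewrite mxE /tup -[i]splitK unsplitK; case: (split i) => [i'|l] /=; last by rewrite eg mxE.
    by case: (I2 i') => -> /=; rewrite ?e0 ?e1 mxE.
  rewrite /tup -[i]splitK unsplitK; case: (split i) => [i'|l] /=.
    by case: (I2 i') => -> /=; rewrite ?eq_lshift /= ?e2 ?e3 mxE.
  by rewrite ?eq_rlshift /= eg mxE.
exact: (@tangent_dim F V a b E (fun t => col (idx t) T) U EEd H1 H2).
Qed.

End SigmaTwoTangent.

(** * Semicontinuity of the tangent dimension *)

Section TangentSemicontinuity.
Variables (F : fieldType) (F0 : [pchar F] =i pred0) (W : vectType F).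
Local Open Scope classical_set_scope.
Local Notation w := (\dim {:W}).
Implicit Types (X A : set (proj W)) (p q : proj W) (f : {mpoly F[w]}) (U : {vspace W}).

Definition crow (u : W) : 'rV[F]_w := \row_j coord (vbasis {:W}) j u.

Definition grad f (x : W) : 'rV[F]_w := \row_i mev (f^`M(i)) x.

Lemma dmev_grad f x v : dmev f x v = (grad f x *m (crow v)^T) 0 0.
Proof. by rewrite mxE; apply: eq_bigr => i _; rewrite !mxE. Qed.

Lemma crow_vec (c : 'rV[F]_w) : crow (\sum_j c 0 j *: (vbasis {:W})`_j) = c.
Proof. by apply/rowP=> j; rewrite mxE coord_sum_free // (basis_free (vbasisP _)). Qed.

Lemma crow_linear a u v : crow (a *: u + v) = a *: crow u + crow v.
Proof. by apply/rowP=> j; rewrite !mxE linearP. Qed.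

Lemma dim_ge_rows s (M : 'M[F]_(s, w)) U : row_free M ->
  (forall i v, crow v = row i M -> v \in U) -> (s <= \dim U)%N.
Proof.
move=> /row_freeP[D MD] MU; pose f i : W := \sum_j M i j *: (vbasis {:W})`_j.
have fE i : crow (f i) = row i M by rewrite -[RHS]crow_vec; congr crow; apply: eq_bigr => j _; rewrite mxE.
rewrite -[s]card_ord -cardsT.
apply: (@dual_family_dim F W 'I_s [set: 'I_s]%SET f (fun i u => (crow u *m D) 0 i)) => [i _|i a u v|i _|i j _ _ ij].
- exact: (MU i).
- by rewrite crow_linear mulmxDl -scalemxAl !mxE.
- by rewrite fE -row_mul MD !mxE eqxx oner_eq0.
- by rewrite fE -row_mul MD !mxE eq_sym (negPf ij).
Qed.

Lemma dim_le_rank r (G : 'M[F]_(r, w)) U :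
  (forall v, v \in U -> G *m (crow v)^T = 0) -> (\rank G + \dim U <= w)%N.
Proof.
move=> GU; pose M : 'M[F]_(\dim U, w) := \matrix_(i, j) crow (vbasis U)`_i 0 j.
have rM : row_free M.
  apply: inj_row_free => c cM; apply/rowP=> i; rewrite mxE.
  have /freeP := basis_free (vbasisP U); apply.
  have E : crow (\sum_(i < \dim U) c 0 i *: (vbasis U)`_i) = 0.
    rewrite -cM; apply/rowP=> j; rewrite !mxE linear_sum; apply: eq_bigr => l _.
    by rewrite !mxE linearZ.
  set u := \sum_(i < _) _ in E *; rewrite (coord_sum u) big1 // => j _.
  by have /rowP/(_ j) := E; rewrite !mxE => ->; rewrite scale0r.
rewrite -{1}(eqP rM) -[\rank M]mxrank_tr; apply: mulmx0_rank_max.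
apply/matrixP=> a i; rewrite [RHS]mxE.
have /colP/(_ a) : G *m (crow (vbasis U)`_i)^T = 0.
  by apply: GU; rewrite vbasis_mem ?mem_nth ?size_tuple.
rewrite [X in _ = X]mxE => H; rewrite -[RHS]H [LHS]mxE [RHS]mxE.
by apply: eq_bigr => j _; rewrite !mxE.
Qed.

Lemma dmev_scale d f s x v : f \is d.-homog -> s != 0 -> dmev f (s *: x) v = s ^+ d / s * dmev f x v.
Proof.
move=> fd s0; rewrite -!deriv_pline.
have -> : pline f (s *: x) v = s ^+ d *: (pline f x v \Po (s^-1 *: 'X)).
  apply/eqP; rewrite -subr_eq0; apply/eqP/(poly_eq0 F0) => t.
  rewrite !(hornerE, horner_comp) !horner_pline -(mev_homog _ _ fd) scalerDr scalerA.
  by rewrite mulrA mulfV // mul1r subrr.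
rewrite derivZ deriv_comp derivZ derivX hornerZ hornerM horner_comp !hornerE.
by rewrite [LHS]mulr1; apply: mulrAC.
Qed.

Lemma tangent_scale X q U f v s : is_affine_tangent_space X q U -> vanishing_ideal X f ->
  s != 0 -> v \in U -> dmev f (s *: rep q) v = 0.
Proof.
move=> XU If s0 /XU/(_ f If) E; have [[d fd] _] := If.
by rewrite (dmev_scale _ _ fd s0) /dmev E mulr0.
Qed.

(** A maximal independent family of gradients at p spans them all, so its common kernel lies in the
    tangent space. *)
Lemma gradient_matrix X p U : is_affine_tangent_space X p U ->
  exists r (fs : 'I_r -> {mpoly F[w]}), [/\ forall i, vanishing_ideal X (fs i),
    row_free (\matrix_i grad (fs i) (rep p)) & (w <= r + \dim U)%N].
Proof.
move=> pU; pose good r := exists2 fs : 'I_r -> {mpoly F[w]}, forall i, vanishing_ideal X (fs i) &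
  row_free (\matrix_i grad (fs i) (rep p)).
have ex0 : exists r, `[< good r >].
  exists 0%N; apply/asboolP; exists (fun=> 0); first by case.
  by rewrite /row_free eqn_leq rank_leq_row.
have ub r : `[< good r >] -> (r <= w)%N.
  by move=> /asboolP[fs _ /eqP <-]; apply: rank_leq_col.
case: (ex_maxnP ex0 ub) => r /asboolP[fs fsI fsG] rmax.
exists r, fs; split=> //; set G := \matrix_i _ in fsG.
have GI f : vanishing_ideal X f -> (grad f (rep p) <= G)%MS.
  move=> If; apply: contrapT => /negP fG; have : (r.+1 <= r)%N; last by rewrite ltnn.
  apply: rmax; apply/asboolP.
  pose gs (i : 'I_(1 + r)) := match split i with inl _ => f | inr j => fs j end.
  have gsI (i : 'I_(1 + r)) : vanishing_ideal X (gs i) by rewrite /gs; case: (split i).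
  exists gs; first exact: gsI.
  rewrite (_ : \matrix_(i < 1 + r) grad (gs i) (rep p) = col_mx (grad f (rep p)) G); last first.
    apply/row_matrixP=> i; rewrite rowK /gs -[i]splitK unsplitK; case: (split i) => j /=.
      by rewrite rowKu; apply/rowP=> l; rewrite !mxE.
    by rewrite rowKd rowK.
  apply: (@inj_row_free _ (1 + r)) => y; rewrite -[y]hsubmxK mul_row_col [lsubmx y]mx11_scalar mul_scalar_mx.
  set c := _ 0 0; have [-> |cN0] := eqVneq c 0.
    rewrite scale0r add0r => /eqP; rewrite mulmx_free_eq0 // => /eqP->.
    by rewrite raddf0 row_mx0.
  move/eqP; rewrite addr_eq0 => /eqP E; case/negP: fG.
  rewrite -[grad _ _]scale1r -(mulVf cN0) -scalerA E scalemx_sub // eqmx_opp.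
  exact: submxMl.
pose K := row_base (kermx G^T).
have KG : K *m G^T = 0 by apply/sub_kermxP; rewrite eq_row_base.
suff : (\rank (kermx G^T) <= \dim U)%N by rewrite mxrank_ker mxrank_tr (eqP fsG) leq_subLR.
apply: (@dim_ge_rows _ K U (row_base_free _)) => i v vE; apply/pU => f If.
rewrite -/(dmev f (rep p) v) dmev_grad; have /submxP[D ->] := GI f If.
rewrite -mulmxA vE -[G *m _]trmxK trmx_mul trmxK -row_mul KG.
by rewrite linear0 trmx0 mulmx0 mxE.
Qed.

(** A determinant that witnesses the independence of the gradients at p cannot vanish on all of A,
    and where it is nonzero the tangent space is no larger than at p. *)
Lemma tangent_semicontinuous X A p U : is_affine_tangent_space X p U -> zclosure A p ->
  (forall q U', A q -> is_affine_tangent_space X q U' -> (\dim U < \dim U')%N) -> False.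
Proof.
move=> pU Ap AU; have [r [fs [fsI fsG rU]]] := gradient_matrix pU.
have [D GD] := row_freeP fsG.
have [i0 ci0] : exists i, coord (vbasis {:W}) i (rep p) != 0.
  apply: contrapT => /forallNP H; case/eqP: (rep_neq0 p); rewrite (coord_sum (rep p)) big1 // => j _.
  by rewrite (_ : coord _ _ _ = 0) ?scale0r //; apply/eqP/negPn/negP/H.
(* The coordinate, nonzero at p, makes [h] vanish at the zero vector of every line, where the
   determinant is not controlled. *)
pose h (x : W) := \det ((\matrix_i grad (fs i) x) *m D) * coord (vbasis {:W}) i0 x.
have ph : pfun h.
  apply: pfunM; last by apply: pfun_linear => a u v; rewrite linearP.
  apply: pfun_det => i j; apply: (@eq_pfun _ _ (fun x => \sum_l mev ((fs i)^`M(l)) x * D l j)) => [x|].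
    by rewrite !mxE; apply: eq_bigr => l _; rewrite !mxE.
  by apply: pfun_sum => l _; apply: pfunM; [exists ((fs i)^`M(l))|apply: pfunC].
suff hA : cvanish A h.
  have := cvanish_closure F0 ph hA Ap (mem_rep p).
  by rewrite /h GD det1 mul1r => /eqP; apply/negP.
move=> q v Aq; rewrite val_rep => /vlineP[s ->]; rewrite /h.
have [->|s0] := eqVneq s 0; first by rewrite scale0r linear0 mulr0.
rewrite (_ : \det _ = 0) ?mul0r //; set G := \matrix_i _.
have [U' qU'] := exists_tangent_space X q.
have rG : (\rank G + \dim U' <= w)%N.
  apply: dim_le_rank => u uU; apply/colP=> i; rewrite [RHS]mxE.
  rewrite -[RHS](tangent_scale qU' (fsI i) s0 uU) dmev_grad.
  by rewrite !mxE; apply: eq_bigr => l _; rewrite !mxE.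
apply/eqP/negPn/negP; rewrite -unitfE -unitmxE -row_free_unit => /eqP GDr.
have rr := mxrankM_maxl G D; rewrite GDr in rr.
by have := leq_trans (leq_add rr (AU q U' Aq qU')) (leq_trans rG rU); rewrite addnS ltnn.
Qed.

End TangentSemicontinuity.

(** The two sides agree at a = b = 1, which [3 <= a + b] excludes. *)
Lemma slot_count a b m : (1 <= a)%N -> (a <= b)%N -> (3 <= a + b)%N -> m = (b + 2)%N ->
  (((2 + a) * m).*2.+2 < 6 + 4 * b + 4 * a + 6 * a * b)%N.
Proof. by move=> a1 ab ab3 ->; nia. Qed.

(** * The singular locus *)

Section SingularLocus.
Variables (F : closedFieldType) (F0 : [pchar F] =i pred0) (V : vectType F).
Local Open Scope classical_set_scope.
Local Notation n := (\dim {:V}).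

Lemma Sing_secant (k : nat) : (3 <= k)%N -> (2 * k <= n)%N -> (7 <= n)%N ->
  Sing (secant_variety (Gr V k)) = zclosure (Sigma2 V k).
Proof.
case: k => [|[|a]] // k3; rewrite -[a.+2]/(2 + a)%N in k3 * => kn n7.
pose m := (n - (2 + a))%N.
have m3 : (3 <= m)%N by rewrite /m; lia.
have kmn : (2 + a + m)%N = n by rewrite /m; lia.
have kn' : (2 + a <= n)%N by lia.
have kn2 : (2 + a + 2 <= n)%N by lia.
have nf := @sigma2_normal F F0 V (2 + a) isT (lshift a 0) (lshift a 1) erefl erefl.
have Sigma2_secant q : Sigma2 V (2 + a) q -> secant_variety (Gr V (2 + a)) q.
  by move=> /nf[N [T [_ qE]]]; apply: subset_zclosure; apply: secant_point qE.
apply/seteqP; split=> p.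
  move=> [sp nreg]; have [Z Z0] := ev_neq0 (rep_neq0 p).
  have c30 Y i j l u v w : i != j -> i != l -> j != l -> c3 (ev (rep p)) Y i j l u v w = 0.
    move=> ij il jl; apply/eqP/negPn/negP => c0.
    by apply: nreg; apply: (regular_of_c3 F0 k3 m3 kmn ij il jl sp Z0 c0).
  have i01 : lshift a (0 : 'I_2) != lshift a 1 by rewrite eq_lshift.
  have [||i0 [i1 [A [B [i01' AB pE]]]]] := classify F0 c30 _ _ i01 (ex_intro _ Z Z0).
  - by move=> Y i j l u v w z Y0 ij il; apply: (secant_rows F0 _ kn').
  - by move=> Y i j l q u v Y0 ij il iq jl jq lq; apply: (secant_columns F0 _ kn').
  exact: (@sigma2_closure F F0 V (2 + a) isT kn2 i0 i1 i01' A B p AB pE).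
move=> Sp; split.
  by apply: (zclosure_sub _ Sigma2_secant Sp); apply: zclosed_zclosure.
move=> [U [d [pU [ch _] dU]]].
apply: (tangent_semicontinuous F0 pU Sp) => q U' Sq qU'.
have [N [T [NT qE]]] := nf q Sq.
have [b [M [T' [e NMT]]]] := extend_rows NT.
apply: leq_trans (sigma2_tangent_dim F0 kn' NMT qE qU'); rewrite dU.
have := secant_local_dim_le F0 k3 kmn ch.
rewrite -ltnS => dk; apply: leq_ltn_trans dk _.
by apply: slot_count; lia.
Qed.

End SingularLocus.

Local Close Scope ring_scope.

Theorem mainTheorem1 (F : closedFieldType) (hF : [pchar F]%R =i pred0)
    (V : vectType F) (k : nat) (hk3 : 3 <= k) (hkn : 2 * k <= \dim {:V})
    (hn : 7 <= \dim {:V}) :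
  Sing (secant_variety (Gr V k)) = zclosure (Sigma2 V k).
Proof. exact: (Sing_secant hF). Qed.
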